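(* Let $H=\lambda V+W$ be the model described in the context, with $\lambda\in\mathcal D_{\lambda_0}$. Let $\mu_1\le\dots\le\mu_N$ be the eigenvalues of $H$ and $\boldsymbol u_1,\dots,\boldsymbol u_N$ associated $\ell^2$-normalized eigenvectors, $\boldsymbol u_\alpha=(u_\alpha(i))_{i=1}^N$. Then there is a constant $\nu>0$, depending on $\theta$, $C_0$, $\lambda_0$, $E_0$, $A_0$ and the measure $\mu$, such that for any $\xi$ satisfying $a_0<\xi\le A_0\log\log N$ we have $$\max_{1\le\alpha\le N}\ \max_{1\le i\le N}|u_\alpha(i)|\le\frac{(\varphi_N)^{4\xi}}{\sqrt N}$$ with $(\xi,\nu)$-high probability.
   Context: Model. For each $N$, $W=(w_{ij})$ is an $N\times N$ random matrix whose entries are independent up to the symmetry constraint $w_{ij}=\overline{w_{ji}}$, centered, complex, with $\mathbb E w_{ii}^2=\frac1N$, $\mathbb E|w_{ij}|^2=\frac1N$, $\mathbb E w_{ij}^2=0$ ($i\neq j$), and $\mathbb P(\sqrt N|w_{ij}|>x)\le C_0e^{-x^{1/\theta}}$ for fixed constants $C_0>0$, $\theta>1$. $V=\operatorname{diag}(v_1,\dots,v_N)$ has real, centered, i.i.d. entries with law $\mu$, $\operatorname{supp}\mu=[-1,1]$, and is independent of $W$. $H=\lambda V+W$. Fix $\lambda_0>0$, $\mathcal D_{\lambda_0}=\{\lambda\in\mathbb R^+:\lambda\le\lambda_0\}$ and $E_0\ge3+\lambda_0$. Assumption on $\lambda,\mu$ (for every $\lambda\in\mathcal D_{\lambda_0}$):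 if $\lambda\le1$, $\mu$ has a continuous density $\mu(v)$ with $\mu(v)>0$ for $v\in(-1,1)$ and $\mu(v)=0$ for $v\notin[-1,1]$; if $\lambda>1$, $\mu$ is a centered Jacobi measure, i.e. has density $Z^{-1}(1+v)^{a}(1-v)^{b}d(v)\mathbf 1_{[-1,1]}(v)$ with $d\in C^1([-1,1])$, $d>0$ on $[-1,1]$, $Z$ a normalization, and either $-1<a,b\le1$, or $1<a,b<\infty$ and $\lambda<\lambda_1$, $\lambda<\lambda_2$, where $\lambda_1=(\int(1+v)^{-2}d\mu(v))^{1/2}$, $\lambda_2=(\int(1-v)^{-2}d\mu(v))^{1/2}$. Parameters. $\varphi_N=(\log N)^{C_\varphi}$ and $\xi=\xi_N$ satisfies $a_0<\xi\le A_0\log\log N$, where $a_0>2$, $A_0\ge10$, $C_\varphi\ge1$ are fixed constants, depending only on $\theta,C_0$, chosen such that the following large deviation estimates hold for $N$ sufficiently large and all $a_0\le\xi\le A_0\log\log N$: for independent centered complex random variables $(a_i),(b_i)$ with variance $\sigma^2$ and $\mathbb P(|a_i|\ge x\sigma)\le C_0e^{-x^{1/\theta}}$, $\mathbb P(|b_i|\ge x\sigma)\le C_0e^{-x^{1/\theta}}$, and $A_i,B_{ij}\in\mathbb C$, each of the events $|\sum_iA_ia_i|\ge\varphi_N^\xi\sigma(\sum_i|A_i|^2)^{1/2}$; $|\sum_i\bar a_iB_{ii}a_i-\sum_i\sigma^2B_{ii}|\ge\varphi_N^\xi\sigma^2(\sum_i|B_{ii}|^2)^{1/2}$; $|\sum_{i\ne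 j}\bar a_iB_{ij}a_j|\ge\varphi_N^\xi\sigma^2(\sum_{i\neq j}|B_{ij}|^2)^{1/2}$; $|\sum_{i,j}\bar a_iB_{ij}b_j|\ge\varphi_N^\xi\sigma^2(\sum_{i,j}|B_{ij}|^2)^{1/2}$ has probability at most $e^{-(\log N)^\xi}$. An event $\Omega$ has $(\xi,\nu)$-high probability if $\mathbb P(\Omega^c)\le e^{-\nu(\log N)^\xi}$ for $N$ sufficiently large. *)

(* Defs.v *)
From HB Require Import structures.
From mathcomp Require Import all_boot all_order all_algebra.
From mathcomp Require Import complex.
From mathcomp Require Import all_classical all_reals all_analysis.

Set Implicit Arguments.
Unset Strict Implicit.
Unset Printing Implicit Defensive.

Import Order.TTheory GRing.Theory Num.Theory.
Import numFieldNormedType.Exports.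

Local Open Scope classical_set_scope.
Local Open Scope ring_scope.
Local Open Scope complex_scope.

(* The Borel structure on R[i] is that of R * R: a complex random variable is
   a function X whose composition with [reim] is measurable. *)
Definition reim (R : realType) (z : R[i]) :
  measurableTypeR R * measurableTypeR R := (complex.Re z, complex.Im z).

(* [fine] is harmless here: it is only used under tail bounds that make all
   moments finite. *)
Definition cexpectation d (T : measurableType d) (R : realType)
    (P : probability T R) (X : T -> R[i]) : R[i] :=
  fine 'E_P[fun t => complex.Re (X t)] +i* fine 'E_P[fun t => complex.Im (X t)].

Definition mutually_independent d d' (T : measurableType d)
    (S : measurableType d') (R : realType) (P : probability T R)
    (I : finType) (X : I -> T -> S) : Prop :=
  forall (J : {set I}) (B : I -> set S),
    (forall i, measurable (B i)) ->
    (P (\bigcap_(i in [set k | k \in J]) X i @^-1` B i) =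
     \prod_(i in J) P (X i @^-1` B i))%E.

Definition sigma_generated (T : Type) d' (S : measurableType d') (I : Type)
    (X : I -> T -> S) : set (set T) :=
  <<s [set A | exists i B, measurable B /\ A = X i @^-1` B] >>.

Definition independent_families d d1 d2 (T : measurableType d)
    (S1 : measurableType d1) (S2 : measurableType d2) (R : realType)
    (P : probability T R) (I1 I2 : Type)
    (X : I1 -> T -> S1) (Y : I2 -> T -> S2) : Prop :=
  forall A B, sigma_generated X A -> sigma_generated Y B ->
    (P (A `&` B) = P A * P B)%E.

Definition varphi (R : realType) (Cphi : R) (N : nat) : R :=
  ln N%:R `^ Cphi.

(* The complement of [Omega N] is only required to be contained in a measurable
   event of small probability. For measurable [Omega N] this is the bound
   P(~` Omega N) <= exp(- nu (log N)^xi); in general it avoids evaluating [P]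
   on a non-measurable set, where its value is meaningless. *)
Definition high_probability (R : realType) (xi : nat -> R) (nu : R)
    (d : nat -> measure_display) (T : forall N, measurableType (d N))
    (P : forall N, probability (T N) R) (Omega : forall N, set (T N)) : Prop :=
  \forall N \near \oo, exists A : set (T N),
    [/\ measurable A, ~` Omega N `<=` A &
        (P N A <= (expR (- (nu * ln N%:R `^ xi N)))%:E)%E].

Definition centered_subexp d (T : measurableType d) (R : realType)
    (P : probability T R) (theta C0 sigma : R) (X : T -> R[i]) : Prop :=
  [/\ measurable_fun setT (@reim R \o X),
      cexpectation P X = 0,
      ('E_P[fun t => (Normc.normc (X t) ^+ 2)%R] = (sigma ^+ 2)%:E)%E &
      forall x, 0 < x ->
        (P [set t | (x * sigma <= Normc.normc (X t))%R]
           <= (C0 * expR (- (x `^ theta^-1)))%:E)%E].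

(* In each estimate the coefficients are assumed not to vanish identically:
   otherwise both sides of the inequality defining the event are 0, the event
   is the whole space, and no choice of constants could satisfy the bound. *)
Definition large_deviation_estimates (R : realType)
    (theta C0 a0 A0 Cphi : R) : Prop :=
  \forall N \near \oo, forall xi : R,
    a0 <= xi -> xi <= A0 * ln (ln N%:R) ->
  let K := varphi Cphi N `^ xi in
  let small d (T : measurableType d) (P : probability T R) (E : set T) :=
    (P E <= (expR (- (ln N%:R `^ xi)))%:E)%E in
  forall d (T : measurableType d) (P : probability T R) (sigma : R),
    0 < sigma ->
  forall a : 'I_N -> T -> R[i],
    (forall i, centered_subexp P theta C0 sigma (a i)) ->
    mutually_independent P (fun i => @reim R \o a i) ->
  [/\ forall A : 'I_N -> R[i],
        let S := \sum_i Normc.normc (A i) ^+ 2 in 0 < S ->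
        small d T P
          [set t | K * sigma * Num.sqrt S <= Normc.normc (\sum_i A i * a i t)],
      forall B : 'I_N -> 'I_N -> R[i],
        let S := \sum_i Normc.normc (B i i) ^+ 2 in 0 < S ->
        small d T P
          [set t | K * sigma ^+ 2 * Num.sqrt S <=
             Normc.normc (\sum_i (a i t)^*%C * B i i * a i t
                      - \sum_i (sigma ^+ 2)%:C * B i i)],
      forall B : 'I_N -> 'I_N -> R[i],
        let S := \sum_i \sum_(j | i != j) Normc.normc (B i j) ^+ 2 in 0 < S ->
        small d T P
          [set t | K * sigma ^+ 2 * Num.sqrt S <=
             Normc.normc (\sum_i \sum_(j | i != j) (a i t)^*%C * B i j * a j t)] &
      forall b : 'I_N -> T -> R[i],
        (forall i, centered_subexp P theta C0 sigma (b i)) ->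
        mutually_independent P
          (fun k : 'I_N + 'I_N =>
             match k with
             | inl i => @reim R \o a i
             | inr i => @reim R \o b i
             end) ->
      forall B : 'I_N -> 'I_N -> R[i],
        let S := \sum_i \sum_j Normc.normc (B i j) ^+ 2 in 0 < S ->
        small d T P
          [set t | K * sigma ^+ 2 * Num.sqrt S <=
             Normc.normc (\sum_i \sum_j (a i t)^*%C * B i j * b j t)]].

Definition coupling_domain (R : realType) (lambda0 : R) : set R :=
  [set lambda | 0 < lambda /\ lambda <= lambda0].

Definition msupport (R : realType) (mu : probability (measurableTypeR R) R) :
    set R :=
  [set x | forall U : set R, open U -> U x -> (0 < mu U)%E].

Definition has_density (R : realType) (mu : probability (measurableTypeR R) R)
    (f : R -> R) : Prop :=
  [/\ measurable_fun setT (f : measurableTypeR R -> R),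
      forall v, 0 <= f v &
      forall A : set (measurableTypeR R), measurable A ->
        (mu A = \int[lebesgue_measure]_(v in A) (f v)%:E)%E].

Definition C1_on (R : realType) (x y : R) (f : R -> R) : Prop :=
  exists f' : R -> R,
    [/\ {within `[x, y], continuous f}, {within `[x, y], continuous f'} &
        forall v, v \in `]x, y[ -> is_derive v 1 f (f' v)].

Definition jacobi_density (R : realType) (Z a b : R) (dd : R -> R) (v : R) : R :=
  Z^-1 * (1 + v) `^ a * (1 - v) `^ b * dd v * \1_(`[-1, 1] : set R) v.

Definition is_jacobi (R : realType) (mu : probability (measurableTypeR R) R)
    (a b : R) : Prop :=
  exists (Z : R) (dd : R -> R),
    [/\ 0 < Z, C1_on (-1) 1 dd, forall v, v \in `[-1, 1] -> 0 < dd v &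
        has_density mu (jacobi_density Z a b dd)].

Definition lambda1 (R : realType) (mu : probability (measurableTypeR R) R) :
    \bar R :=
  ((\int[mu]_v ((1 + v) ^- 2)%:E) `^ (2^-1)%R)%E.

Definition lambda2 (R : realType) (mu : probability (measurableTypeR R) R) :
    \bar R :=
  ((\int[mu]_v ((1 - v) ^- 2)%:E) `^ (2^-1)%R)%E.

(* For lambda <= 1 continuity of the density is required on ]-1, 1[ only: it may
   jump or blow up at the endpoints, as the Jacobi densities allowed for
   lambda > 1 do when an exponent is <= 0. *)
Definition admissible_law (R : realType) (lambda : R)
    (mu : probability (measurableTypeR R) R) : Prop :=
  (lambda <= 1 ->
     exists f : R -> R,
       [/\ has_density mu f,
           forall v, v \in `]-1, 1[ -> {for v, continuous f},
           forall v, v \in `]-1, 1[ -> 0 < f v &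
           forall v, v \notin `[-1, 1] -> f v = 0]) /\
  (1 < lambda ->
     exists a b : R, is_jacobi mu a b /\
       ([/\ -1 < a, a <= 1, -1 < b & b <= 1] \/
        [/\ 1 < a, 1 < b,
            (lambda%:E < lambda1 mu)%E & (lambda%:E < lambda2 mu)%E])).

Record wigner d (T : measurableType d) (R : realType) (P : probability T R)
    (theta C0 : R) (N : nat) (W : T -> 'M[R[i]]_N) : Prop := Wigner {
  wigner_measurable :
    forall i j, measurable_fun setT (fun t => reim (W t i j));
  wigner_hermitian : forall t i j, W t i j = (W t j i)^*;
  wigner_independent :
    mutually_independent P
      (fun (p : {ij : 'I_N * 'I_N | (ij.1 <= ij.2)%N}) t =>
         reim (W t (val p).1 (val p).2));
  wigner_centered : forall i j, cexpectation P (fun t => W t i j) = 0;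
  wigner_diag :
    forall i, cexpectation P (fun t => W t i i ^+ 2) = (N%:R^-1)%:C;
  wigner_variance :
    forall i j, i != j ->
      ('E_P[fun t => (Normc.normc (W t i j) ^+ 2)%R] = (N%:R^-1)%:E)%E;
  wigner_pseudovariance :
    forall i j, i != j -> cexpectation P (fun t => W t i j ^+ 2) = 0;
  wigner_tail :
    forall i j x, 0 < x ->
      (P [set t | (x < Num.sqrt N%:R * Normc.normc (W t i j))%R]
         <= (C0 * expR (- (x `^ theta^-1)))%:E)%E }.

Record iid_with_law d (T : measurableType d) (R : realType)
    (P : probability T R) (mu : probability (measurableTypeR R) R) (N : nat)
    (v : 'I_N -> T -> measurableTypeR R) : Prop := IidWithLaw {
  iid_measurable : forall i, measurable_fun setT (v i);
  iid_law : forall i (B : set (measurableTypeR R)), measurable B ->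
    P (v i @^-1` B) = mu B;
  iid_independent : mutually_independent P v }.

Record deformed_wigner d (T : measurableType d) (R : realType)
    (P : probability T R) (theta C0 : R)
    (mu : probability (measurableTypeR R) R) (N : nat)
    (v : 'I_N -> T -> measurableTypeR R) (W : T -> 'M[R[i]]_N) : Prop :=
  DeformedWigner {
  dw_wigner : wigner P theta C0 W;
  dw_potential : iid_with_law P mu v;
  dw_independent :
    independent_families P v
      (fun (ij : 'I_N * 'I_N) t => reim (W t ij.1 ij.2)) }.

Definition hamiltonian (T : Type) (R : realType) (lambda : R) (N : nat)
    (v : 'I_N -> T -> R) (W : T -> 'M[R[i]]_N) (t : T) : 'M[R[i]]_N :=
  lambda%:C *: diag_mx (\row_i (v i t)%:C) + W t.

(* Eigenvalues in nondecreasing order, repeated according to multiplicity; the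
   eigenvectors are normalized but not required to be mutually orthogonal. *)
Record eigen_system (R : realType) (N : nat) (H : 'M[R[i]]_N)
    (e : 'I_N -> R) (u : 'I_N -> 'cV[R[i]]_N) : Prop := EigenSystem {
  eigen_sorted : forall al be : 'I_N, (al <= be)%N -> e al <= e be;
  eigen_char_poly : char_poly H = \prod_al ('X - ((e al)%:C)%:P);
  eigen_vector : forall al, H *m u al = (e al)%:C *: u al;
  eigen_normalized : forall al, \sum_i Normc.normc (u al i 0) ^+ 2 = 1 }.

(* Main.v *)
Require Import Defs.
From HB Require Import structures.
From mathcomp Require Import all_boot all_order all_algebra.
From mathcomp Require Import complex finmap zify ring lra.
From mathcomp Require Import all_classical all_reals all_analysis.
From mathcomp Require Import measurable_realfun.

Set Implicit Arguments.
Unset Strict Implicit.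
Unset Printing Implicit Defensive.

Import Order.TTheory GRing.Theory Num.Theory.
Import numFieldNormedType.Exports.

Local Open Scope classical_set_scope.
Local Open Scope ring_scope.
Local Open Scope complex_scope.

(* Fix z = E + i eta, let G be the resolvent of H at z, m = tr G / N and
   w = z + m. The Schur complement formula and the large deviation estimates,
   applied conditionally on everything but column i, give
   1 / G_ii = lambda v_i - w + Y_i with |Y_i| small. Call z good when
   N eta Im w >= K ^ 4, with K = varphi_N ^ xi. At a good z the Y_i are small
   relative to Im w, and the imaginary part of the formula for G_ii yields
   N^-1 sum_i |lambda v_i - w| ^ -2 <= 1 + o(1). On the other hand the
   hypotheses on mu imply that lambda ^ 2 < \int (v - s) ^ -2 dmu(v) for
   every s in [-1, 1], so w must stay at a distance c > 0 from
   lambda [-1, 1]. At a z with eta0 = K ^ 6 / N that is not good, follow eta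
   upwards to the first good value: below it Im m <= K ^ 4 / (N eta), whence
   by Cauchy-Schwarz w has moved only by O(K ^ -2), and is still at distance
   c / 2. So |G_ii| <= 2 / c whenever eta = eta0, without any local law, and
   |u(i)| ^ 2 <= 2 eta0 |G_ii| for an eigenvector u whose eigenvalue is within
   eta0 of E. *)

(** * Resolvents of Hermitian matrices *)

(** The large deviation estimates concern deterministic coefficients and one [z] at a time, and this
    shapes the proof. Quadratic forms with random coefficients are reduced to them by conditioning
    on everything outside row and column [i]. All estimates are used at polynomially many points
    only, so that the union bound costs no more than half of the exponent. For this reason the climb
    in [eta] runs along the integer multiples of [eta0], and no continuity in [z] is invoked.

    The exponents are tied together. A point that is not good has Im w < K ^ 4 / (N eta), which at
    [eta0] is K ^ -2; hence the sixth power. The resulting bound on |u(i)| ^ 2 is of order K ^ 6 /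
    N, and the two powers of K left below the target K ^ 8 / N absorb the constant 4 / c.

    The constants [c], [eps], [delta] depend on [lambda], but they only influence how large N has to
    be, so [nu] can be the same for all couplings. *)

Section ComplexModulus.
Variable R : rcfType.
Implicit Types (x y z : R[i]).
Local Notation normc := (@Normc.normc R).

Lemma normc_sqrE z : normc z ^+ 2 = complex.Re z ^+ 2 + complex.Im z ^+ 2.
Proof. by case: z => a b /=; rewrite sqr_sqrtr // addr_ge0 ?sqr_ge0. Qed.

Lemma normc_ge0 z : 0 <= normc z.
Proof. by case: z => a b /=; exact: sqrtr_ge0. Qed.

Lemma ler_normcD x y : normc (x + y) <= normc x + normc y.
Proof. exact: (@le_normcD R x y). Qed.

Lemma normc_opp z : normc (- z) = normc z.
Proof. exact: (@normcN R z). Qed.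

Lemma ler_normcB x y : normc (x - y) <= normc x + normc y.
Proof. by rewrite -(normc_opp y) ler_normcD. Qed.

Lemma Im_le_normc z : `|complex.Im z| <= normc z.
Proof.
by case: z => a b /=; rewrite -(sqrtr_sqr b) ler_wsqrtr // lerDr sqr_ge0.
Qed.

Lemma normc_real (a : R) : normc a%:C = `|a|.
Proof. by rewrite /= expr0n addr0 sqrtr_sqr. Qed.

Lemma mulc_conj z : z * z^* = (normc z ^+ 2)%:C.
Proof.
rewrite normc_sqrE; case: z => a b /=; simpc.
by congr (_ +i* _); ring.
Qed.

Lemma Im_sum (I : Type) (s : seq I) (P : pred I) (F : I -> R[i]) :
  complex.Im (\sum_(i <- s | P i) F i) = \sum_(i <- s | P i) complex.Im (F i).
Proof. by apply: big_morph => // -[a b] [c d]. Qed.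

Lemma Im_realM (a : R) z : complex.Im (a%:C * z) = a * complex.Im z.
Proof. by case: z => c d /=; rewrite mul0r addr0. Qed.

Lemma ler_normc_sum (I : Type) (s : seq I) (P : pred I) (F : I -> R[i]) :
  normc (\sum_(i <- s | P i) F i) <= \sum_(i <- s | P i) normc (F i).
Proof.
elim/big_ind2: _ => [|x a y b xa yb|//]; first by rewrite Normc.normc0.
by apply: le_trans (ler_normcD _ _) _; exact: lerD.
Qed.

(** Lagrange's identity: the double sum of squares is twice the gap between the two sides. *)
Lemma cauchy_schwarz (I : finType) (x y : I -> R) :
  (\sum_i x i * y i) ^+ 2 <= (\sum_i x i ^+ 2) * (\sum_i y i ^+ 2).
Proof.
have : 0 <= \sum_i \sum_j (x i * y j - x j * y i) ^+ 2.
  by apply: sumr_ge0 => i _; apply: sumr_ge0 => j _; exact: sqr_ge0.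
suff -> : \sum_i \sum_j (x i * y j - x j * y i) ^+ 2 =
   2 * ((\sum_i x i ^+ 2) * (\sum_i y i ^+ 2) - (\sum_i x i * y i) ^+ 2).
  by rewrite pmulr_rge0 // subr_ge0.
have dist (f g : I -> R) :
    (\sum_i f i) * (\sum_j g j) = \sum_i \sum_j f i * g j.
  by rewrite big_distrl; apply: eq_bigr => i _; rewrite big_distrr.
rewrite mulrBr expr2 !dist mulr2n !mulrDl !mul1r.
rewrite [X in _ + X - _]exchange_big /= -!big_split /= -sumrB.
apply: eq_bigr => i _; rewrite -!big_split /= -sumrB.
by apply: eq_bigr => j _; ring.
Qed.

Lemma cauchy_schwarz_normc (I : finType) (x y : I -> R[i]) :
  normc (\sum_i x i * y i) ^+ 2 <=
  (\sum_i normc (x i) ^+ 2) * (\sum_i normc (y i) ^+ 2).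
Proof.
apply: le_trans (cauchy_schwarz _ _); rewrite lerXn2r ?nnegrE ?normc_ge0 //.
  by apply: sumr_ge0 => i _; rewrite mulr_ge0 ?normc_ge0.
apply: le_trans (ler_normc_sum _ _ _) _.
by apply: ler_sum => i _; rewrite Normc.normcM.
Qed.

Lemma Im_inv z : complex.Im z^-1 = - complex.Im z / normc z ^+ 2.
Proof. by rewrite normc_sqrE; case: z => a b /=; rewrite mulNr. Qed.

End ComplexModulus.

Section Resolvent.
Variables (R : rcfType) (N : nat).
Implicit Types (H : 'M[R[i]]_N) (z : R[i]).
Local Notation normc := (@Normc.normc R).
Local Notation Re := (@complex.Re R).
Local Notation Im := (@complex.Im R).

Definition hermitian H := forall i j, H i j = (H j i)^*.

Definition resolvent H z : 'M[R[i]]_N := invmx (H - z%:M).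

(** For a left null vector [v], the quadratic form [s] of [H] at [v] is real by hermiticity and
    equals [z] times the squared norm of [v]; its imaginary part forces [v] to vanish. *)
Lemma resolvent_unit H z : hermitian H -> 0 < Im z -> H - z%:M \in unitmx.
Proof.
move=> hH z_gt0; rewrite unitmxE unitfE; apply/det0P => -[v v_neq0 vH].
have vHj j : \sum_i v 0 i * H i j = z * v 0 j.
  move/matrixP: vH => /(_ 0 j); rewrite mulmxBr !mxE => /eqP.
  rewrite subr_eq0 => /eqP ->; rewrite (bigD1 j) //= !mxE eqxx mulr1n mulrC.
  rewrite big1 ?addr0 // => i /negPf ij; rewrite !mxE ij.
  by rewrite mulr0n mulr0.
pose s := \sum_j (\sum_i v 0 i * H i j) * (v 0 j)^*.
have sE : s = z * (\sum_j normc (v 0 j) ^+ 2)%:C.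
  rewrite /s rmorph_sum mulr_sumr /=; apply: eq_bigr => j _.
  by rewrite vHj -mulrA mulc_conj.
have s_real : s^* = s.
  rewrite /s rmorph_sum /=.
  under eq_bigr => j _ do rewrite rmorphM rmorph_sum mulr_suml /=.
  rewrite exchange_big /=; apply: eq_bigr => i _.
  rewrite mulr_suml; apply: eq_bigr => j _.
  by rewrite rmorphM /= conjcK -(hH j i) mulrC mulrA mulrAC.
have Im_s : Im s = 0.
  by move: s_real; case: (s) => a b /= [] /eqP; rewrite -subr_eq0 -opprD oppr_eq0 -mulr2n mulrn_eq0 /= => /eqP.
have sum0 : \sum_j normc (v 0 j) ^+ 2 = 0.
  move: Im_s; rewrite sE mulrC Im_realM => /eqP.
  by rewrite mulf_eq0 (gt_eqF z_gt0) orbF => /eqP.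
case/negP: v_neq0; apply/eqP/rowP => j; rewrite mxE.
have /eqP := sum0; rewrite psumr_eq0; last by move=> k _; exact: sqr_ge0.
by move=> /allP /(_ j); rewrite mem_index_enum => /(_ isT) /=;
   rewrite sqrf_eq0 => /eqP /Normc.eq0_normc.
Qed.

Lemma mulmx_resolvent H z : hermitian H -> 0 < Im z ->
  (H - z%:M) *m resolvent H z = 1%:M.
Proof. by move=> hH z_gt0; rewrite mulmxV // resolvent_unit. Qed.

Lemma mul_resolvent_mx H z : hermitian H -> 0 < Im z ->
  resolvent H z *m (H - z%:M) = 1%:M.
Proof. by move=> hH z_gt0; rewrite mulVmx // resolvent_unit. Qed.

(** Both the matrix and the spectral parameter may change: [stieltjes_diff] moves [z], while
    [resolvent_off_minor] erases a row and a column. *)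
Lemma resolvent_diff H1 H2 z1 z2 : hermitian H1 -> hermitian H2 ->
  0 < Im z1 -> 0 < Im z2 ->
  resolvent H1 z1 - resolvent H2 z2 =
  resolvent H1 z1 *m ((H2 - z2%:M) - (H1 - z1%:M)) *m resolvent H2 z2.
Proof.
move=> h1 h2 z1_gt0 z2_gt0.
by rewrite mulmxBr mul_resolvent_mx // mulmxBl mul1mx -mulmxA mulmx_resolvent //
   mulmx1.
Qed.

Let adj (A : 'M[R[i]]_N) : 'M[R[i]]_N := map_mx (@conjc R) A^T.

Lemma adj_resolvent H z : hermitian H -> 0 < Im z ->
  adj (resolvent H z) *m (H - (z^*)%:M) = 1%:M /\
  (H - (z^*)%:M) *m adj (resolvent H z) = 1%:M.
Proof.
move=> hH z_gt0.
have adjM (A B : 'M[R[i]]_N) : adj (A *m B) = adj B *m adj A.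
  by rewrite /adj trmx_mul map_mxM.
have adj1 : adj 1%:M = 1%:M by rewrite /adj trmx1 map_mx1.
have adjH : adj (H - z%:M) = H - (z^*)%:M.
  apply/matrixP => i j; rewrite !mxE rmorphB rmorphMn /= -hH.
  by rewrite eq_sym.
by split; rewrite -adjH -adjM ?mulmx_resolvent ?mul_resolvent_mx.
Qed.

Lemma Im_sub_conj (x y : R[i]) (r : R) :
  x - x^* = (y - y^*) * r%:C -> Im x = Im y * r.
Proof.
case: x y => a b [c d] /(congr1 (@complex.Im R)) /=; lra.
Qed.

(** Ward identity: the resolvent identity between [z] and its conjugate, read at a diagonal entry.
    It turns sums of squared moduli into imaginary parts; [ward_row] is the companion with the
    factors in the other order. *)
Lemma ward_col H z (i : 'I_N) : hermitian H -> 0 < Im z ->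
  Im (resolvent H z i i) = Im z * \sum_k normc (resolvent H z k i) ^+ 2.
Proof.
move=> hH z_gt0; set G := resolvent H z.
have [adjl _] := adj_resolvent hH z_gt0.
have E : G - adj G = (z - z^*) *: (adj G *m G).
  have -> : (z - z^*) *: (adj G *m G) =
      adj G *m ((H - (z^*)%:M) - (H - z%:M)) *m G.
    rewrite opprB [X in _ *m X *m _]addrC addrA subrK -scalemx1 -[z^*%:M]scalemx1 -scalerBl.
    by rewrite -scalemxAr mulmx1 -scalemxAl.
  by rewrite mulmxBr adjl mulmxBl mul1mx -mulmxA mulmx_resolvent // mulmx1.
apply: Im_sub_conj; move/matrixP: E => /(_ i i); rewrite !mxE => ->.
rewrite rmorph_sum /=; congr (_ * _); apply: eq_bigr => k _.
by rewrite !mxE mulrC mulc_conj.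
Qed.

Lemma ward_row H z (i : 'I_N) : hermitian H -> 0 < Im z ->
  Im (resolvent H z i i) = Im z * \sum_k normc (resolvent H z i k) ^+ 2.
Proof.
move=> hH z_gt0; set G := resolvent H z.
have [_ adjr] := adj_resolvent hH z_gt0.
have E : G - adj G = (z - z^*) *: (G *m adj G).
  have -> : (z - z^*) *: (G *m adj G) =
      G *m ((H - (z^*)%:M) - (H - z%:M)) *m adj G.
    rewrite opprB [X in _ *m X *m _]addrC addrA subrK -scalemx1 -[z^*%:M]scalemx1 -scalerBl.
    by rewrite -scalemxAr mulmx1 -scalemxAl.
  by rewrite mulmxBr mulmxBl -mulmxA adjr mulmx1 mul_resolvent_mx // mul1mx.
apply: Im_sub_conj; move/matrixP: E => /(_ i i); rewrite !mxE => ->.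
rewrite rmorph_sum /=; congr (_ * _); apply: eq_bigr => k _.
by rewrite !mxE mulc_conj.
Qed.

(** From u = (e - z) G u, Cauchy-Schwarz and the Ward identity give |u(i)|^2 <= |e - z|^2 Im G_ii /
    Im z. No orthonormal eigenbasis enters, so degenerate eigenvalues need no special care. *)
Lemma eigenvector_resolvent H z (e : R) (u : 'cV[R[i]]_N) (i : 'I_N) :
  hermitian H -> 0 < Im z -> H *m u = e%:C *: u ->
  \sum_k normc (u k 0) ^+ 2 = 1 -> `|e - Re z| <= Im z ->
  normc (u i 0) ^+ 2 <= 2 * Im z * normc (resolvent H z i i).
Proof.
move=> hH z_gt0 Hu u1 ez; set G := resolvent H z.
have Gu : u = (e%:C - z) *: (G *m u).
  rewrite scalemxAr scalerBl -Hu -mul_scalar_mx -mulmxBl mulmxA.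
  by rewrite mul_resolvent_mx // mul1mx.
have uE : u i 0 = (e%:C - z) * \sum_k G i k * u k 0.
  by rewrite {1}Gu !mxE.
rewrite uE Normc.normcM exprMn.
have ez2 : normc (e%:C - z) ^+ 2 <= 2 * Im z ^+ 2.
  rewrite normc_sqrE mulr2n mulrDl mul1r lerD //; last first.
    by case: (z) => a b /=; rewrite sub0r sqrrN.
  rewrite -[leLHS]real_normK ?num_real // lerXn2r ?nnegrE ?(ltW z_gt0) //.
  by case: (z) ez => a b.
have := cauchy_schwarz_normc (G i) (fun k => u k 0); rewrite u1 mulr1 => cs.
have WG := ward_row i hH z_gt0; rewrite -/G in WG.
apply: le_trans (ler_pM (sqr_ge0 _) (sqr_ge0 _) ez2 cs) _.
set S := \sum_k normc (G i k) ^+ 2 in WG *.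
have -> : 2 * Im z ^+ 2 * S = 2 * Im z * (Im z * S) by ring.
rewrite -WG ler_wpM2l //; first by rewrite mulr_ge0 ?ltW.
exact: le_trans (ler_norm _) (Im_le_normc _).
Qed.

Definition stieltjes H z : R[i] := N%:R^-1%:C * \sum_i resolvent H z i i.

Lemma Im_stieltjes H z : Im (stieltjes H z) =
  N%:R^-1 * \sum_i Im (resolvent H z i i).
Proof. by rewrite Im_realM Im_sum. Qed.

Lemma Im_stieltjes_ge0 H z : hermitian H -> 0 < Im z -> 0 <= Im (stieltjes H z).
Proof.
move=> hH z_gt0; rewrite Im_stieltjes mulr_ge0 ?invr_ge0 //.
apply: sumr_ge0 => i _; rewrite ward_col // mulr_ge0 ?(ltW z_gt0) //.
by apply: sumr_ge0 => k _; exact: sqr_ge0.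
Qed.

(** The difference is z1 - z2 times the normalized trace of G1 G2. Cauchy-Schwarz brings in
    Frobenius norms, which the Ward identity turns into Im m / Im z; unlike a plain Lipschitz
    estimate, the bound improves when Im m is small. *)
Lemma stieltjes_diff H z1 z2 : (0 < N)%N -> hermitian H ->
  0 < Im z1 -> 0 < Im z2 ->
  normc (stieltjes H z1 - stieltjes H z2) ^+ 2 * (Im z1 * Im z2) <=
  normc (z1 - z2) ^+ 2 * (Im (stieltjes H z1) * Im (stieltjes H z2)).
Proof.
move=> N_gt0 hH z1_gt0 z2_gt0.
set G1 := resolvent H z1; set G2 := resolvent H z2.
have dG : G1 - G2 = (z1 - z2) *: (G1 *m G2).
  rewrite resolvent_diff // opprB [X in _ *m X *m _]addrC addrA subrK -scalemx1 -[z2%:M]scalemx1.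
  by rewrite -scalerBl -scalemxAr mulmx1 -scalemxAl.
have -> : stieltjes H z1 - stieltjes H z2 =
    N%:R^-1%:C * ((z1 - z2) * \sum_(p : 'I_N * 'I_N) G1 p.1 p.2 * G2 p.2 p.1).
  rewrite /stieltjes -mulrBr -sumrB; congr (_ * _).
  rewrite -(pair_bigA _ (fun i k => G1 i k * G2 k i)) /= mulr_sumr.
  by apply: eq_bigr => i _; move/matrixP: dG => /(_ i i); rewrite !mxE => ->.
rewrite !Normc.normcM normc_real !exprMn.
have := cauchy_schwarz_normc (fun p : 'I_N * 'I_N => G1 p.1 p.2)
  (fun p => G2 p.2 p.1).
rewrite -(pair_bigA _ (fun i k => normc (G1 i k) ^+ 2)) /=.
rewrite -(pair_bigA _ (fun i k => normc (G2 k i) ^+ 2)) /= => cs.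
have W1 : \sum_i \sum_k normc (G1 i k) ^+ 2 = (\sum_i Im (G1 i i)) / Im z1.
  rewrite mulr_suml; apply: eq_bigr => i _; rewrite (ward_row i hH z1_gt0).
  by rewrite mulrAC divff ?mul1r // gt_eqF.
have W2 : \sum_i \sum_k normc (G2 k i) ^+ 2 = (\sum_i Im (G2 i i)) / Im z2.
  rewrite mulr_suml; apply: eq_bigr => i _; rewrite (ward_col i hH z2_gt0).
  by rewrite mulrAC divff ?mul1r // gt_eqF.
rewrite !Im_stieltjes -/G1 -/G2; rewrite W1 W2 in cs.
set X := normc _ ^+ 2 in cs *; set S1 := \sum_i Im (G1 i i) in cs *.
set S2 := \sum_i Im (G2 i i) in cs *.
have N0 : (0 : R) < N%:R^-1 by rewrite invr_gt0 ltr0n.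
rewrite ger0_norm ?(ltW N0) //.
set D := normc _ ^+ 2.
have -> : N%:R^-1 ^+ 2 * (D * X) * (Im z1 * Im z2) =
   N%:R^-1 ^+ 2 * D * (X * (Im z1 * Im z2)) by ring.
have -> : D * (N%:R^-1 * S1 * (N%:R^-1 * S2)) = N%:R^-1 ^+ 2 * D * (S1 * S2).
  by ring.
rewrite ler_wpM2l ?mulr_ge0 ?(ltW N0) ?normc_ge0 //.
rewrite -ler_pdivlMr ?mulr_gt0 //; apply: le_trans cs _.
by rewrite invfM mulrACA.
Qed.

End Resolvent.

(** * Minors and the Schur complement formula *)

Section Minor.
Variables (R : rcfType) (N : nat).
Implicit Types (H : 'M[R[i]]_N) (z : R[i]) (i k l : 'I_N).
Local Notation normc := (@Normc.normc R).
Local Notation Re := (@complex.Re R).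
Local Notation Im := (@complex.Im R).

(* Erasing row and column i instead of deleting them keeps the dimension N, and
   does not change the resolvent off row and column i. *)
Definition minor H i : 'M[R[i]]_N :=
  \matrix_(k, l) if (k == i) || (l == i) then 0 else H k l.

Lemma minor_hermitian H i : hermitian H -> hermitian (minor H i).
Proof.
by move=> hH k l; rewrite !mxE orbC; case: ifP => _ //; rewrite ?rmorph0.
Qed.

(** The erased matrix has the spurious resolvent entry -1/z at [(i, i)]. Replacing it by 0 lets all
    sums run over the full index set. *)
Definition minor_resolvent H i z : 'M[R[i]]_N :=
  \matrix_(k, l) if (k == i) || (l == i) then 0
                 else resolvent (minor H i) z k l.

Lemma resolvent_minor_col H i z k : hermitian H -> 0 < Im z -> k != i ->
  resolvent (minor H i) z k i = 0.
Proof.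
move=> hH z_gt0 ki; have hM := @minor_hermitian H i hH.
have := mul_resolvent_mx hM z_gt0; move/matrixP => /(_ k i); rewrite !mxE.
rewrite (negPf ki) (bigD1 i) //= !mxE eqxx /= mulr1n sub0r big1; last first.
  by move=> j /negPf ji; rewrite !mxE eqxx ji orbT mulr0n subr0 mulr0.
rewrite addr0 => /eqP; rewrite mulf_eq0 oppr_eq0 => /orP[/eqP //|/eqP z0].
by move: z_gt0; rewrite z0 ltxx.
Qed.

Lemma resolvent_minor_row H i z k : hermitian H -> 0 < Im z -> k != i ->
  resolvent (minor H i) z i k = 0.
Proof.
move=> hH z_gt0 ki; have hM := @minor_hermitian H i hH.
have := mulmx_resolvent hM z_gt0; move/matrixP => /(_ i k); rewrite !mxE.
rewrite eq_sym (negPf ki) (bigD1 i) //= !mxE eqxx /= mulr1n sub0r big1; last first.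
  move=> j /negPf ji; rewrite !mxE eqxx /= eq_sym ji.
  by rewrite mulr0n subr0 mul0r.
rewrite addr0 => /eqP; rewrite mulf_eq0 oppr_eq0 => /orP[/eqP z0|/eqP //].
by move: z_gt0; rewrite z0 ltxx.
Qed.

(** [H] and its minor differ only in row and column [i]; the row contributes nothing because
    [resolvent (minor H i) z k i] vanishes. *)
Lemma resolvent_off_minor H i z k l : hermitian H -> 0 < Im z -> k != i ->
  resolvent H z k l = resolvent (minor H i) z k l -
    (\sum_p minor_resolvent H i z k p * H p i) * resolvent H z i l.
Proof.
move=> hH z_gt0 ki; have hM := @minor_hermitian H i hH.
have := resolvent_diff hM hH z_gt0 z_gt0; move/matrixP => /(_ k l).
set G := resolvent H z; set G' := resolvent (minor H i) z.
have D q : (G' *m (H - z%:M - (minor H i - z%:M))) k q =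
    if q == i then \sum_p minor_resolvent H i z k p * H p i else 0.
  rewrite mxE; case: ifP => [/eqP ->|qi].
    apply: eq_bigr => p _; rewrite !mxE (negPf ki) eqxx orbT /=.
    have [-> | pi] /= := eqVneq p i; last by rewrite -/G'; ring.
    by rewrite /G' resolvent_minor_col // !mul0r.
  apply: big1 => p _; rewrite !mxE qi orbF.
  have [-> | pi] /= := eqVneq p i; last by ring.
  by rewrite /G' resolvent_minor_col // !mul0r.
rewrite [RHS]mxE (bigD1 i) //= D eqxx [X in _ = _ + X]big1 => [|q /negPf qi]; last first.
  by rewrite D qi mul0r.
by rewrite !mxE addr0 => <-; ring.
Qed.

(** Substitute [resolvent_off_minor] for the entries G_ki in the entry [(i, i)] of (H - z) G = 1.
    Being a product equal to 1, the identity also shows that G_ii is nonzero. *)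
Lemma schur_complement H i z : hermitian H -> 0 < Im z ->
  resolvent H z i i * (H i i - z -
    \sum_k \sum_l H i k * minor_resolvent H i z k l * H l i) = 1.
Proof.
move=> hH z_gt0; have := mulmx_resolvent hH z_gt0.
move/matrixP => /(_ i i); rewrite [RHS]mxE eqxx mulr1n mxE (bigD1 i) //= => <-.
rewrite !mxE eqxx mulr1n mulrC mulrBl; congr (_ + _).
rewrite (bigD1 i) //= [X in X + _]big1 => [|l _]; last first.
  by rewrite mxE eqxx mulr0 mul0r.
rewrite add0r mulr_suml -sumrN; apply: eq_bigr => k ki.
have -> : (H - z%:M) i k = H i k.
  by rewrite !mxE eq_sym (negPf ki) mulr0n subr0.
rewrite (@resolvent_off_minor H i z k i) // resolvent_minor_col // sub0r.
rewrite mulrN mulrA; congr (- (_ * _)).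
by rewrite mulr_sumr; apply: eq_bigr => l _; rewrite mulrA.
Qed.

(** The case [k = i] is included, so that after division by G_ii the identity can be summed over [k]
    to compare the two traces. *)
Lemma resolvent_minor_diff H i z k : hermitian H -> 0 < Im z ->
  resolvent H z k k * resolvent H z i i =
  minor_resolvent H i z k k * resolvent H z i i +
  resolvent H z k i * resolvent H z i k.
Proof.
move=> hH z_gt0; rewrite mxE orbb; case: eqVneq => [->|ki].
  by rewrite mul0r add0r.
rewrite (@resolvent_off_minor H i z k k) //.
rewrite (@resolvent_off_minor H i z k i) //.
by rewrite resolvent_minor_col // mulrBl; ring.
Qed.

Lemma minor_resolvent_ward H i z l : hermitian H -> 0 < Im z ->
  Im (minor_resolvent H i z l l) =
  Im z * \sum_k normc (minor_resolvent H i z k l) ^+ 2.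
Proof.
move=> hH z_gt0; have hM := @minor_hermitian H i hH.
have [->|li] := eqVneq l i.
  rewrite mxE eqxx big1 ?mulr0 // => k _.
  by rewrite mxE eqxx orbT Normc.normc0 expr0n.
rewrite mxE (negPf li) ward_col //; congr (_ * _); apply: eq_bigr => k _.
rewrite mxE (negPf li) orbF; case: eqVneq => [->|//].
by rewrite resolvent_minor_row.
Qed.

End Minor.

Section SchurError.
Variables (R : rcfType) (N : nat) (H : 'M[R[i]]_N) (z : R[i]) (i : 'I_N).
Local Notation normc := (@Normc.normc R).
Local Notation Re := (@complex.Re R).
Local Notation Im := (@complex.Im R).
Hypotheses (hH : hermitian H) (z_gt0 : 0 < Im z).
Let N_gt0 : (0 < N)%N. Proof. by case: N i => // -[]. Qed.
Let Ninv_gt0 : (0 : R) < N%:R^-1. Proof. by rewrite invr_gt0 ltr0n. Qed.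
Let G := resolvent H z.
Let B := minor_resolvent H i z.

Let Gii_neq0 : G i i != 0.
Proof.
apply/eqP => Gii; have := schur_complement i hH z_gt0.
by rewrite -/G Gii mul0r => /esym/eqP; rewrite oner_eq0.
Qed.

(** The trace of [G] minus that of [B], by [trace_minor]. *)
Let trace_defect : R[i] := (\sum_k G k i * G i k) / G i i.

Let trace_minor : \sum_k B k k = \sum_k G k k - trace_defect.
Proof.
rewrite /trace_defect mulr_suml -sumrB; apply: eq_bigr => k _.
apply: (mulIf Gii_neq0); rewrite mulrBl divfK //.
by rewrite /G resolvent_minor_diff // addrK.
Qed.

(** Cauchy-Schwarz bounds the numerator by the column and row sums, both of which the Ward
    identities equate to Im G_ii / Im z. *)
Let trace_defect_le : normc trace_defect <= (Im z)^-1.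
Proof.
rewrite /trace_defect Normc.normcM Normc.normcV.
have nG : 0 < normc (G i i).
  by rewrite lt_neqAle normc_ge0 eq_sym andbT; apply/eqP => /Normc.eq0_normc/eqP;
     rewrite (negPf Gii_neq0).
rewrite ler_pdivrMr // ler_pdivlMl //.
have ImG : Im (G i i) <= normc (G i i).
  exact: le_trans (ler_norm _) (Im_le_normc _).
apply: le_trans ImG.
have cs := cauchy_schwarz_normc (fun k => G k i) (G i).
set S := normc _ in cs *.
have Wc := ward_col i hH z_gt0; have Wr := ward_row i hH z_gt0.
rewrite -/G in Wc Wr.
set a := \sum_k _ in cs Wc; set b := \sum_k _ in cs Wr.
have ab : a = b by apply: (mulfI (lt0r_neq0 z_gt0)); rewrite -Wc -Wr.
rewrite Wr ler_pM2l // -(@ler_pXn2r _ 2) ?nnegrE ?normc_ge0 //.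
  by rewrite [leRHS]expr2 -{1}ab.
by apply: sumr_ge0 => k _; exact: sqr_ge0.
Qed.

(** The error has four sources: the diagonal entry ([e1]), the diagonal and off-diagonal parts of
    the quadratic form ([e2] each), and the replacement of the trace of [B] by that of [G] ([q]). *)
Lemma schur_error (d : R[i]) (e1 e2 q M : R) (m := stieltjes H z) :
  q = (N%:R * Im z)^-1 -> M = Im m -> 0 <= e2 ->
  normc (H i i - d) <= e1 ->
  normc (\sum_k (H k i)^* * B k k * H k i - N%:R^-1%:C * \sum_k B k k)
    <= e2 * N%:R^-1 * Num.sqrt (\sum_k normc (B k k) ^+ 2) ->
  normc (\sum_k \sum_(l | k != l) (H k i)^* * B k l * H l i)
    <= e2 * N%:R^-1 * Num.sqrt (\sum_k \sum_(l | k != l) normc (B k l) ^+ 2) ->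
  normc ((G i i)^-1 - (d - (z + m))) <= e1 + 2 * e2 * Num.sqrt (q * (M + q)) + q.
Proof.
move=> qE ME e2_ge0 Hii diag off.
pose S := \sum_k \sum_l normc (B k l) ^+ 2.
have q_gt0 : 0 < q by rewrite qE invr_gt0 mulr_gt0 ?ltr0n.
have normX k l : (0 : R) <= normc (B k l) ^+ 2 by exact: sqr_ge0.
(* By the Ward identity [S] is Im (tr B) / Im z; passing to tr G costs at most 1 / Im z, whence
   [M + q]. *)
have SE : S <= N%:R ^+ 2 * (q * (M + q)).
  rewrite /S exchange_big /=.
  have -> : \sum_l \sum_k normc (B k l) ^+ 2 = (Im z)^-1 * Im (\sum_l B l l).
    rewrite Im_sum mulr_sumr; apply: eq_bigr => l _.
    by rewrite /B minor_resolvent_ward // mulKf ?lt0r_neq0.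
  have -> : N%:R ^+ 2 * (q * (M + q)) =
     (Im z)^-1 * (N%:R * M + (Im z)^-1).
    rewrite qE; field; rewrite lt0r_neq0 // pnatr_eq0 -lt0n N_gt0 //.
  rewrite ler_wpM2l ?invr_ge0 ?(ltW z_gt0) // trace_minor.
  have -> : N%:R * M = Im (\sum_k G k k).
    rewrite ME Im_stieltjes Im_sum mulrA divff ?mul1r //.
    by rewrite pnatr_eq0 -lt0n.
  have -> : forall x y : R[i], Im (x - y) = Im x - Im y by move=> [? ?] [].
  rewrite lerD2l; apply: le_trans trace_defect_le.
  by apply: le_trans (Im_le_normc _); rewrite -normrN ler_norm.
have sqrtS (s : R) : s <= S ->
    e2 * N%:R^-1 * Num.sqrt s <= e2 * Num.sqrt (q * (M + q)).
  move=> sS; rewrite -mulrA ler_wpM2l // ler_pdivrMl ?ltr0n //.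
  apply: le_trans (ler_wsqrtr (le_trans sS SE)) _.
  by rewrite sqrtrM ?sqr_ge0 // sqrtr_sqr ger0_norm.
have diag_le : \sum_k normc (B k k) ^+ 2 <= S.
  apply: ler_sum => k _; rewrite (bigD1 k) //= lerDl.
  by apply: sumr_ge0 => l _.
have off_le : \sum_k \sum_(l | k != l) normc (B k l) ^+ 2 <= S.
  apply: ler_sum => k _; rewrite [leRHS](bigD1 k) //=.
  under eq_bigl => l do rewrite eq_sym.
  by rewrite lerDr.
have -> : (G i i)^-1 - (d - (z + m)) = (H i i - d)
   - (\sum_k (H k i)^* * B k k * H k i - N%:R^-1%:C * \sum_k B k k)
   - (\sum_k \sum_(l | k != l) (H k i)^* * B k l * H l i)
   + N%:R^-1%:C * trace_defect.
  have := schur_complement i hH z_gt0; rewrite -/G -/B => E.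
  have -> : (G i i)^-1 = H i i - z - \sum_k \sum_l H i k * B k l * H l i.
    by apply: (mulfI Gii_neq0); rewrite E divff.
  have -> : \sum_k \sum_l H i k * B k l * H l i =
      \sum_k (H k i)^* * B k k * H k i +
      \sum_k \sum_(l | k != l) (H k i)^* * B k l * H l i.
    rewrite -big_split /=; apply: eq_bigr => k _; rewrite (bigD1 k) //=.
    rewrite (hH i k); congr (_ + _).
    by apply: eq_bigl => l; rewrite eq_sym.
  have -> : trace_defect = \sum_k G k k - \sum_k B k k.
    by rewrite trace_minor subKr.
  by rewrite /m /stieltjes -/G; ring.
have defect : normc (N%:R^-1%:C * trace_defect) <= q.
  rewrite Normc.normcM normc_real ger0_norm ?(ltW Ninv_gt0) // qE invfM.
  by rewrite ler_wpM2l ?(ltW Ninv_gt0).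
apply: le_trans (ler_normcD _ _) _; apply: lerD defect.
have := le_trans diag (sqrtS _ diag_le); have := le_trans off (sqrtS _ off_le).
move=> off' diag'; apply: le_trans (ler_normcB _ _) _.
have := ler_normcB (H i i - d)
  (\sum_k (H k i)^* * B k k * H k i - N%:R^-1%:C * \sum_k B k k).
lra.
Qed.

End SchurError.

(** * A resolvent bound from the stability of the potential *)

Section ResolventBound.
Variables (R : rcfType) (N : nat) (H : 'M[R[i]]_N) (x : 'I_N -> R).
Variables (K eps c : R).
Local Notation normc := (@Normc.normc R).
Local Notation Re := (@complex.Re R).
Local Notation Im := (@complex.Im R).
Hypothesis hH : hermitian H.
Hypotheses (eps_gt0 : 0 < eps) (eps_le1 : eps <= 1) (c_gt0 : 0 < c)
  (c_le1 : c <= 1).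
Hypotheses (K_eps : 40 / eps <= K) (K_c : 40 / c <= K) (K_N : K ^+ 4 <= N%:R).
Hypothesis stable : forall w : R[i], 0 < Im w ->
  \sum_i normc ((x i)%:C - w) ^- 2 <= (1 + eps) * N%:R ->
  forall i, c <= normc ((x i)%:C - w).

Definition shift z : R[i] := z + stieltjes H z.

Definition schur_gap z i : R[i] :=
  (resolvent H z i i)^-1 - ((x i)%:C - shift z).

(** A linearized form of the usual error K sqrt (Im w / (N eta)). The first term is small relative
    to Im w; the second is comparable to the first at a good point, and is 4 K ^ -3 at height
    [eta0]. *)
Definition schur_bound z : Prop := forall i,
  normc (schur_gap z i) <= Im (shift z) / K + 4 * K ^+ 3 / (N%:R * Im z).

Let K40 : 40 <= K.
Proof.
apply: le_trans K_eps; rewrite ler_pdivlMr //.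
by rewrite ger_pMr.
Qed.

Let K_gt0 : 0 < K. Proof. by apply: lt_le_trans K40. Qed.

Let N_gt0R : 0 < N%:R :> R.
Proof. by apply: lt_le_trans K_N; rewrite exprn_gt0. Qed.

Let N_gt0 : (0 < N)%N. Proof. by move: N_gt0R; rewrite ltr0n. Qed.

Let ImD (a b : R[i]) : Im (a + b) = Im a + Im b. Proof. by case: a b => ? ? []. Qed.

Let Im_shift z : Im (shift z) = Im z + Im (stieltjes H z).
Proof. exact: ImD. Qed.

Let Im_shift_gt0 z : 0 < Im z -> 0 < Im (shift z).
Proof. by move=> z0; rewrite Im_shift ltr_pwDl // Im_stieltjes_ge0. Qed.

Definition good z := K ^+ 4 <= Im (shift z) * (N%:R * Im z).

Let good_gap z i : 0 < Im z -> schur_bound z -> good z ->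
  normc (schur_gap z i) <= 5 / K * Im (shift z).
Proof.
move=> z0 sb gz; apply: le_trans (sb i) _.
have -> : 5 / K * Im (shift z) = Im (shift z) / K + 4 * (Im (shift z) / K).
  by ring.
rewrite lerD2l -mulrA ler_pM2l // ler_pdivrMr ?mulr_gt0 //.
by rewrite mulrAC ler_pdivlMr // -exprSr.
Qed.

Let Im_gapE z i : Im ((resolvent H z i i)^-1) =
  Im (schur_gap z i) - Im (shift z).
Proof.
rewrite /schur_gap; case: (_^-1) => a b; case: (shift z) => p q /=; ring.
Qed.

Let gapE z i : (resolvent H z i i)^-1 = ((x i)%:C - shift z) + schur_gap z i.
Proof. by rewrite /schur_gap; ring. Qed.

Let Im_shift_le z i : 0 < Im z -> Im (shift z) <= normc ((x i)%:C - shift z).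
Proof.
move=> z0; apply: le_trans (Im_le_normc _).
by case: (shift z) => a b /=; rewrite sub0r normrN ler_norm.
Qed.

(** Each Im G_kk is at least Im w |x_k - w| ^ -2 up to a factor close to 1. Their mean is Im m <= Im
    w, so Im w cancels and the hypothesis of [stable] remains. *)
Lemma good_stable z i : 0 < Im z -> schur_bound z -> good z ->
  c <= normc ((x i)%:C - shift z).
Proof.
move=> z0 sb gz; apply: stable; first exact: Im_shift_gt0.
have y0 := Im_shift_gt0 z0; set y := Im (shift z) in y0.
(* [r] is the Schur error relative to Im w; the constant 40 makes it at most [eps / 8]. *)
have [r rE] : exists r : R, r = 5 / K by exists (5 / K).
have r_ge0 : 0 <= r by rewrite rE divr_ge0 // ltW.
have e1 := eps_le1; have e0 := eps_gt0.
have r_eps : r <= eps / 8.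
  rewrite rE ler_pdivrMr //; move: K_eps; rewrite ler_pdivrMr //; lra.
have gap k := good_gap k z0 sb gz; rewrite -/y -rE in gap.
have r1 : 0 < 1 - r by move: eps_le1; lra.
have r2 : 0 < 1 + r by lra.
have Im_lower k : (1 - r) / (1 + r) ^+ 2 * y * normc ((x k)%:C - shift z) ^- 2
    <= Im (resolvent H z k k).
  have gk := gap k.
  rewrite -(invrK (resolvent H z k k)) Im_inv Im_gapE -/y.
  have yk := Im_shift_le k z0; rewrite -/y in yk.
  set D := normc ((x k)%:C - shift z) in yk *.
  have D0 : 0 < D by apply: lt_le_trans yk.
  have up : normc (resolvent H z k k)^-1 <= (1 + r) * D.
    rewrite gapE; apply: le_trans (ler_normcD _ _) _.
    rewrite mulrDl mul1r lerD2l; apply: le_trans gk _; exact: ler_wpM2l.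
  have Yk := Im_le_normc (schur_gap z k).
  have num : (1 - r) * y <= - (Im (schur_gap z k) - y).
    have := le_trans Yk gk; rewrite ler_norml => /andP[_ ?]; lra.
  have up0 : 0 < normc (resolvent H z k k)^-1.
    apply: lt_le_trans (Im_le_normc _); rewrite normr_gt0 Im_gapE -/y.
    rewrite -oppr_eq0 gt_eqF //; apply: lt_le_trans num.
    exact: mulr_gt0.
  have -> : (1 - r) / (1 + r) ^+ 2 * y * D ^- 2 =
     ((1 - r) * y) / ((1 + r) * D) ^+ 2.
    by field; rewrite !gt_eqF.
  apply: ler_pM => //.
  - by rewrite mulr_ge0 // ltW.
  - by rewrite invr_ge0 sqr_ge0.
  - rewrite lef_pV2 ?posrE ?exprn_gt0 ?mulr_gt0 //.
    by rewrite lerXn2r ?nnegrE ?(ltW up0) // mulr_ge0 // ltW.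
set S := \sum_k _.
have SM : (1 - r) / (1 + r) ^+ 2 * y * S <= N%:R * y.
  apply: (@le_trans _ _ (\sum_k Im (resolvent H z k k))).
    by rewrite mulr_sumr; apply: ler_sum => k _; exact: Im_lower.
  have -> : \sum_k Im (resolvent H z k k) = N%:R * Im (stieltjes H z).
    by rewrite Im_stieltjes mulrA divff ?mul1r // gt_eqF.
  by rewrite ler_pM2l // /y Im_shift lerDr ltW.
have : (1 - r) / (1 + r) ^+ 2 * S <= N%:R.
  by move: SM; rewrite mulrAC ler_pM2r.
rewrite mulrAC ler_pdivrMr ?exprn_gt0 //.
have S_ge0 : 0 <= S.
  by apply: sumr_ge0 => k _; rewrite invr_ge0 sqr_ge0.
move=> h; rewrite -(ler_pM2l r1); apply: le_trans h _.
have r_sq : r * r <= r by rewrite ler_piMr //; lra.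
have r_mul : r * eps <= r by rewrite ler_piMr.
(* As 5 r <= eps, the accumulated loss (1 + r)^2 / (1 - r) stays below 1 + eps. *)
have : (1 + r) ^+ 2 <= (1 - r) * (1 + eps) by rewrite expr2; lra.
by move=> ?; rewrite [leRHS]mulrA [leLHS]mulrC ler_pM2r.
Qed.

Section Descent.
Variables (E eta0 : R) (n : nat).
Hypotheses (eta0E : eta0 = K ^+ 6 / N%:R) (top : 1 <= n.+1%:R * eta0).

(** Consecutive heights have ratio at most 2, which is all the resolution that [double_step] asks
    for. *)
Let z (k : nat) : R[i] := E +i* (k.+1%:R * eta0).

Hypothesis bound : forall k, (k <= n)%N -> schur_bound (z k).

Let eta0_gt0 : 0 < eta0.
Proof. by rewrite eta0E divr_gt0 // exprn_gt0. Qed.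

Let z_gt0 k : 0 < Im (z k).
Proof. by rewrite /= mulr_gt0 // ltr0n. Qed.

Let m k := Im (stieltjes H (z k)).

Let m_ge0 k : 0 <= m k. Proof. exact: Im_stieltjes_ge0. Qed.

(** The threshold K ^ 4 / N equals [K ^- 2 * eta0], by the choice of [eta0]. *)
Let badE k : ~~ good (z k) ->
  (m k + k.+1%:R * eta0) * (k.+1%:R * eta0) < K ^- 2 * eta0.
Proof.
rewrite /good -ltNge Im_shift /= -/(m k) addrC => h.
rewrite -(ltr_pM2l N_gt0R) mulrCA.
apply: lt_le_trans h _; rewrite eta0E.
have -> : N%:R * (K ^- 2 * (K ^+ 6 / N%:R)) = K ^+ 4 by field; rewrite !gt_eqF.
by [].
Qed.

(** Carries the bound on Im m at the last bad height over to the first good one. By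
    [stieltjes_diff], (m' - m)^2 <= m' m / 2, which excludes m' > 4 m. *)
Let double_step k : m k.+1 <= 4 * m k.
Proof.
have := stieltjes_diff N_gt0 hH (z_gt0 k.+1) (z_gt0 k).
rewrite -/(m k) -/(m k.+1).
have -> : normc (z k.+1 - z k) ^+ 2 = eta0 ^+ 2.
  by rewrite normc_sqrE /= subrr expr0n add0r -mulrBl -natrB // subSnn mul1r.
rewrite [Im (z _)]/= [Im (z k)]/=.
set D := normc _ ^+ 2 => h.
have DM : (m k.+1 - m k) ^+ 2 <= D.
  rewrite /D -[leLHS]real_normK ?num_real // lerXn2r ?nnegrE ?normc_ge0 //.
  apply: le_trans (Im_le_normc _); rewrite /m.
  by case: (stieltjes H (z k.+1)) => ? ?; case: (stieltjes H (z k)).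
have D2 : 2 * D <= m k.+1 * m k.
  have k1 : (1 : R) <= k.+1%:R by rewrite ler1n.
  have k2 : (2 : R) <= k.+2%:R by rewrite ler_nat.
  have D0 : 0 <= D by rewrite sqr_ge0.
  rewrite -(ler_pM2l (exprn_gt0 2 eta0_gt0)); apply: le_trans h.
  have -> : D * (k.+2%:R * eta0 * (k.+1%:R * eta0)) =
    eta0 ^+ 2 * ((k.+2%:R * k.+1%:R) * D) by ring.
  rewrite ler_wpM2l ?sqr_ge0 // ler_wpM2r //; nra.
have := m_ge0 k; have := m_ge0 k.+1; rewrite leNgt => a b; apply/negP => h4.
nra.
Qed.

Let top_good : good (z n).
Proof.
rewrite /good Im_shift /= -/(m n).
apply: le_trans K_N _; have := top.
move: (_ * eta0) (m n) (m_ge0 n) => e mn mn_ge0 e_ge1.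
by rewrite mulrCA ler_peMr ?(ltW N_gt0R) //; nra.
Qed.

Let first_good : exists2 k, (k <= n)%N &
  good (z k) /\ forall j, (j < k)%N -> ~~ good (z j).
Proof.
have ex : exists k, good (z k) by exists n; exact: top_good.
case: (ex_minnP ex) => k gk kmin; exists k; first exact: kmin top_good.
by split=> // j jk; apply/negP => /kmin; rewrite leqNgt jk.
Qed.

(** With t = K ^ -2 and e the change of height, badness gives m 0 < t, e < t and m k * e < t * eta0.
    Then [stieltjes_diff] bounds the change of the Stieltjes transform by 2 t, to which e < t is
    added. *)
Let shift_close k : (forall j, (j <= k)%N -> ~~ good (z j)) ->
  normc (shift (z k.+1) - shift (z 0)) <= 5 / K ^+ 2.
Proof.
move=> bad; have eta_gt0 := eta0_gt0.
have := badE (bad k (leqnn k)); have := badE (bad 0%N (leq0n k)).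
have := stieltjes_diff N_gt0 hH (z_gt0 k.+1) (z_gt0 0).
rewrite -/(m 0) -/(m k.+1).
have dz : z k.+1 - z 0 = 0 +i* (k.+1%:R * eta0).
  rewrite /z; simpc; congr (_ +i* _); rewrite -[k.+2]addn1 natrD; ring.
have -> : normc (z k.+1 - z 0) ^+ 2 = (k.+1%:R * eta0) ^+ 2.
  by rewrite dz normc_sqrE /= expr0n add0r.
rewrite [Im (z _)]/= [Im (z 0)]/= mul1r.
set D := normc (_ - _) => hD b0 bk.
have mk := double_step k.
have k1 : (1 : R) <= k.+1%:R by rewrite ler1n.
have e2 : k.+2%:R * eta0 = k.+1%:R * eta0 + eta0.
  by rewrite -[k.+2]addn1 natrD mulrDl mul1r.
rewrite e2 in hD; set e := k.+1%:R * eta0 in hD bk e2.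
have e_eta : eta0 <= e by rewrite /e ler_peMl // ltW.
have := m_ge0 0; have := m_ge0 k; have := m_ge0 k.+1.
set t := K ^- 2 in b0 bk *; move=> mk1 mk0 m0.
have t0 : 0 < t by rewrite invr_gt0 exprn_gt0.
have m0t : m 0 < t by nra.
have et : e < t by nra.
have mke : m k * e < t * eta0 by nra.
have D0 : 0 <= D by exact: normc_ge0.
have D2 : D ^+ 2 <= (2 * t) ^+ 2.
  have : D ^+ 2 * (e * eta0) <= e * (4 * t * eta0) * t.
    apply: (@le_trans _ _ (D ^+ 2 * ((e + eta0) * eta0))).
      by rewrite ler_wpM2l ?sqr_ge0 // ler_wpM2r ?(ltW eta0_gt0) // lerDl ltW.
    apply: le_trans hD _.
    have -> : e ^+ 2 * (m k.+1 * m 0) = e * (m k.+1 * e) * m 0 by ring.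
    apply: ler_pM => //; [by rewrite !mulr_ge0 //; lra | | exact: ltW].
    rewrite ler_wpM2l //; [lra | nra].
  have ee : 0 < e * eta0 by rewrite mulr_gt0 //; lra.
  move=> h; rewrite -(ler_pM2r ee); apply: le_trans h _.
  by rewrite le_eqVlt; apply/orP; left; apply/eqP; ring.
have Dt : D <= 2 * t.
  by rewrite -(@ler_pXn2r _ 2) ?nnegrE //; lra.
have -> : shift (z k.+1) - shift (z 0) =
   (z k.+1 - z 0) + (stieltjes H (z k.+1) - stieltjes H (z 0)).
  by rewrite /shift; ring.
apply: le_trans (ler_normcD _ _) _; rewrite -/D dz.
have -> : normc (0 +i* e) = e.
  by rewrite /= expr0n add0r sqrtr_sqr ger0_norm //; lra.
rewrite -/t; lra.
Qed.

Lemma resolvent_diag_bound i :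
  normc (resolvent H (E +i* eta0) i i) <= 2 / c.
Proof.
have z0E : E +i* eta0 = z 0 by rewrite /z mul1r.
rewrite z0E -[resolvent _ _ _ _]invrK Normc.normcV -[2 / c]invrK invfM invrK.
set g := (resolvent _ _ _ _)^-1.
suff h : 2^-1 * c <= normc g.
  have g0 : 0 < normc g by apply: lt_le_trans h; rewrite mulr_gt0 // invr_gt0.
  by rewrite lef_pV2 ?posrE // mulr_gt0 // invr_gt0.
have tri : normc ((x i)%:C - shift (z 0)) <= normc g + normc (schur_gap (z 0) i).
  have -> : (x i)%:C - shift (z 0) = g - schur_gap (z 0) i.
    by rewrite /g gapE; ring.
  exact: ler_normcB.
have Kinv : 40 * K^-1 <= c.
  move: K_c; rewrite ler_pdivrMr // => h.
  by rewrite ler_pdivrMr // mulrC.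
have c1 := c_le1; have Kinv0 : 0 < K^-1 by rewrite invr_gt0.
(* Either [z 0] is good and its own Schur error is relative to Im w, or stability is transported
   down from the first good height. In the latter case Im w < K ^ -2 at [z 0], and the Schur error
   there is at most 5 K ^ -3. *)
have [k kn [gk bad]] := first_good; case: k => [|k] in kn gk bad.
  have ck := good_stable i (z_gt0 0) (bound kn) gk.
  have gap := good_gap i (z_gt0 0) (bound kn) gk.
  have := Im_shift_le i (z_gt0 0); have := Im_shift_gt0 (z_gt0 0).
  move: tri ck gap; set D := normc (_ - _); set y := Im _; set Y := normc (schur_gap _ _).
  move=> tri ck gap y0 yD.
  have sy : K^-1 * y <= y / 40 by rewrite mulrC ler_wpM2l ?(ltW y0) //; lra.
  lra.
have ck := good_stable i (z_gt0 k.+1) (bound kn) gk.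
have close := shift_close bad.
have tri2 : normc ((x i)%:C - shift (z k.+1)) <=
   normc ((x i)%:C - shift (z 0)) + normc (shift (z k.+1) - shift (z 0)).
  have -> : (x i)%:C - shift (z k.+1) =
    ((x i)%:C - shift (z 0)) - (shift (z k.+1) - shift (z 0)) by ring.
  exact: ler_normcB.
have gap := bound (leq0n n) i.
have b0 := badE (bad 0%N isT).
have Im0 : Im (shift (z 0)) < K ^- 2.
  by move: b0; rewrite !mul1r ltr_pM2r // Im_shift addrC /= mul1r.
have q0 : 4 * K ^+ 3 / (N%:R * Im (z 0)) = 4 * K^-1 ^+ 3.
  by rewrite /= mul1r eta0E; field; rewrite !gt_eqF.
rewrite q0 in gap.
have K2 : K ^- 2 = K^-1 ^+ 2 by rewrite exprVn.
rewrite K2 in Im0; rewrite K2 in close.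
move: tri tri2 ck close gap Im0 Kinv.
set D := normc (_ - _); set D' := normc (_ - shift (z k.+1)).
set D'' := normc (shift _ - _); set Y := normc (schur_gap _ _).
set y := Im _; set s := K^-1 in Kinv0 *.
move=> *; have s1 : 40 * s <= 1 by lra.
have : s ^+ 2 <= s / 40 by nra.
have : s ^+ 3 <= s / 40 by nra.
have : y * s <= s / 40 by nra.
move=> *; lra.
Qed.

End Descent.

End ResolventBound.

Lemma sqrt_amgm (R : rcfType) (a b : R) : 0 <= a -> 0 <= b ->
  Num.sqrt (a * b) <= (a + b) / 2.
Proof.
move=> a0 b0; have ab : 0 <= (a + b) / 2 by lra.
rewrite -(ger0_norm ab) -sqrtr_sqr ler_wsqrtr //.
have := sqr_ge0 (a - b); rewrite !expr2; lra.
Qed.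

Section SchurBound.
Variables (R : rcfType) (N : nat) (H : 'M[R[i]]_N) (x : 'I_N -> R).
Local Notation normc := (@Normc.normc R).
Local Notation Re := (@complex.Re R).
Local Notation Im := (@complex.Im R).

Lemma schur_bound_deviations (K : R) z : hermitian H -> (0 < N)%N ->
  1 <= K -> 0 < Im z ->
  (forall i, normc (H i i - (x i)%:C) <= K / Num.sqrt N%:R) ->
  (forall i (B := minor_resolvent H i z),
     normc (\sum_k (H k i)^* * B k k * H k i - N%:R^-1%:C * \sum_k B k k)
       <= K * N%:R^-1 * Num.sqrt (\sum_k normc (B k k) ^+ 2)) ->
  (forall i (B := minor_resolvent H i z),
     normc (\sum_k \sum_(l | k != l) (H k i)^* * B k l * H l i) <=
     K * N%:R^-1 * Num.sqrt (\sum_k \sum_(l | k != l) normc (B k l) ^+ 2)) ->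
  schur_bound H x K z.
Proof.
move=> hH N_gt0 K1 z0 h1 h2 h3 i.
have K0 : 0 < K by lra.
have M0 := Im_stieltjes_ge0 hH z0.
pose q := (N%:R * Im z)^-1.
have q0 : 0 < q by rewrite invr_gt0 mulr_gt0 ?ltr0n.
have := @schur_error R N H z i hH z0 (x i)%:C _ K q _ erefl erefl (ltW K0)
  (h1 i) (h2 i) (h3 i).
rewrite -/(shift H z) -/(schur_gap H x z i) => le_gap; apply: le_trans le_gap _.
have -> : Im (shift H z) = Im z + Im (stieltjes H z).
  by rewrite /shift; case: (z) => ? ?; case: (stieltjes _ _).
rewrite -/q.
have Kinv0 : 0 < K^-1 by rewrite invr_gt0.
(* The two factors are weighted as K ^ 3 q and s / K so that the term in Im w keeps the small
   coefficient 1 / K. *)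
have amgm s : 0 <= s -> K * Num.sqrt (q * s) <= (K ^+ 3 * q + s / K) / 2.
  move=> s0; have -> : K * Num.sqrt (q * s) = Num.sqrt ((K ^+ 3 * q) * (s / K)).
    have -> : K ^+ 3 * q * (s / K) = K ^+ 2 * (q * s) by field; rewrite gt_eqF.
    by rewrite sqrtrM ?sqr_ge0 // sqrtr_sqr ger0_norm // ltW.
  by apply: sqrt_amgm; rewrite !mulr_ge0 ?exprn_ge0 // ltW.
(* This puts the error of the diagonal entry in the same form as that of the quadratic forms. *)
have e1 : K / Num.sqrt N%:R = K * Num.sqrt (q * Im z).
  rewrite -sqrtrV ?ler0n // /q invfM divfK //.
  by rewrite gt_eqF.
rewrite e1; have := amgm _ (ltW z0).
have := amgm (Im (stieltjes H z) + q) (addr_ge0 M0 (ltW q0)).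
have K31 : 1 <= K ^+ 3 by rewrite exprn_ege1.
have qK : q <= K ^+ 3 * q by rewrite ler_peMl // ltW.
have qK1 : q / K <= q by rewrite ler_pdivrMr // ler_peMr // ltW.
have zK : 0 <= Im z / K by rewrite divr_ge0 // ltW.
rewrite -[2 * K * _]mulrA -[4 * _ * _]mulrA; set u := K * Num.sqrt _.
set w := K * Num.sqrt _; rewrite -/q; move=> *; lra.
Qed.

End SchurBound.

(** * Stability of the empirical law of the potential *)

Section EmpiricalStability.
Variables (R : realType) (mu : probability (measurableTypeR R) R) (lambda : R).
Local Notation normc := (@Normc.normc R).
Local Notation Re := (@complex.Re R).
Local Notation Im := (@complex.Im R).

(** Lower bounds on the counts suffice, since stability only requires bounding a sum of nonnegative
    terms from below. *)
Definition typical (Bs : seq (set R)) (delta : R) N (x : 'I_N -> R) : Prop :=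
  forall B, B \in Bs ->
    N%:R * (fine (mu (B : set (measurableTypeR R))) - delta)
      <= \sum_i (\1_B (x i) : R).

Lemma typicalW Bs Bs' delta delta' N (x : 'I_N -> R) :
  {subset Bs' <= Bs} -> delta <= delta' ->
  typical Bs delta x -> typical Bs' delta' x.
Proof.
move=> sB sd tx B /sB/tx; apply: le_trans.
by rewrite ler_wpM2l // lerB.
Qed.

Import HBNNSimple.

(** The integrand is unbounded near [s], but some simple function [h] below it already has integral
    above [lambda ^ 2]. Its finitely many level sets are the only events whose frequencies matter,
    and its boundedness makes the estimate uniform for [w] near [lambda * s]. *)
Lemma local_dispersion (s : R) : 0 < lambda ->
  ((lambda ^+ 2)%:E < \int[mu]_v ((v - s) ^- 2)%:E)%E ->
  exists c eps delta (Bs : seq (set R)),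
  [/\ 0 < c, 0 < eps, 0 < delta,
      forall B, B \in Bs -> measurable (B : set (measurableTypeR R)) &
      forall N (x : 'I_N -> R), (0 < N)%N -> typical Bs delta x ->
        forall w, 0 < Im w -> normc ((lambda * s)%:C - w) <= 2 * c ->
        (1 + eps) * N%:R < \sum_i normc ((lambda * x i)%:C - w) ^- 2].
Proof.
move=> l0; rewrite ge0_integralTE; last first.
  by move=> v; rewrite lee_fin invr_ge0 sqr_ge0.
move=> /ereal_sup_gt[_ [h hle <-] lh].
pose rs : seq R := fset_set (range h).
pose B y : set R := h @^-1` [set y].
have rs_ge0 y : y \in rs -> 0 <= y.
  by rewrite in_fset_set // inE => -[v _ <-]; exact: fun_ge0.
pose p y := fine (mu (B y)).
have mB y : measurable (B y : set (measurableTypeR R)).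
  exact: measurable_sfunP.
have shE : sintegral mu h = (\sum_(y <- rs) y * p y)%:E.
  rewrite sintegralE fsbig_finite //= -sumEFin; apply: eq_bigr => y _.
  by rewrite EFinM fineK // fin_num_measure.
rewrite shE lte_fin in lh; set L := \sum_(y <- rs) _ in lh.
pose Y := \sum_(y <- rs) y.
have Y_ge0 : 0 <= Y by rewrite /Y big_seq; apply: sumr_ge0.
have hE v : h v = \sum_(y <- rs) y * \1_(B y) v.
  by rewrite fimfunE fsbig_finite.
have h_le v : h v <= Y.
  rewrite hE /Y !big_seq; apply: ler_sum => y /rs_ge0 y0.
  by rewrite ler_piMr // indicE; case: (_ \in _).
pose g := L - lambda ^+ 2; have g0 : 0 < g by rewrite subr_gt0.
have LE : L = lambda ^+ 2 + g by rewrite /g; ring.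
pose r := Num.sqrt Y; have r0 : 0 <= r by exact: sqrtr_ge0.
(* [r] bounds the square root of [h]. The gap [g] is spent as follows: [den] makes (lambda + 2 u)^2
   exceed lambda^2 by at most g / 2, where u = g / den * r; [delta] costs at most g / 4 of the
   integral; [eps] fits in the remainder. *)
pose den := 16 * ((lambda + 1) * (r + 1) * (g + 1)).
have den0 : 0 < den by rewrite !mulr_gt0 //; lra.
exists (g / den), (g / (8 * (lambda ^+ 2 + g))), (g / (4 * (Y + 1))), (map B rs).
have l2 : 0 < lambda ^+ 2 by rewrite exprn_gt0.
split.
- exact: divr_gt0.
- by rewrite divr_gt0 // mulr_gt0 //; lra.
- by rewrite divr_gt0 // mulr_gt0 //; lra.
- by move=> _ /mapP[y _ ->].
move=> N x N0 tx w w0 ws.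
pose u := g / den * r.
have u0 : 0 <= u by rewrite mulr_ge0 // divr_ge0 // ltW.
have u_le : 16 * u * (lambda + 1) <= g /\ 16 * u <= 1.
  have uden : u * den = g * r by rewrite /u mulrAC divfK // gt_eqF.
  have : u * 16 * ((lambda + 1) * (g + 1)) * (r + 1) = g * r.
    by rewrite -uden /den; ring.
  have le1 (a : R) : a * (r + 1) = g * r -> a <= g by move=> ?; nra.
  move=> /le1 h1; have ug0 := mulr_ge0 u0 (ltW g0).
  have lg : 0 <= u * lambda by rewrite mulr_ge0 // ltW.
  have lgg : 0 <= u * lambda * g by rewrite mulr_ge0 // ltW.
  by split; nra.
pose Th := (lambda + 2 * u) ^+ 2.
have Th_le : Th <= lambda ^+ 2 + g / 2.
  by case: u_le => u1 u2; rewrite /Th; nra.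
pose D i := normc ((lambda * x i)%:C - w).
have D0 i : 0 < D i.
  apply: lt_le_trans (Im_le_normc _); rewrite normr_gt0.
  by move: w0; case: (w) => a b /= b0; rewrite sub0r oppr_eq0 gt_eqF.
have hD i : h (x i) <= Th * D i ^- 2.
  rewrite ler_pdivlMr ?exprn_gt0 //.
  have h0 : 0 <= h (x i) by exact: fun_ge0.
  have [->|hn0] := eqVneq (h (x i)) 0; first by rewrite mul0r sqr_ge0.
  have hp : 0 < h (x i) by rewrite lt_neqAle eq_sym hn0.
  pose k := Num.sqrt (h (x i)).
  have k0 : 0 <= k by exact: sqrtr_ge0.
  have kr : k <= r by rewrite /k /r ler_wsqrtr.
  have kvs : k * `|x i - s| <= 1.
    rewrite -sqrtr_sqr -sqrtrM // -[leRHS]sqrtr1 ler_wsqrtr //.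
    have := hle (x i); rewrite lee_fin => hx.
    (* At [x i = s] the value of [0 ^- 2] is 0, so [h] vanishes there; positivity of [h (x i)]
       excludes this point. *)
    have xs : 0 < (x i - s) ^+ 2.
      rewrite exprn_even_gt0 //=; apply/eqP => xs0.
      by move: hx; rewrite xs0 expr0n invr0 leNgt hp.
    by move: hx; rewrite -[leRHS]div1r ler_pdivlMr.
  have -> : h (x i) * D i ^+ 2 = (k * D i) ^+ 2 by rewrite exprMn sqr_sqrtr.
  have DE : D i <= lambda * `|x i - s| + 2 * (g / den).
    have -> : D i = normc ((lambda * (x i - s))%:C + ((lambda * s)%:C - w)).
      by rewrite /D mulrBr rmorphB /=; congr normc; ring.
    apply: le_trans (ler_normcD _ _) _.
    by apply: lerD ws; rewrite normc_real normrM gtr0_norm.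
  rewrite /Th lerXn2r ?nnegrE ?mulr_ge0 ?(ltW (D0 i)) //; first by lra.
  apply: le_trans (ler_wpM2l k0 DE) _; rewrite mulrDr; apply: lerD.
    by rewrite mulrCA ler_piMr // ltW.
  rewrite mulrCA /u [X in _ <= 2 * X]mulrC; rewrite ler_wpM2l // ler_wpM2r //.
  by rewrite divr_ge0 // ltW.
have Th0 : 0 < Th by rewrite exprn_gt0 //; lra.
have N0' : (0 : R) < N%:R by rewrite ltr0n.
have sum_h : N%:R * (L - g / 4) <= \sum_i h (x i).
  under eq_bigr => i _ do rewrite hE.
  rewrite exchange_big /=.
  apply: (@le_trans _ _
      (\sum_(y <- rs) y * (N%:R * (p y - g / (4 * (Y + 1)))))).
    rewrite -subr_ge0.
    have -> : \sum_(y <- rs) y * (N%:R * (p y - g / (4 * (Y + 1)))) =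
       N%:R * (L - Y * (g / (4 * (Y + 1)))).
      rewrite /L /Y mulr_suml -sumrB mulr_sumr; apply: eq_bigr => y _; ring.
    rewrite -mulrBr mulr_ge0 // ?(ltW N0') //.
    have -> : L - Y * (g / (4 * (Y + 1))) - (L - g / 4) =
        g / (4 * (Y + 1)) by field; lra.
    by rewrite divr_ge0 ?(ltW g0) // mulr_ge0 //; lra.
  rewrite [leLHS]big_seq [leRHS]big_seq; apply: ler_sum => y yrs.
  rewrite -mulr_sumr ler_wpM2l ?rs_ge0 //.
  by have := tx (B y) (map_f _ yrs).
have : \sum_i h (x i) <= Th * \sum_i D i ^- 2.
  by rewrite mulr_sumr; apply: ler_sum => i _.
move=> /(le_trans sum_h) h1.
rewrite -(ltr_pM2l Th0); apply: lt_le_trans h1.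
rewrite mulrA [ltLHS]mulrC ltr_pM2l //.
apply: (@le_lt_trans _ _
  ((lambda ^+ 2 + g / 2) * (1 + g / (8 * (lambda ^+ 2 + g))))).
  rewrite ler_wpM2r // addr_ge0 // divr_ge0 ?(ltW g0) // mulr_ge0 //; lra.
rewrite LE -subr_gt0; set l := lambda ^+ 2 in l2 *.
have -> : l + g - g / 4 - (l + g / 2) * (1 + g / (8 * (l + g))) =
   g * (l + 3 / 2 * g) / (8 * (l + g)) by field; lra.
by rewrite !mulr_gt0 ?invr_gt0 ?mulr_gt0 //; lra.
Qed.

(** Compactness of [-1, 1] makes the constants of [local_dispersion] uniform: finitely many centres
    [s] are enough, and minima are taken over them. *)
Lemma empirical_stability : 0 < lambda ->
  (forall s : R, -1 <= s <= 1 ->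
     ((lambda ^+ 2)%:E < \int[mu]_v ((v - s) ^- 2)%:E)%E) ->
  exists c eps delta (Bs : seq (set R)),
  [/\ 0 < c <= 1, 0 < eps <= 1, 0 < delta,
      forall B, B \in Bs -> measurable (B : set (measurableTypeR R)) &
      forall N (x : 'I_N -> R), (forall i, -1 <= x i <= 1) ->
        typical Bs delta x -> forall w, 0 < Im w ->
        \sum_i normc ((lambda * x i)%:C - w) ^- 2 <= (1 + eps) * N%:R ->
        forall i, c <= normc ((lambda * x i)%:C - w)].
Proof.
move=> l0 disp.
pose loc (s : R) (q : R * R * R * seq (set R)) := let: (c, eps, delta, Bs) := q in
  [/\ 0 < c, 0 < eps, 0 < delta,
      forall B, B \in Bs -> measurable (B : set (measurableTypeR R)) &
      forall N (x : 'I_N -> R), (0 < N)%N -> typical Bs delta x ->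
        forall w, 0 < Im w -> normc ((lambda * s)%:C - w) <= 2 * c ->
        (1 + eps) * N%:R < \sum_i normc ((lambda * x i)%:C - w) ^- 2].
have /choice[q qP] : forall s, exists q, -1 <= s <= 1 -> loc s q.
  move=> s.
  (* [choice] needs a value for every real [s]; the one outside [-1, 1] is arbitrary. *)
  have [s1|s1] := pselect (-1 <= s <= 1); last by exists (0, 0, 0, [::]).
  have [c [eps [delta [Bs h]]]] := local_dispersion l0 (disp s s1).
  by exists (c, eps, delta, Bs).
pose c_ s := (q s).1.1.1; pose eps_ s := (q s).1.1.2.
pose delta_ s := (q s).1.2; pose Bs_ s := (q s).2.
have {}qP s : -1 <= s <= 1 -> loc s (c_ s, eps_ s, delta_ s, Bs_ s).
  by move/qP; rewrite /c_ /eps_ /delta_ /Bs_; case: (q s) => [[[? ?] ?] ?].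
have := @segment_compact R (-1) 1; rewrite compact_cover.
(* With this radius, [lambda * x i] is within [c_ s] of [lambda * s]; if [w] is within [c_ s] of
   [lambda * x i], the two distances add up to the [2 * c] allowed by [local_dispersion]. *)
move=> /(_ R `[-1, 1]%classic (fun s => ball s (c_ s / lambda)))[].
- by move=> s _; exact: ball_open.
- move=> s /= s1; exists s => //; apply: ballxx.
  by move: s1; rewrite in_itv /= => /qP[c0 _ _ _ _]; exact: divr_gt0.
move=> D Dsub Dcov.
have D1 s : s \in D -> -1 <= s <= 1.
  by move=> /Dsub; rewrite inE /= in_itv.
pose mn (f : R -> R) := \big[Num.min/1]_(s <- D) f s.
have mn_gt0 f : (forall s, s \in D -> 0 < f s) -> 0 < mn f.
  move=> f0; rewrite /mn big_seq; elim/big_ind: _ => // a b a0 b0.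
  by rewrite lt_min a0.
have mn_le1 f : mn f <= 1.
  by rewrite /mn; elim/big_rec: _ => // a y _ y1; rewrite ge_min y1 orbT.
have mn_le f s : s \in D -> mn f <= f s.
  rewrite /mn -[s \in D]/(s \in enum_fset D).
  elim: (enum_fset D) => // a t IH; rewrite inE big_cons => /orP[/eqP ->|/IH h].
    by rewrite ge_min lexx.
  by rewrite ge_min h orbT.
exists (mn c_), (mn eps_), (mn delta_), (flatten [seq Bs_ s | s <- D]).
split; rewrite ?mn_le1 ?andbT.
- by apply: mn_gt0 => s /D1/qP[].
- by apply: mn_gt0 => s /D1/qP[].
- by apply: mn_gt0 => s /D1/qP[].
- by move=> B /flatten_mapP[s /D1/qP[_ _ _ mB _]]; exact: mB.
move=> N x x1 tx w w0 sum_le i; rewrite leNgt; apply/negP => dist.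
have N0 : (0 < N)%N by exact: leq_ltn_trans (leq0n i) (ltn_ord i).
have [|s /= sD xs] := Dcov (x i); first by rewrite /= in_itv /= x1.
have [_ _ _ _] := qP s (D1 s sD) => /(_ N x N0) h.
have {}h := h _ w w0.
have : (1 + eps_ s) * N%:R < \sum_i normc ((lambda * x i)%:C - w) ^- 2.
  apply: h.
    apply: typicalW tx; last exact: mn_le.
    by move=> B BB; apply/flatten_mapP; exists s.
  have -> : (lambda * s)%:C - w =
      (lambda * (s - x i))%:C + ((lambda * x i)%:C - w).
    by rewrite mulrBr rmorphB /=; ring.
  apply: le_trans (ler_normcD _ _) _; rewrite mulr2n mulrDl mul1r.
  apply: lerD; last by rewrite ltW // (lt_le_trans dist) // mn_le.
  rewrite normc_real normrM gtr0_norm // mulrC -ler_pdivlMr // ltW //.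
rewrite ltNge => /negP; apply; apply: le_trans sum_le _.
by rewrite ler_wpM2r // lerD2l mn_le.
Qed.

End EmpiricalStability.

(** * Dispersion of the law of the potential *)

Section Dispersion.
Variables (R : realType) (mu : probability (measurableTypeR R) R).
Implicit Types (f : R -> R) (s : R).
Local Notation dispersion s := (\int[mu]_v ((v - s) ^- 2)%:E)%E.

Lemma measurable_inv_sqr s :
  measurable_fun setT (fun v : measurableTypeR R => (v - s) ^- 2 : R).
Proof.
have -> : (fun v : measurableTypeR R => (v - s) ^- 2 : R) =
    (@powR R ^~ (-1)) \o (fun v : measurableTypeR R => (v - s) ^+ 2).
  by apply/funext => v /=; rewrite powR_inv1 // sqr_ge0.
apply: measurableT_comp; first exact: measurable_powR.
apply: measurable_funX; exact: measurable_funB.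
Qed.

Lemma density_lower f (A : set R) (rho : R) : has_density mu f ->
  measurable A -> (forall v, A v -> rho <= f v) -> 0 <= rho ->
  (rho%:E * lebesgue_measure A <= mu (A : set (measurableTypeR R)))%E.
Proof.
move=> [mf f0 muE] mA fA rho0; rewrite muE // -integral_cst //.
apply: ge0_le_integral => //.
- by apply/measurable_EFinP; apply: measurable_funTS.
Qed.

(** The strict lower bound in the hypothesis keeps [v = s] out of [A], where the integrand takes the
    value 0 instead of being infinite. *)
Lemma dispersion_lower (A : set R) (a r s : R) : measurable A ->
  (forall v, A v -> 0 < (v - s) ^+ 2 <= r) ->
  (a%:E <= mu (A : set (measurableTypeR R)))%E -> 0 < r ->
  ((r^-1 * a)%:E <= \int[mu]_(v in A) ((v - s) ^- 2)%:E)%E.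
Proof.
move=> mA Ar Aa r0; rewrite EFinM.
apply: (@le_trans _ _ (r^-1%:E * mu (A : set (measurableTypeR R)))%E).
  by rewrite lee_pmul2l // lte_fin invr_gt0.
rewrite -integral_cst //; apply: ge0_le_integral => //.
- by move=> *; rewrite lee_fin invr_ge0 ltW.
- apply/measurable_EFinP; apply: measurable_funTS; exact: measurable_inv_sqr.
- by move=> v /Ar /andP[v0 vr]; rewrite lee_fin lef_pV2 ?posrE.
Qed.

Lemma dispersion_setT (A : set R) s : measurable A ->
  (\int[mu]_(v in A) ((v - s) ^- 2)%:E <= dispersion s)%E.
Proof.
move=> mA; apply: ge0_subset_integral => //.
- by apply/measurable_EFinP; exact: measurable_inv_sqr.
- by move=> v _; rewrite lee_fin invr_ge0 sqr_ge0.
Qed.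

(** The interval lies to the right of [s] and omits it, as [dispersion_lower] requires. *)
Lemma interior_mass f s : has_density mu f -> {for s, continuous f} ->
  0 < f s -> exists rho r0, [/\ 0 < rho, 0 < r0 & forall r, 0 < r <= r0 ->
    ((rho * r)%:E <= mu (`]s, (s + r)%R[%classic : set (measurableTypeR R)))%E].
Proof.
move=> df cf fs; have fs2 : f s / 2 < f s by lra.
have /nbhs_ballP[r0 /= r00 near_s] : \forall v \near s, f s / 2 < f v.
  exact: (cf _ (lt_nbhsr fs2)).
exists (f s / 2), r0; split => //; first by lra.
move=> r /andP[r_gt0 r_le].
have -> : (f s / 2 * r)%:E =
    ((f s / 2)%:E * lebesgue_measure `]s, (s + r)%R[%classic)%E.
  rewrite lebesgue_measure_itv /= lte_fin ltrDl r_gt0 -EFinD -EFinM.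
  by congr (_ * _)%:E; ring.
apply: (density_lower df) => //; last by lra.
move=> v /=; rewrite in_itv /= => /andP[sv vs]; apply/ltW/near_s.
by rewrite /ball /= ltr_norml; apply/andP; split; lra.
Qed.

(** Mass [rho * r] within distance [r] of [s] contributes at least rho / r, which is unbounded as
    [r] tends to 0. *)
Lemma interior_dispersion f s (L : R) : has_density mu f ->
  {for s, continuous f} -> 0 < f s -> 0 < L -> (L%:E < dispersion s)%E.
Proof.
move=> df cf fs L0; have [rho [r0 [rho0 r00 mass]]] := interior_mass df cf fs.
(* Makes rho / r at least 2 L, hence strictly above L. *)
pose r := Num.min r0 (rho / (2 * L)).
have r_gt0 : 0 < r by rewrite lt_min r00 divr_gt0 // mulr_gt0.
have r_le : r <= r0 by rewrite ge_min lexx.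
have rL : 2 * L * r <= rho.
  have : r <= rho / (2 * L) by rewrite ge_min lexx orbT.
  by rewrite ler_pdivlMr ?mulr_gt0 // mulrC.
have mr := mass r; rewrite r_gt0 r_le in mr.
have := @dispersion_lower `]s, (s + r)%R[%classic _ (r ^+ 2) s _ _ (mr isT).
move=> h; apply: lt_le_trans (dispersion_setT s _); last first.
  exact: (measurable_itv `]s, (s + r)%R[).
apply: lt_le_trans (h _ _ _).
- rewrite lte_fin mulrC ltr_pdivlMr ?exprn_gt0 //.
  by rewrite expr2 mulrA ltr_pM2r //; nra.
- exact: measurable_itv.
- move=> v /=; rewrite in_itv /= => /andP[sv vs].
  by rewrite exprn_gt0 ?subr_gt0 //= lerXn2r ?nnegrE //; lra.
- exact: exprn_gt0.
Qed.

End Dispersion.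

Section EndpointDispersion.
Variables (R : realType) (mu : probability (measurableTypeR R) R).
Implicit Types (f : R -> R) (s sg : R).
Local Notation dispersion s := (\int[mu]_v ((v - s) ^- 2)%:E)%E.

(** With [sg] equal to 1 or -1, both endpoints are treated at once: [1 - sg * v] is the distance of
    [v] to [sg] inside [-1, 1]. *)
Definition signed_itv sg (a b : R) : set R := [set v | a < sg * v < b].

Lemma signed_itvP sg a b : sg = 1 \/ sg = -1 ->
  measurable (signed_itv sg a b) /\
  (a < b -> lebesgue_measure (signed_itv sg a b) = (b - a)%:E).
Proof.
case=> ->.
  have -> : signed_itv 1 a b = `]a, b[%classic.
    by apply/seteqP; split=> v; rewrite /signed_itv /= in_itv /= mul1r.
  split; first exact: measurable_itv.
  by move=> ab; rewrite lebesgue_measure_itv /= lte_fin ab -EFinD.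
have -> : signed_itv (-1) a b = `](- b), (- a)[%classic.
  apply/seteqP; split=> v; rewrite /signed_itv /= in_itv /= mulN1r => /andP[? ?];
  by apply/andP; split; lra.
split; first exact: measurable_itv.
move=> ab; rewrite lebesgue_measure_itv /= lte_fin ltrN2 ab -EFinD.
by congr _%:E; ring.
Qed.

Lemma sqr_sub_sign sg v : sg = 1 \/ sg = -1 -> (v - sg) ^+ 2 = (1 - sg * v) ^+ 2.
Proof. by case=> ->; ring. Qed.

(** A density at least linear in the distance to the endpoint is the borderline case, with
    logarithmic divergence. The dyadic shell at distances between r / 2 and r has mass at least
    kappa r^2 / 4, so each shell contributes kappa / 4. *)
Lemma endpoint_dispersion f sg kappa (L : R) : sg = 1 \/ sg = -1 ->
  has_density mu f -> 0 < kappa ->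
  (forall v, 1 / 2 < sg * v < 1 -> kappa * (1 - sg * v) <= f v) ->
  (L%:E < dispersion sg)%E.
Proof.
move=> sg1 df k0 fk.
pose g (v : measurableTypeR R) := (((v - sg) ^- 2)%:E : \bar R).
have mg : measurable_fun setT g.
  by apply/measurable_EFinP; exact: measurable_inv_sqr.
have g0 v : (0 <= g v)%E by rewrite lee_fin invr_ge0 sqr_ge0.
have mI a b := (signed_itvP a b sg1).1.
have step r : 0 < r <= 1 / 2 ->
    ((kappa / 4)%:E <= \int[mu]_(v in signed_itv sg (1 - r) (1 - r / 2)) g v)%E.
  move=> /andP[r0 r1]; have rr : 1 - r < 1 - r / 2 by lra.
  have mass : ((kappa * (r / 2) * (r / 2))%:E <=
      mu (signed_itv sg (1 - r) (1 - r / 2) : set (measurableTypeR R)))%E.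
    have := (signed_itvP (1 - r) (1 - r / 2) sg1).2 rr.
    have -> : 1 - r / 2 - (1 - r) = r / 2 by field.
    rewrite (EFinM (kappa * _)) => <-; apply: (density_lower df) => //.
      move=> v /= /andP[h1 h2]; apply: (@le_trans _ _ (kappa * (1 - sg * v))).
        by rewrite ler_pM2l //; lra.
      by apply: fk; apply/andP; split; lra.
    by rewrite mulr_ge0 ?ltW //; lra.
  have := @dispersion_lower R mu _ _ (r ^+ 2) sg (mI _ _) _ mass.
  have -> : (r ^+ 2)^-1 * (kappa * (r / 2) * (r / 2)) = kappa / 4.
    by field; rewrite gt_eqF.
  apply; last exact: exprn_gt0.
  move=> v /= /andP[h1 h2]; rewrite sqr_sub_sign // exprn_gt0 /=; last lra.
  by rewrite lerXn2r ?nnegrE //; lra.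
have iter M : forall r, 0 < r <= 1 / 2 ->
    ((M%:R * (kappa / 4))%:E <= \int[mu]_(v in signed_itv sg (1 - r) 1) g v)%E.
  elim: M => [|M IH] r r01; first by rewrite mul0r; apply: integral_ge0.
  have r2 : 0 < r / 2 <= 1 / 2 by case/andP: r01 => *; apply/andP; split; lra.
  apply: (@le_trans _ _ (\int[mu]_(v in signed_itv sg (1 - r) (1 - r / 2) `|`
      signed_itv sg (1 - r / 2) 1) g v)%E); last first.
    apply: ge0_subset_integral => //.
    - by apply: measurableU; exact: mI.
    - exact: mI.
    - exact: measurable_funTS.
    case/andP: r01 => r0 r1.
    by move=> v [] /= /andP[h1 h2]; apply/andP; split; lra.
  rewrite ge0_integral_setU //.
  - rewrite -natr1 mulrDl mul1r addrC EFinD leeD //; first exact: step.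
    exact: IH.
  - exact: mI.
  - exact: mI.
  - exact: measurable_funTS.
  - by apply/disj_setPS => v [/= /andP[_ h1] /andP[h2 _]]; lra.
apply: (@lt_le_trans _ _ (\int[mu]_(v in signed_itv sg (1 - 1 / 2) 1) g v)%E);
  last exact: dispersion_setT.
(* Enough shells for their total to exceed L. *)
pose M := (Num.trunc (`|L| / (kappa / 4))).+1.
have k4 : 0 < kappa / 4 by lra.
apply: lt_le_trans (iter M (1 / 2) _); last by apply/andP; split; lra.
rewrite lte_fin -ltr_pdivrMr //; apply: le_lt_trans (truncnS_gt _).
by rewrite ler_pM2r ?invr_gt0 // ler_norm.
Qed.

(** An exponent at most 1 gives u <= u^q for u in ]0, 1]; the factor of the other endpoint has base
    in [1, 2] and exponent above -1, hence is at least 1/2, and [dd] is bounded below by its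
    minimum. *)
Lemma jacobi_endpoint_dispersion (a b sg L : R) : sg = 1 \/ sg = -1 ->
  is_jacobi mu a b -> -1 < a <= 1 -> -1 < b <= 1 -> (L%:E < dispersion sg)%E.
Proof.
move=> sg1 [Z [dd [Z0 [dd' [cdd _ _]] dd0 df]]] a1 b1.
have [m m1 dm] := @EVT_min R dd (-1) 1 ltac:(lra) cdd.
have dm0 := dd0 m m1.
apply: (@endpoint_dispersion _ sg (Z^-1 * dd m / 2) L sg1 df).
  by rewrite divr_gt0 // mulr_gt0 // invr_gt0.
move=> v v1.
have pw (p q u w : R) : -1 < p <= 1 -> -1 < q <= 1 -> 0 < u <= 1 ->
    1 <= w <= 2 -> u / 2 <= w `^ p * u `^ q.
  move=> /andP[p0 p1] /andP[q0 q1] u01 /andP[w1 w2].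
  have h1 : u <= u `^ q by exact: ger1_powR.
  have w0 : 0 < w by lra.
  have h2 : 2^-1 <= w `^ p.
    apply: (@le_trans _ _ (w `^ (-1))); last by apply: ler_powR => //; exact: ltW.
    by rewrite powR_inv1 ?(ltW w0) // lef_pV2 ?posrE.
  case/andP: u01 => u0 _.
  by rewrite mulrC; apply: ler_pM => //; exact: ltW.
have v11 : v \in `[-1, 1].
  by rewrite in_itv /=; case: sg1 v1 => -> /andP[? ?]; apply/andP; split; lra.
rewrite /jacobi_density indicE mem_set // mulr1.
have dmv := dm v v11.
have -> : Z^-1 * dd m / 2 * (1 - sg * v) = Z^-1 * ((1 - sg * v) / 2 * dd m).
  by ring.
rewrite -!mulrA ler_pM2l ?invr_gt0 // !mulrA.
have u2 : 0 <= (1 - sg * v) / 2 by case/andP: v1 => *; lra.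
suff pwv : (1 - sg * v) / 2 <= (1 + v) `^ a * (1 - v) `^ b.
  by apply: ler_pM => //; exact: ltW.
case: sg1 v1 => -> /andP[h1 h2].
  by rewrite mul1r; apply: pw => //; apply/andP; split; lra.
rewrite mulrC [leRHS]mulrC mulrC; have -> : 1 - -1 * v = 1 + v by ring.
by apply: pw => //; apply/andP; split; lra.
Qed.

(* The tangent of [x ^- 2] at [x = 1], evaluated at [x = 1 - sg * v]. *)
Lemma tangent_ineq (v sg : R) (b : bool) : sg = 1 \/ sg = -1 ->
  -1 <= v <= 1 -> v <> sg -> 1 / 2 < v \/ b = false ->
  3 + 16^-1 * b%:R <= (v - sg) ^- 2 + 2 * (1 - sg * v).
Proof.
move=> sg1 /andP[v1 v2] vsg vb; rewrite sqr_sub_sign //.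
have v2E : v ^+ 2 = (1 - sg * v - 1) ^+ 2 by case: sg1 => ->; ring.
have x0 : 0 < 1 - sg * v.
  rewrite subr_gt0 lt_neqAle; apply/andP; split.
    by apply/eqP => h; apply: vsg; case: sg1 h => ->; lra.
  by case: sg1 => ->; lra.
have x2 : 1 - sg * v <= 2 by case: sg1 => ->; lra.
have vb2 : 16^-1 * b%:R <= v ^+ 2 / 4.
  by case: vb => [|->]; [case: b; rewrite /=; nra | rewrite mulr0; nra].
move: v2E x0 x2; set x := 1 - sg * v => v2E x0 x2.
apply: (@le_trans _ _ (3 + v ^+ 2 / 4)); first by rewrite lerD2l.
rewrite -subr_ge0 v2E.
have -> : x ^- 2 + 2 * x - (3 + (x - 1) ^+ 2 / 4) =
   (x - 1) ^+ 2 * (2 * x + 1 - x ^+ 2 / 4) / x ^+ 2.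
  by field; rewrite gt_eqF.
by rewrite divr_ge0 ?sqr_ge0 // mulr_ge0 ?sqr_ge0 //; nra.
Qed.

(** Integrating [tangent_ineq] over a centered law gives dispersion + 2 >= 3 + mu(B) / 16.
    Strictness comes from the positive mass of [B], the interval ]1/2, 1[, where the tangent
    inequality has room to spare. *)
Lemma tangent_dispersion f sg : sg = 1 \/ sg = -1 ->
  has_density mu f -> (forall v, v \in `]-1, 1[ -> {for v, continuous f}) ->
  (forall v, v \in `]-1, 1[ -> 0 < f v) ->
  (forall v, v \notin `[-1, 1] -> f v = 0) ->
  (\int[mu]_v (v : R)%:E = 0)%E -> (1 < dispersion sg)%E.
Proof.
move=> sg1 df cf fp f0 centered.
(* The point [sg] must be removed: there [(v - sg) ^- 2] is 0 and the tangent inequality fails. It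
   has no mass because [mu] has a density. *)
pose X : set (measurableTypeR R) := `[-1, 1]%classic `\ sg.
have mX : measurable X by apply: measurableD; [exact: measurable_itv | exact: measurable_set1].
have muXC : mu (~` X) = 0%E.
  have [mf fge0 muE] := df.
  have -> : mu (~` X) =
     (\int[lebesgue_measure]_(v in (~` X : set (measurableTypeR R))) (f v)%:E)%E.
    by rewrite muE //; exact: measurableC.
  rewrite (@ge0_negligible_integral _ (measurableTypeR R) R (@lebesgue_measure R) (~` X) [set sg]) //=.
  - apply: integral0_eq => v [/= nX /= vsg]; rewrite f0 //.
    by apply/negP => v1; apply: nX; split.
  - exact: measurableC.
  - by apply/measurable_EFinP; exact: measurable_funTS.
  - by move=> v _; rewrite lee_fin.
  - by rewrite lebesgue_measure_set1.
have muX : mu X = 1%E.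
  have := probability_setC mu (measurableC mX).
  by rewrite setCK muXC sube0.
have intX (g : measurableTypeR R -> \bar R) : measurable_fun setT g ->
    (\int[mu]_v g v = \int[mu]_(v in X) g v)%E.
  move=> mg; rewrite integralE [RHS]integralE.
  have XE : X = setT `\` ~` X by rewrite setTD setCK.
  rewrite [in RHS]XE; congr (_ - _)%E; apply: ge0_negligible_integral => //.
  - exact: measurableC.
  - exact: measurable_funepos.
  - exact: measurableC.
  - exact: measurable_funeneg.
pose B : set (measurableTypeR R) := `]1 / 2, 1[%classic.
have mB : measurable B by exact: measurable_itv.
have BX : (`]1 / 2, 1[%classic : set R) `<=` `[-1, 1]%classic `\ sg.
  move=> v /=; rewrite !in_itv /= => /andP[v1 v2].
  split; first by apply/andP; split; lra.
  by move=> vE; case: sg1 => sE; clear -v1 v2 vE sE; lra.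
have muB0 : (0 < mu B)%E.
  have h34 : (3 / 4 : R) \in `]-1, 1[ by rewrite in_itv /=; apply/andP; split; lra.
  have [rho [r0 [rho0 r00 mass]]] := interior_mass df (cf _ h34) (fp _ h34).
  pose r := Num.min r0 (1 / 4).
  have r_gt0 : 0 < r by rewrite lt_min r00 /=; lra.
  have rr0 : r <= r0 by rewrite ge_min lexx.
  have r4 : r <= 1 / 4 by rewrite ge_min lexx orbT.
  apply: (@lt_le_trans _ _ (rho * r)%:E); first by rewrite lte_fin mulr_gt0.
  have := mass r; rewrite r_gt0 rr0 => /(_ isT) h; apply: le_trans h _.
  have sub : `](3 / 4 : R), (3 / 4 + r)%R[%classic `<=` `](1 / 2 : R), 1[%classic.
    by move=> v /=; rewrite !in_itv /= => /andP[? ?]; apply/andP; split; lra.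
  by apply: le_measure; rewrite ?inE.
have mid : measurable_fun setT (fun v : measurableTypeR R => v : R).
  exact: measurable_id.
have muXy : (mu X < +oo)%E by rewrite muX ltry.
have mind : measurable_fun X (fun v : measurableTypeR R => (\1_B v : R)%:E).
  by apply/measurable_EFinP; apply: measurable_funTS; exact: measurable_indic.
have bX : mu.-integrable X (EFin \o (fun v : measurableTypeR R => v : R)).
  apply: measurable_bounded_integrable => //.
  - exists 1; split; first exact: num_real.
    move=> M M1 v [/= + _]; rewrite in_itv /= => /andP[v1 v2].
    by apply: le_trans (ltW M1); rewrite ler_norml v1 v2.
have cX : (\int[mu]_(v in X) (v : R)%:E = 0)%E.
  by rewrite -intX //; apply/measurable_EFinP.
have cst_int (c : R) : (\int[mu]_(v in X) c%:E = c%:E)%E.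
  apply: etrans (integral_cst mu mX c%:E) _; apply: etrans (congr1 _ muX) _; exact: mule1.
have lin : (\int[mu]_(v in X) (2 * (1 - sg * v))%:E = 2%:E)%E.
  under eq_integral => v _.
    rewrite (_ : (2 * (1 - sg * v))%:E = (2%:E - (2 * sg)%:E * v%:E)%E); last first.
      by rewrite -EFinM -EFinB; congr _%:E; ring.
    over.
  rewrite integralB //=.
  - by rewrite integralZl // cX mule0 sube0 cst_int.
  - exact: finite_measure_integrable_cst.
  - exact: integrableZl.
pose g (v : measurableTypeR R) := (((v - sg) ^- 2)%:E : \bar R).
have mg : measurable_fun setT g.
  by apply/measurable_EFinP; exact: measurable_inv_sqr.
have x_ge0 (v : R) : -1 <= v <= 1 -> 0 <= 1 - sg * v.
  by move=> /andP[v1 v2]; case: sg1 => ->; lra.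
have mlin : measurable_fun X (fun v : measurableTypeR R => (2 * (1 - sg * v))%:E).
  apply/measurable_EFinP; apply: measurable_funTS; apply: measurable_funM => //.
  by apply: measurable_funB => //; exact: measurable_funM.
rewrite intX //.
suff main : (3%:E + (16^-1)%:E * mu B <= \int[mu]_(v in X) g v + 2%:E)%E.
  have muBf : mu B \is a fin_num by exact: fin_num_measure.
  move: main; rewrite -(fineK muBf) in muB0 *; rewrite lte_fin in muB0.
  case: (\int[mu]_(v in X) g v)%E => [x| |] //=; last by rewrite ltry.
  by rewrite -EFinM -!EFinD !lee_fin lte_fin; lra.
rewrite -lin -ge0_integralD //; last 3 first.
- by move=> v _; rewrite lee_fin invr_ge0 sqr_ge0.
- exact: measurable_funTS.
- by move=> v [/= + _]; rewrite in_itv /= => /x_ge0 ?; rewrite lee_fin mulr_ge0.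
apply: (@le_trans _ _
    (\int[mu]_(v in X) (3%:E + (16^-1)%:E * (\1_B v)%:E))%E).
  rewrite ge0_integralD //; last by apply: measurable_funeM.
  rewrite cst_int leeD2l // ge0_integralZl //.
  by rewrite lee_pmul2l // ?lte_fin ?invr_gt0 // integral_indic // setIidl.
apply: ge0_le_integral => //.
- by move=> v _; rewrite adde_ge0 // mule_ge0 // lee_fin.
- by apply: emeasurable_funD => //; exact: measurable_funeM.
- apply: emeasurable_funD; first exact: measurable_funTS.
  exact: mlin.
move=> v [/= + vsg]; rewrite in_itv /= => v1.
rewrite -EFinM -!EFinD lee_fin; apply: tangent_ineq => //.
case: (boolP (v \in B)) => [|_]; last by right.
by rewrite inE /B /= in_itv /= => /andP[? _]; left.
Qed.

End EndpointDispersion.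

Section LawDispersion.
Variables (R : realType) (mu : probability (measurableTypeR R) R).
Local Notation dispersion s := (\int[mu]_v ((v - s) ^- 2)%:E)%E.

Lemma sqr_lt_of_lt_sqrt (l : R) (x : \bar R) : 0 < l -> (0 <= x)%E ->
  (l%:E < x `^ (2^-1)%R)%E -> ((l ^+ 2)%:E < x)%E.
Proof.
move=> l0; case: x => [r| |]; [|by rewrite ltry|by []].
rewrite lee_fin => r0; rewrite poweR_EFin !lte_fin powR12_sqrt // => lr.
by rewrite -(sqr_sqrtr r0) ltrXn2r // ?nnegrE ?sqrtr_ge0 ?ltW.
Qed.

(* The law admissible at [Num.min 1 lambda0] has a continuous positive density
   on the open interval, so the integral diverges for interior [s]. *)
Lemma law_dispersion (lambda0 lambda s : R) :
  (forall l, coupling_domain lambda0 l -> admissible_law l mu) ->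
  (\int[mu]_v (v : R)%:E = 0)%E -> coupling_domain lambda0 lambda ->
  -1 <= s <= 1 -> ((lambda ^+ 2)%:E < dispersion s)%E.
Proof.
move=> adm centered [l0 ll0] s1.
have l00 : 0 < lambda0 by exact: lt_le_trans ll0.
have dom1 : coupling_domain lambda0 (Num.min 1 lambda0).
  by split; [rewrite lt_min ltr01 | rewrite ge_min lexx orbT].
have [f [df cf fp f0]] : exists f : R -> R,
       [/\ has_density mu f,
           forall v, v \in `]-1, 1[ -> {for v, continuous f},
           forall v, v \in `]-1, 1[ -> 0 < f v &
           forall v, v \notin `[-1, 1] -> f v = 0].
  by have [+ _] := adm _ dom1; apply; rewrite ge_min lexx.
have [s_in|s_out] := boolP (s \in `]-1, 1[).
  by apply: (interior_dispersion df (cf s s_in) (fp s s_in)); exact: exprn_gt0.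
have sg1 : s = 1 \/ s = -1.
  move: s_out s1; rewrite in_itv /= negb_and -!leNgt.
  by move=> /orP[h|h] /andP[h1 h2]; [right|left]; apply/eqP; rewrite eq_le; apply/andP; split.
have [l1|l1] := leP lambda 1.
  apply: le_lt_trans (tangent_dispersion sg1 df cf fp f0 centered).
  by rewrite lee_fin exprn_ile1 // ltW.
have [_ /(_ l1)[a [b [jac]]]] := adm lambda (conj l0 ll0).
case=> [[a0 a1 b0 b1]|[_ _ lam1 lam2]].
  by apply: (jacobi_endpoint_dispersion _ sg1 jac); apply/andP.
have disp_ge0 : (0 <= dispersion s)%E.
  by apply: integral_ge0 => v _; rewrite lee_fin invr_ge0 sqr_ge0.
apply: sqr_lt_of_lt_sqrt => //.
case: sg1 => sE; rewrite sE.
  suff <- : lambda2 mu = (dispersion 1 `^ 2^-1)%E by [].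
  congr (_ `^ _)%E; apply: eq_integral => v _; congr _%:E.
  by rewrite -[in RHS]sqrrN opprB.
suff <- : lambda1 mu = (dispersion (-1) `^ 2^-1)%E by [].
congr (_ `^ _)%E; apply: eq_integral => v _; congr _%:E.
by rewrite opprK addrC.
Qed.

End LawDispersion.

(** * Union bound and lower tail of empirical counts *)

Section UnionBound.
Context d (T : measurableType d) (R : realType) (P : probability T R).

Lemma union_bound (I : Type) (s : seq I) (c : pred I) (A : I -> set T) :
  (forall i, measurable (A i)) ->
  (P (\big[setU/set0]_(i <- s | c i) A i) <= \sum_(i <- s | c i) P (A i))%E.
Proof.
move=> mA; elim: s => [|i s IH]; first by rewrite !big_nil measure0.
rewrite !big_cons; case: ifP => // _.
have mU : measurable (\big[setU/set0]_(j <- s | c j) A j).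
  exact: bigsetU_measurable.
apply: le_trans (leeD2l _ IH).
exact: measureU2.
Qed.

End UnionBound.

Section CountTail.
Context d (T : measurableType d) (R : realType) (P : probability T R).
Variables (mu : probability (measurableTypeR R) R) (N : nat).
Variable v : 'I_N -> T -> measurableTypeR R.
Hypothesis iid : iid_with_law P mu v.

Lemma expRN_le (t : R) : 0 <= t -> expR (- t) <= 1 - t + t ^+ 2.
Proof.
move=> t0; rewrite expRN; apply: (@le_trans _ _ (1 + t)^-1).
  by rewrite lef_pV2 ?posrE ?expR_gt0 ?expR_ge1Dx //; lra.
rewrite -[leLHS]mul1r ler_pdivrMr; last lra.
have t3 : 0 <= t ^+ 3 by rewrite exprn_ge0.
have -> : (1 - t + t ^+ 2) * (1 + t) = 1 + t ^+ 3 by ring.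
by rewrite lerDl.
Qed.

(** Chernoff's bound for a binomial variable. The event is split according to the set [J] of indices
    whose value falls in [B], so that independence gives an explicit product and only finite sums
    occur. *)
Lemma count_lower_tail (B : set (measurableTypeR R)) (delta : R) :
  measurable B -> 0 < delta ->
  exists A : set T, [/\ measurable A,
    forall t, ~ A t -> N%:R * (fine (mu B) - delta) <= \sum_i (\1_B (v i t) : R) &
    (P A <= (expR (- (delta ^+ 2 / 4 * N%:R)))%:E)%E].
Proof.
move=> mB delta0; have [mv lawv indv] := iid.
pose p := fine (mu B); pose a := N%:R * (p - delta).
have pE : mu B = p%:E by rewrite fineK // fin_num_measure.
pose F (J : {set 'I_N}) i : set (measurableTypeR R) :=
  if i \in J then B else ~` B.
have mF J i : measurable (F J i).
  by rewrite /F; case: ifP => // _; exact: measurableC.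
pose A J : set T := \bigcap_(i in [set k | k \in [set: 'I_N]%SET]) v i @^-1` F J i.
have mvF i (C : set (measurableTypeR R)) : measurable C ->
    measurable (v i @^-1` C).
  by move=> mC; rewrite -[X in measurable X]setTI; exact: mv.
have mA J : measurable (A J).
  apply: fin_bigcap_measurable; first exact: finite_finset.
  by move=> i _; exact: mvF.
exists (\big[setU/set0]_(J : {set 'I_N} | #|J|%:R < a) A J); split.
- exact: bigsetU_measurable.
- move=> t; apply: contra_notP => /negP; rewrite -ltNge => lt_a.
  pose J := [set i | v i t \in B]%SET.
  have JE : \sum_i (\1_B (v i t) : R) = #|J|%:R.
    rewrite -sum1_card natr_sum [RHS]big_mkcond /=; apply: eq_bigr => i _.
    by rewrite inE indicE; case: (_ \in _).
  rewrite (bigD1 J) /=; last by rewrite -JE.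
  left => i _; rewrite /F inE /=; case: ifPn => vB; first exact: set_mem.
  by move/mem_set; exact/negP.
apply: le_trans (union_bound _ _ _ mA) _.
have PA J : P (A J) = (\prod_i (if i \in J then p else 1 - p))%:E.
  rewrite /A indv // -prodEFin (eq_bigl xpredT) => [|i]; last by rewrite inE.
  apply: eq_bigr => i _.
  rewrite lawv // /F; case: ifP => // _.
  by rewrite probability_setC // pE.
under eq_bigr do rewrite PA.
rewrite sumEFin lee_fin.
have p01 : 0 <= p <= 1.
  rewrite -!lee_fin -pE; apply/andP; split => //; exact: probability_le1.
have {p01} [p0 p1] := andP p01.
(* The minimizer of t^2 - t delta, with value - delta^2 / 4. *)
pose t := delta / 2; have t0 : 0 <= t by rewrite /t; lra.
apply: (@le_trans _ _ (\sum_(J : {set 'I_N})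
   expR (t * (a - #|J|%:R)) * \prod_i (if i \in J then p else 1 - p))).
  rewrite [leLHS]big_mkcond /=; apply: ler_sum => J _.
  have pr : 0 <= \prod_i (if i \in J then p else 1 - p).
    by apply: prodr_ge0 => i _; case: ifP => // _; lra.
  case: ifP => [Ja|_]; last by rewrite mulr_ge0 ?expR_ge0.
  rewrite ler_peMl // -[leLHS](@expR0 R) ler_expR mulr_ge0 //; lra.
(* The exponential factorizes over the indices, and the sum over all subsets is the expansion of a
   product of binomials. *)
have -> : \sum_(J : {set 'I_N})
   expR (t * (a - #|J|%:R)) * \prod_i (if i \in J then p else 1 - p) =
   expR (t * a) * \prod_(i < N) (p * expR (- t) + (1 - p)).
  rewrite bigA_distr mulr_sumr; apply: eq_bigr => J _.
  rewrite mulrBr expRD -mulrA; congr (_ * _).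
  have -> : expR (- (t * #|J|%:R)) = \prod_i (if i \in J then expR (- t) else 1).
    rewrite -big_mkcond prodr_const -mulNr expRM_natr.
    by congr (_ ^+ _); apply: eq_card.
  rewrite -big_split; apply: eq_bigr => i _ /=.
  by case: ifP => _; rewrite ?mul1r // mulrC.
rewrite prodr_const card_ord.
have h : p * expR (- t) + (1 - p) <= expR (- (p * (t - t ^+ 2))).
  apply: le_trans (expR_ge1Dx _).
  by have := expRN_le t0; nra.
apply: (@le_trans _ _ (expR (t * a) * expR (- (p * (t - t ^+ 2))) ^+ N)).
  rewrite ler_wpM2l ?expR_ge0 // lerXn2r ?nnegrE ?expR_ge0 //.
  by rewrite addr_ge0 ?mulr_ge0 ?expR_ge0 //; lra.
rewrite -expRM_natr -expRD ler_expR /a.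
have -> : t * (N%:R * (p - delta)) + - (p * (t - t ^+ 2)) * N%:R =
  N%:R * (p * t ^+ 2 - t * delta) by ring.
have -> : - (delta ^+ 2 / 4 * N%:R) = N%:R * (1 * t ^+ 2 - t * delta).
  by rewrite /t; field.
by rewrite ler_wpM2l // lerD2r ler_wpM2r ?sqr_ge0.
Qed.

End CountTail.

(** * Large deviations with random coefficients *)

Section Decoupling.
Context d (T : measurableType d) (R : realType) (P : probability T R).
Implicit Types G : set (set T).

(** Two finite measures that agree on a pi-system agree on the sigma-algebra it generates; here they
    are [A |-> P (A & B)] and [P B] times [P]. Applied once on each side, this yields
    [independent_g_sigma]. *)
Lemma independent_g_sigmal G (B : set T) : G `<=` measurable -> setI_closed G ->
  G setT -> measurable B ->
  (forall A, G A -> P (A `&` B) = (P A * P B)%E) ->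
  forall A, <<s G >> A -> P (A `&` B) = (P A * P B)%E.
Proof.
move=> Gm GI GT mB PG A GA.
have [r PB] : exists r : {nonneg R}, P B = (r%:num)%:E.
  have PB0 : 0 <= fine (P B) by exact: fine_ge0.
  by exists (NngNum PB0); rewrite /= fineK // fin_num_measure.
have cover : \bigcup_(k : nat) [set: T] = setT.
  by rewrite bigcup_const //; exists 0%N.
have h : mrestr P mB A = mscale r P A.
  apply: (@g_sigma_algebra_measure_unique d R T G Gm (fun=> setT) (fun=> GT)
    cover) => //.
  - by move=> C GC; have := PG C GC; rewrite PB muleC => PC; exact: PC.
  - move=> _; apply: le_lt_trans (ltry 1).
    exact: (probability_le1 P (measurableI _ _ measurableT mB)).
by rewrite muleC PB; exact: h.
Qed.

Lemma independent_g_sigma G1 G2 :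
  G1 `<=` measurable -> G2 `<=` measurable ->
  setI_closed G1 -> setI_closed G2 -> G1 setT -> G2 setT ->
  (forall A B, G1 A -> G2 B -> P (A `&` B) = (P A * P B)%E) ->
  forall A B, <<s G1 >> A -> <<s G2 >> B -> P (A `&` B) = (P A * P B)%E.
Proof.
move=> m1 m2 I1 I2 T1 T2 P12 A B GA GB.
have sub G : G `<=` measurable -> <<s G >> `<=` (measurable : set (set T)).
  by move=> Gm; apply: smallest_sub => //; exact: sigma_algebra_measurable.
apply: (independent_g_sigmal m1) => // [|C GC]; first exact: sub GB.
rewrite setIC muleC; apply: (independent_g_sigmal m2) => //; first exact: m1.
by move=> D GD; rewrite setIC muleC P12.
Qed.

(* The law of [t |-> (t, t)] under independent sub-sigma-algebras is the product
   of the restrictions of [P]; no value space is needed for the two families. *)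
Lemma decoupling G1 G2
    (E : set (g_sigma_algebraType G1 * g_sigma_algebraType G2)) (b : \bar R) :
  G1 `<=` measurable -> G2 `<=` measurable ->
  setI_closed G1 -> setI_closed G2 -> G1 setT -> G2 setT ->
  (forall A B, G1 A -> G2 B -> P (A `&` B) = (P A * P B)%E) ->
  measurable E ->
  (forall t : T, (P [set s : T | E (t, s)] <= b)%E) ->
  measurable [set t : T | E (t, t)] /\ (P [set t : T | E (t, t)] <= b)%E.
Proof.
move=> m1 m2 I1 I2 GT1 GT2 P12 mE Eb.
have indep := independent_g_sigma m1 m2 I1 I2 GT1 GT2 P12.
have sub G : G `<=` measurable -> <<s G >> `<=` (measurable : set (set T)).
  by move=> Gm; apply: smallest_sub => //; exact: sigma_algebra_measurable.
have mid1 : measurable_fun setT (id : T -> g_sigma_algebraType G1).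
  by move=> _ Y mY; rewrite setTI; exact: sub mY.
have mid2 : measurable_fun setT (id : T -> g_sigma_algebraType G2).
  by move=> _ Y mY; rewrite setTI; exact: sub mY.
pose diag (t : T) : g_sigma_algebraType G1 * g_sigma_algebraType G2 := (t, t).
have mdiag : measurable_fun setT diag by exact: measurable_fun_pair.
pose X1 : {mfun T >-> g_sigma_algebraType G1} :=
  HB.pack (id : T -> g_sigma_algebraType G1) (isMeasurableFun.Build _ _ _ _ _ mid1).
pose X2 : {mfun T >-> g_sigma_algebraType G2} :=
  HB.pack (id : T -> g_sigma_algebraType G2) (isMeasurableFun.Build _ _ _ _ _ mid2).
pose X : {mfun T >-> (g_sigma_algebraType G1 * g_sigma_algebraType G2)%type} :=
  HB.pack diag (isMeasurableFun.Build _ _ _ _ _ mdiag).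
have mdE : measurable [set t : T | E (t, t)].
  by rewrite -[X in measurable X]setTI; exact: (mdiag measurableT _ mE).
split => //.
have -> : P [set t : T | E (t, t)] = distribution P X E by [].
rewrite -(@product_measure_unique _ _ _ _ R (distribution P X1)
  (distribution P X2)) //.
rewrite /product_measure1 /=.
apply: (@le_trans _ _ (\int[distribution P X1]_x b)%E).
  apply: ge0_le_integral => //.
  - exact: measurable_fun_xsection.
  - move=> t _; apply: le_trans (Eb t); rewrite /distribution /pushforward /=.
    by rewrite le_eqVlt; apply/orP; left; apply/eqP; congr (P _); apply/seteqP; split=> s; rewrite /xsection /= inE.
rewrite le_eqVlt; apply/orP; left; apply/eqP.
apply: etrans (integral_cst _ measurableT b) _; rewrite -[RHS]mule1.
by congr (_ * _)%E; exact: (probability_setT P).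
Qed.

End Decoupling.

(** * Measurability of resolvents with respect to sub-sigma-algebras *)

Section ComplexMeasurable.
Context d (T : measurableType d) (R : realType).
Implicit Types f g : T -> R[i].
Local Notation Re := (@complex.Re R).
Local Notation Im := (@complex.Im R).

(** The domain is kept arbitrary, so that the lemmas also apply to sub-sigma-algebras of the sample
    space and to products of these. *)
Definition cmeasurable f :=
  measurable_fun setT (fun t => Re (f t)) /\ measurable_fun setT (fun t => Im (f t)).

Lemma cmeasurable_reim f :
  measurable_fun setT (@reim R \o f) <-> cmeasurable f.
Proof. exact: measurable_fun_pairP. Qed.

Lemma eq_cmeasurable f g : f =1 g -> cmeasurable f -> cmeasurable g.
Proof. by move=> /funext ->. Qed.

Lemma cmeasurable_cst z : cmeasurable (fun=> z).
Proof. by split; exact: measurable_cst. Qed.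

Lemma cmeasurable_real (h : T -> R) : measurable_fun setT h ->
  cmeasurable (fun t => (h t)%:C).
Proof. by move=> mh; split => //; exact: measurable_cst. Qed.

Lemma cmeasurableD f g : cmeasurable f -> cmeasurable g ->
  cmeasurable (fun t => f t + g t).
Proof.
move=> [f1 f2] [g1 g2]; split.
  have -> : (fun t => Re (f t + g t)) = (fun t => Re (f t)) \+ (fun t => Re (g t)).
    by apply/funext => t /=; case: (f t) (g t) => ? ? [].
  exact: measurable_funD.
have -> : (fun t => Im (f t + g t)) = (fun t => Im (f t)) \+ (fun t => Im (g t)).
  by apply/funext => t /=; case: (f t) (g t) => ? ? [].
exact: measurable_funD.
Qed.

Lemma cmeasurableM f g : cmeasurable f -> cmeasurable g ->
  cmeasurable (fun t => f t * g t).
Proof.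
move=> [f1 f2] [g1 g2]; split.
  have -> : (fun t => Re (f t * g t)) =
      (fun t => Re (f t) * Re (g t) - Im (f t) * Im (g t)).
    by apply/funext => t /=; case: (f t) (g t) => ? ? [].
  by apply: measurable_funB; exact: measurable_funM.
have -> : (fun t => Im (f t * g t)) =
    (fun t => Re (f t) * Im (g t) + Im (f t) * Re (g t)).
  by apply/funext => t /=; case: (f t) (g t) => ? ? [].
by apply: measurable_funD; exact: measurable_funM.
Qed.

Lemma cmeasurableN f : cmeasurable f -> cmeasurable (fun t => - f t).
Proof.
move=> mf; apply: (@eq_cmeasurable (fun t => -1 * f t)).
  by move=> t; rewrite mulN1r.
by apply: cmeasurableM => //; exact: cmeasurable_cst.
Qed.

Lemma cmeasurableB f g : cmeasurable f -> cmeasurable g ->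
  cmeasurable (fun t => f t - g t).
Proof. by move=> mf mg; apply: cmeasurableD => //; exact: cmeasurableN. Qed.

Lemma cmeasurable_conj f : cmeasurable f -> cmeasurable (fun t => (f t)^*).
Proof.
move=> [f1 f2]; split.
  have -> : (fun t => Re (f t)^*) = (fun t => Re (f t)).
    by apply/funext => t; case: (f t).
  exact: f1.
have -> : (fun t => Im (f t)^*) = \- (fun t => Im (f t)).
  by apply/funext => t /=; case: (f t).
exact: measurable_funN.
Qed.

Lemma measurable_normc_sqr f : cmeasurable f ->
  measurable_fun setT (fun t => Normc.normc (f t) ^+ 2).
Proof.
move=> [f1 f2].
under eq_fun do rewrite normc_sqrE.
by apply: measurable_funD; exact: measurable_funX.
Qed.

Lemma measurable_inv (h : T -> R) : measurable_fun setT h ->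
  (forall t, 0 <= h t) -> measurable_fun setT (fun t => (h t)^-1).
Proof.
move=> mh h0; have -> : (fun t => (h t)^-1) = (@powR R ^~ (-1)) \o h.
  by apply/funext => t /=; rewrite powR_inv1.
by apply: measurableT_comp => //; exact: measurable_powR.
Qed.

Lemma measurable_sqrt (h : T -> R) : measurable_fun setT h ->
  (forall t, 0 <= h t) -> measurable_fun setT (fun t => Num.sqrt (h t)).
Proof.
move=> mh h0; have -> : (fun t => Num.sqrt (h t)) = (@powR R ^~ (2^-1)) \o h.
  by apply/funext => t /=; rewrite powR12_sqrt.
by apply: measurableT_comp => //; exact: measurable_powR.
Qed.

Lemma measurable_normc f : cmeasurable f ->
  measurable_fun setT (fun t => Normc.normc (f t)).
Proof.
move=> mf.
have -> : (fun t => Normc.normc (f t)) =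
    (fun t => Num.sqrt (Normc.normc (f t) ^+ 2)).
  by apply/funext => t; rewrite sqrtr_sqr ger0_norm ?normc_ge0.
apply: measurable_sqrt; first exact: measurable_normc_sqr.
by move=> t; exact: sqr_ge0.
Qed.

(** The inverse is the conjugate divided by the squared modulus; at 0 both sides are 0 by
    convention. *)
Lemma cmeasurable_inv f : cmeasurable f -> cmeasurable (fun t => (f t)^-1).
Proof.
move=> mf; apply: (@eq_cmeasurable
    (fun t => (f t)^* * ((Normc.normc (f t) ^+ 2)^-1)%:C)).
  move=> t; have [->|f0] := eqVneq (f t) 0; first by rewrite Normc.normc0 expr0n !invr0 mulr0.
  apply: (mulfI f0); rewrite mulrA mulc_conj divff // -rmorphM /= divff //.
  rewrite sqrf_eq0; apply/eqP => /Normc.eq0_normc/eqP.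
  by rewrite (negPf f0).
apply: cmeasurableM; first exact: cmeasurable_conj.
apply: cmeasurable_real; apply: measurable_inv; first exact: measurable_normc_sqr.
by move=> t; exact: sqr_ge0.
Qed.

Lemma cmeasurable_sum (I : Type) (s : seq I) (c : pred I) (F : I -> T -> R[i]) :
  (forall i, c i -> cmeasurable (F i)) ->
  cmeasurable (fun t => \sum_(i <- s | c i) F i t).
Proof.
move=> mF; elim: s => [|i s IH].
  apply: (@eq_cmeasurable (fun=> 0)); last exact: cmeasurable_cst.
  by move=> t; rewrite big_nil.
have [ci|/negPf ci] := boolP (c i); last first.
  by apply: eq_cmeasurable IH => t; rewrite big_cons ci.
apply: (@eq_cmeasurable (fun t => F i t + \sum_(j <- s | c j) F j t)).
  by move=> t; rewrite big_cons ci.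
by apply: cmeasurableD => //; exact: mF.
Qed.

Lemma cmeasurable_prod (I : Type) (s : seq I) (c : pred I) (F : I -> T -> R[i]) :
  (forall i, c i -> cmeasurable (F i)) ->
  cmeasurable (fun t => \prod_(i <- s | c i) F i t).
Proof.
move=> mF; elim: s => [|i s IH].
  apply: (@eq_cmeasurable (fun=> 1)); last exact: cmeasurable_cst.
  by move=> t; rewrite big_nil.
have [ci|/negPf ci] := boolP (c i); last first.
  by apply: eq_cmeasurable IH => t; rewrite big_cons ci.
apply: (@eq_cmeasurable (fun t => F i t * \prod_(j <- s | c j) F j t)).
  by move=> t; rewrite big_cons ci.
by apply: cmeasurableM => //; exact: mF.
Qed.

Lemma cmeasurable_det n (A : T -> 'M[R[i]]_n) :
  (forall i j, cmeasurable (fun t => A t i j)) ->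
  cmeasurable (fun t => \det (A t)).
Proof.
move=> mA; rewrite /determinant; apply: cmeasurable_sum => s _.
apply: cmeasurableM; first exact: cmeasurable_cst.
by apply: cmeasurable_prod.
Qed.

(** By Cramer's formula the entries of the inverse are rational in those of the matrix. *)
Lemma cmeasurable_invmx n (A : T -> 'M[R[i]]_n) i j :
  (forall k l, cmeasurable (fun t => A t k l)) ->
  (forall t, A t \in unitmx) ->
  cmeasurable (fun t => invmx (A t) i j).
Proof.
move=> mA unitA; apply: (@eq_cmeasurable
    (fun t => (\det (A t))^-1 * cofactor (A t) j i)).
  by move=> t; rewrite /invmx unitA !mxE.
apply: cmeasurableM; first by apply: cmeasurable_inv; exact: cmeasurable_det.
apply: cmeasurableM; first exact: cmeasurable_cst.
apply: cmeasurable_det => k l.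
by apply: eq_cmeasurable (mA (lift j k) (lift i l)) => t; rewrite !mxE.
Qed.

(** Only the entries off row and column [i] are assumed measurable; this is what places the
    coefficients of the quadratic forms in the sigma-algebra independent of column [i]. *)
Lemma cmeasurable_minor_resolvent n (H : T -> 'M[R[i]]_n) i z k l :
  (forall t, hermitian (H t)) -> 0 < Im z ->
  (forall k l, k != i -> l != i -> cmeasurable (fun t => H t k l)) ->
  cmeasurable (fun t => minor_resolvent (H t) i z k l).
Proof.
move=> hH z0 mH; have [kl|kl] := boolP ((k == i) || (l == i)).
  apply: (@eq_cmeasurable (fun=> 0)); last exact: cmeasurable_cst.
  by move=> t; rewrite mxE kl.
apply: (@eq_cmeasurable (fun t => resolvent (minor (H t) i) z k l)).
  by move=> t; rewrite mxE (negPf kl).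
apply: cmeasurable_invmx; last first.
  by move=> t; apply: resolvent_unit => //; exact: minor_hermitian.
move=> p q; apply: (@eq_cmeasurable (fun t =>
    (if (p == i) || (q == i) then 0 else H t p q) - ((z%:M)%R : 'M[R[i]]_n) p q)).
  by move=> t; rewrite !mxE.
apply: cmeasurableB; last exact: cmeasurable_cst.
have [pq|] := boolP ((p == i) || (q == i)); first exact: cmeasurable_cst.
by rewrite negb_or => /andP[? ?]; exact: mH.
Qed.

End ComplexMeasurable.

Lemma cmeasurable_comp d d' (T : measurableType d) (T' : measurableType d')
    (R : realType) (f : T' -> R[i]) (g : T -> T') :
  cmeasurable f -> measurable_fun setT g -> cmeasurable (f \o g).
Proof.
move=> [f1 f2] mg; split; first exact: (measurableT_comp f1 mg).
exact: (measurableT_comp f2 mg).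
Qed.

(** * Independence of a column from the rest of the matrix *)

Section Cylinders.
Context d d' (T : measurableType d) (S : measurableType d') (R : realType).
Variables (P : probability T R) (I : finType) (X : I -> T -> S).
Hypotheses (mX : forall i, measurable_fun setT (X i))
  (indX : mutually_independent P X).
Implicit Types D : pred I.

(** A pi-system carrying the information of the variables indexed by [D]; mutual independence
    computes [P] directly on its members. *)
Definition cylinders D : set (set T) := [set A | exists B : I -> set S,
  [/\ forall i, measurable (B i), forall i, ~~ D i -> B i = setT &
      A = \bigcap_i X i @^-1` B i]].

Lemma cylinders_setT D : cylinders D setT.
Proof.
exists (fun=> setT); split => //.
by apply/seteqP; split.
Qed.

Lemma cylinders_setI D : setI_closed (cylinders D).
Proof.
move=> _ _ [B [mB BT ->]] [C [mC CT ->]].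
exists (fun i => B i `&` C i); split.
- by move=> i; exact: measurableI.
- by move=> i Di; rewrite BT // CT // setTI.
- by apply/seteqP; split=> t /=; [move=> [h1 h2] i _; split; [exact: h1|exact: h2]
    | move=> h; split=> i _; have [] := h i Logic.I].
Qed.

Lemma cylinders_preimage D i (B : set S) : D i -> measurable B ->
  cylinders D (X i @^-1` B).
Proof.
move=> Di mB; exists (fun j => if j == i then B else setT); split.
- by move=> j; case: ifP.
- by move=> j Dj; case: eqP => // ji; rewrite ji Di in Dj.
- apply/seteqP; split=> t /=; last by move=> /(_ i Logic.I); rewrite eqxx.
  by move=> Bt j _ /=; case: eqP => // ->.
Qed.

Let mpre i (B : set S) : measurable B -> measurable (X i @^-1` B).
Proof. by move=> mB; rewrite -[X in measurable X]setTI; exact: mX. Qed.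

Lemma cylinders_measurable D : cylinders D `<=` measurable.
Proof.
move=> _ [B [mB _ ->]]; apply: fin_bigcap_measurable; first exact: finite_finset.
by move=> i _; exact: mpre.
Qed.

Let cylinder_prob (B : I -> set S) : (forall i, measurable (B i)) ->
  P (\bigcap_i X i @^-1` B i) = (\prod_i P (X i @^-1` B i))%E.
Proof.
move=> mB; have := indX [set: I]%SET mB.
have -> : [set k | k \in [set: I]%SET] = setT.
  by apply/seteqP; split=> // k _; rewrite /= inE.
by move=> ->; apply: eq_bigl => i; rewrite inE.
Qed.

Lemma cylinders_independent D1 D2 A1 A2 : (forall i, D1 i -> ~~ D2 i) ->
  cylinders D1 A1 -> cylinders D2 A2 -> P (A1 `&` A2) = (P A1 * P A2)%E.
Proof.
move=> D12 [B [mB BT ->]] [C [mC CT ->]].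
have -> : \bigcap_i X i @^-1` B i `&` \bigcap_i X i @^-1` C i =
    \bigcap_i X i @^-1` (B i `&` C i).
  by apply/seteqP; split=> t /=; [move=> [h1 h2] i _; split; [exact: h1|exact: h2]
    | move=> h; split=> i _; have [] := h i Logic.I].
have mBC i : measurable (B i `&` C i) by exact: measurableI.
rewrite (cylinder_prob mB) (cylinder_prob mC) (cylinder_prob mBC).
rewrite -big_split /=; apply: eq_bigr => i _.
have [D1i|D1i] := boolP (D1 i).
  rewrite CT ?D12 // setIT preimage_setT.
  by rewrite (probability_setT P) mule1.
by rewrite BT // setTI preimage_setT (probability_setT P) mul1e.
Qed.

End Cylinders.

Section WignerColumn.
Context d (T : measurableType d) (R : realType) (P : probability T R).
Variables (theta C0 : R) (N : nat) (W : T -> 'M[R[i]]_N).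
Hypothesis wigW : wigner P theta C0 W.
Local Notation normc := (@Normc.normc R).
Local Notation index := {ij : 'I_N * 'I_N | (ij.1 <= ij.2)%N}.

Definition upper_entry (p : index) (t : T) : (measurableTypeR R * measurableTypeR R)%type :=
  reim (W t (val p).1 (val p).2).

Lemma upper_entry_measurable p : measurable_fun setT (upper_entry p).
Proof. exact: (wigner_measurable wigW). Qed.

Definition ordered_pair (k i : 'I_N) : 'I_N * 'I_N :=
  if (k <= i)%N then (k, i) else (i, k).

Lemma ordered_pairP k i : ((ordered_pair k i).1 <= (ordered_pair k i).2)%N.
Proof.
rewrite /ordered_pair; case: ifP => //= /negbT.
by rewrite -ltnNge => /ltnW.
Qed.

Definition entry_index k i : index := exist _ (ordered_pair k i) (ordered_pairP k i).

(** A column meets each symmetric pair of entries once, so independence of the upper triangle passes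
    to the column. *)
Lemma entry_index_inj i : injective (entry_index ^~ i).
Proof.
move=> k l /(congr1 val) /=; rewrite /ordered_pair.
by case: ifP => ki; case: ifP => li [] // -> // <-.
Qed.

Definition reim_conj (z : measurableTypeR R * measurableTypeR R) :
  (measurableTypeR R * measurableTypeR R)%type := (z.1, - (z.2 : R)).

Lemma measurable_reim_conj : measurable_fun setT reim_conj.
Proof.
apply: measurable_fun_pair; first exact: measurable_fst.
by apply: measurable_funN; exact: measurable_snd.
Qed.

Lemma entryE k i t : reim (W t k i) =
  (if (k <= i)%N then id else reim_conj) (upper_entry (entry_index k i) t).
Proof.
rewrite /upper_entry /= /ordered_pair; case: ifP => //= _.
by rewrite (wigner_hermitian wigW) /reim /reim_conj /=; case: (W t i k).
Qed.

Lemma entry_preimage k i (B : set (measurableTypeR R * measurableTypeR R)) :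
  measurable B -> exists2 C, measurable C &
    (fun t => reim (W t k i)) @^-1` B = upper_entry (entry_index k i) @^-1` C.
Proof.
move=> mB; case: (boolP (k <= i)%N) => ki.
  exists B => //; apply/seteqP; split=> t; rewrite /= entryE ki //.
exists (reim_conj @^-1` B).
  by rewrite -[X in measurable X]setTI; exact: measurable_reim_conj.
by apply/seteqP; split=> t; rewrite /= entryE (negPf ki).
Qed.

Lemma column_independent i :
  mutually_independent P (fun k => @reim R \o (fun t => W t k i)).
Proof.
move=> J B mB.
have /choice[C CP] : forall k, exists C : set (measurableTypeR R * measurableTypeR R),
    measurable C /\ (fun t => reim (W t k i)) @^-1` B k =
      upper_entry (entry_index k i) @^-1` C.
  by move=> k; have [C mC CE] := entry_preimage k i (mB k); exists C.
pose e k := entry_index k i.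
(* Indices outside the column receive the trivial constraint [setT]. *)
pose D (p : index) := if [pick k | e k == p] is Some k then C k else setT.
have De k : D (e k) = C k.
  rewrite /D; case: pickP => [l /eqP /entry_index_inj -> //|/(_ k)].
  by rewrite eqxx.
have mD p : measurable (D p).
  by rewrite /D; case: pickP => [k _|_] //; have [] := CP k.
have := wigner_independent wigW [set e k | k in J]%SET mD.
have -> : \bigcap_(p in [set p | p \in [set e k | k in J]%SET])
    (fun t => reim (W t (val p).1 (val p).2)) @^-1` D p =
    \bigcap_(k in [set k | k \in J]) (@reim R \o (fun t => W t k i)) @^-1` B k.
  apply/seteqP; split=> t h.
    move=> k /= kJ; have -> : B k (reim (W t k i)) =
      ((fun t => reim (W t k i)) @^-1` B k) t by [].
    have [_ ->] := CP k; rewrite -De; apply: (h (e k)).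
    by rewrite /=; apply/imsetP; exists k.
  move=> p /imsetP[k kJ ->] /=; rewrite De.
  have [_ CE] := CP k; have : ((fun t => reim (W t k i)) @^-1` B k) t by exact: h.
  by rewrite CE.
move=> ->; rewrite big_imset /=; last by move=> k l _ _; exact: entry_index_inj.
apply: eq_bigr => k _; have [_ CE] := CP k.
by rewrite De -[RHS]/(P ((fun t => reim (W t k i)) @^-1` B k)) CE.
Qed.

(** The model bounds the strict tail, whereas [centered_subexp] asks for the non-strict one; let [y]
    increase to [x]. *)
Lemma tail_le_of_lt (f : T -> R) (g : R -> R) (x : R) : 0 < x ->
  measurable_fun setT f -> {for x, continuous g} ->
  (forall y, 0 < y -> (P [set t | (y < f t)%R] <= (g y)%:E)%E) ->
  (P [set t | (x <= f t)%R] <= (g x)%:E)%E.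
Proof.
move=> x0 mf cg tail.
have mset y : measurable [set t | (y < f t)%R].
  have -> : [set t | (y < f t)%R] = setT `&` f @^-1` `]y, +oo[%classic.
    by rewrite setTI; apply/seteqP; split=> t; rewrite /= in_itv /= andbT.
  by apply: mf => //; exact: measurable_itv.
have mset' : measurable [set t | (x <= f t)%R].
  have -> : [set t | (x <= f t)%R] = setT `&` f @^-1` `[x, +oo[%classic.
    by rewrite setTI; apply/seteqP; split=> t; rewrite /= in_itv /= andbT.
  by apply: mf => //; exact: measurable_itv.
apply/lee_addgt0Pr => e e0.
have /nbhs_ballP[r /= r0 near_x] : \forall y \near x, g y < g x + e.
  by apply: (cg _ (lt_nbhsl _)); rewrite ltrDl.
pose y := Num.max (x / 2) (x - r / 2).
have y0 : 0 < y by rewrite lt_max divr_gt0.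
have yx : y < x by rewrite gt_max; apply/andP; split; lra.
have yr : x - r / 2 <= y by rewrite le_max lexx orbT.
have gy : g y < g x + e.
  by apply: near_x; rewrite /ball /= ltr_norml; apply/andP; split; lra.
apply: (@le_trans _ _ (P [set t | (y < f t)%R])).
  apply: le_measure; rewrite ?inE // => t /=; exact: lt_le_trans.
apply: le_trans (tail y y0) _.
by rewrite -EFinD lee_fin ltW.
Qed.

Lemma wigner_diag_real t i : complex.Im (W t i i) = 0.
Proof.
have := wigner_hermitian wigW t i i.
by case: (W t i i) => a b [] /eqP; rewrite -subr_eq0 opprK -mulr2n mulrn_eq0 /= => /eqP.
Qed.

Lemma cmeasurable_entry k i : cmeasurable (fun t => W t k i).
Proof. by apply/cmeasurable_reim; exact: (wigner_measurable wigW). Qed.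

Lemma entry_variance k i : (0 < N)%N ->
  ('E_P[fun t => (normc (W t k i) ^+ 2)%R] = (N%:R^-1)%:E)%E.
Proof.
move=> N0; have [->|ki] := eqVneq k i; last exact: (wigner_variance wigW).
have := congr1 (@complex.Re R) (wigner_diag wigW i) => /= E.
have -> : (fun t => (normc (W t i i) ^+ 2)%R) =
    (fun t => complex.Re (W t i i ^+ 2)).
  apply/funext => t; rewrite normc_sqrE expr2; have := wigner_diag_real t i.
  by case: (W t i i) => a b /= ->; rewrite expr2; ring.
(* [fine] sends infinite values to 0, so the nonzero value of the second moment shows that the
   expectation is finite. *)
have N1 : N%:R^-1 != 0 :> R by rewrite invr_eq0 pnatr_eq0 -lt0n.
by move: E N1; case: ('E_P[_])%E => [x /= ->|/= <-|/= <-] //; rewrite eqxx.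
Qed.

Lemma column_subexp k i : (0 < N)%N ->
  centered_subexp P theta C0 (Num.sqrt N%:R^-1) (fun t => W t k i).
Proof.
move=> N0; have N1 : (0 : R) < N%:R by rewrite ltr0n.
split.
- exact: (wigner_measurable wigW).
- exact: (wigner_centered wigW).
- by rewrite entry_variance // sqr_sqrtr // invr_ge0 ltW.
move=> x x0.
have -> : [set t | (x * Num.sqrt N%:R^-1 <= normc (W t k i))%R] =
    [set t | (x <= Num.sqrt N%:R * normc (W t k i))%R].
  by apply/seteqP; split=> t /=;
    rewrite sqrtrV ?ler0n // ler_pdivrMr ?sqrtr_gt0 // mulrC.
apply: (@tail_le_of_lt (fun t => Num.sqrt N%:R * normc (W t k i))
  (fun y => C0 * expR (- (y `^ theta^-1)))) => //.
- by apply: measurable_funM => //; apply: measurable_normc; exact: cmeasurable_entry.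
- apply: continuousM; first exact: cst_continuous.
  apply: continuous_comp; last exact: continuous_expR.
  apply: continuousN; apply: differentiable_continuous; apply/derivable1_diffP.
  by apply: derivable_powR; rewrite in_itv /= x0.
- by move=> y; exact: (wigner_tail wigW).
Qed.

End WignerColumn.

(** [X t s] is a form with coefficients read at [t] and column read at [s]. For fixed [t] the
    coefficients are constants, and decoupling restores [s = t]. *)
Lemma decoupled_deviation d (T : measurableType d) (R : realType)
    (P : probability T R) (G1 G2 : set (set T)) (S : T -> R)
    (X : T -> T -> R[i]) (c : R) (b : \bar R) :
  G1 `<=` measurable -> G2 `<=` measurable ->
  setI_closed G1 -> setI_closed G2 -> G1 setT -> G2 setT ->
  (forall A B, G1 A -> G2 B -> P (A `&` B) = (P A * P B)%E) ->
  measurable_fun setT (S : g_sigma_algebraType G1 -> R) -> (forall t, 0 <= S t) ->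
  cmeasurable (fun p : (g_sigma_algebraType G1 * g_sigma_algebraType G2)%type =>
    X p.1 p.2) ->
  (0 <= b)%E ->
  (forall t, 0 < S t ->
     (P [set s | (c * Num.sqrt (S t) <= Normc.normc (X t s))%R] <= b)%E) ->
  exists A : set T, [/\ measurable A, (P A <= b)%E &
    forall t, ~ A t -> 0 < S t -> Normc.normc (X t t) <= c * Num.sqrt (S t)].
Proof.
move=> m1 m2 I1 I2 T1 T2 P12 mS S0 mX b0 dev.
(* Restricted to [0 < S], since the deviation estimates assume coefficients that are not all
   zero. *)
pose E : set (g_sigma_algebraType G1 * g_sigma_algebraType G2) :=
  [set p | 0 < S p.1 /\ c * Num.sqrt (S p.1) <= Normc.normc (X p.1 p.2)].
have mS1 : measurable_fun setT
    (fun p : (g_sigma_algebraType G1 * g_sigma_algebraType G2)%type => S p.1).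
  exact: (measurableT_comp mS measurable_fst).
have mE : measurable E.
  have -> : E = (setT `&` (fun p => S p.1) @^-1` `]0, +oo[%classic) `&`
      (setT `&` (fun p => Normc.normc (X p.1 p.2) - c * Num.sqrt (S p.1))
        @^-1` `[0, +oo[%classic).
    by rewrite !setTI; apply/seteqP; split=> p /=; rewrite !in_itv /= !andbT subr_ge0.
  apply: measurableI; first by apply: mS1 => //; exact: measurable_itv.
  have mf : measurable_fun setT
      (fun p : (g_sigma_algebraType G1 * g_sigma_algebraType G2)%type =>
        Normc.normc (X p.1 p.2) - c * Num.sqrt (S p.1)).
    apply: measurable_funB; first exact: measurable_normc.
    by apply: measurable_funM => //; exact: measurable_sqrt.
  by apply: mf => //; exact: measurable_itv.
have Eb t : (P [set s : T | E (t, s)] <= b)%E.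
  have [St|St] := ltP 0 (S t).
    apply: le_trans (dev t St); rewrite le_eqVlt; apply/orP; left; apply/eqP.
    by congr (P _); apply/seteqP; split=> s /=; [case | split].
  rewrite [X in P X](_ : _ = set0) ?measure0 //.
  by apply/seteqP; split=> s //= -[/=]; rewrite ltNge St.
have [mA PA] := decoupling m1 m2 I1 I2 T1 T2 P12 mE Eb.
exists [set t | E (t, t)]; split => // t nE St.
by rewrite leNgt; apply/negP => /ltW ?; apply: nE.
Qed.

Section QuadraticDeviation.
Context d (T : measurableType d) (R : realType) (P : probability T R).
Variables (theta C0 lambda : R) (mu : probability (measurableTypeR R) R) (N : nat).
Variables (v : 'I_N -> T -> measurableTypeR R) (W : T -> 'M[R[i]]_N).
Hypothesis dw : deformed_wigner P theta C0 mu v W.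
Local Notation normc := (@Normc.normc R).
Local Notation Re := (@complex.Re R).
Local Notation Im := (@complex.Im R).
Local Notation index := {ij : 'I_N * 'I_N | (ij.1 <= ij.2)%N}.
Local Notation H := (hamiltonian lambda v W).
Let wigW := dw_wigner dw.

Lemma hamiltonianE t k l : H t k l =
  (if k == l then (lambda * v k t)%:C else 0) + W t k l.
Proof.
rewrite !mxE; case: eqVneq => [->|kl]; last by rewrite mulr0n mulr0.
by rewrite mulr1n rmorphM.
Qed.

Lemma hamiltonian_hermitian t : hermitian (H t).
Proof.
move=> k l; rewrite !hamiltonianE rmorphD /= (wigner_hermitian wigW t k l) eq_sym.
congr (_ + _); case: eqVneq => [->|_]; last by rewrite conjc0.
by rewrite conjc_real.
Qed.

Definition touches (i : 'I_N) (p : index) : bool :=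
  ((val p).1 == i) || ((val p).2 == i).

Definition column_sets i : set (set T) :=
  cylinders (@upper_entry _ T R N W) (touches i).

(** A pi-system for the potential together with the entries off row and column [i]. Keeping a
    potential event and a cylinder as separate factors lets independence be checked in two stages,
    first [v] against [W], then inside [W]. *)
Definition rest_sets i : set (set T) := [set A | exists A1 A2,
  [/\ sigma_generated v A1,
      cylinders (@upper_entry _ T R N W) (fun p => ~~ touches i p) A2 &
      A = A1 `&` A2]].

Let mW := upper_entry_measurable wigW.
Let indW : mutually_independent P (@upper_entry _ T R N W) :=
  wigner_independent wigW.

Let vgen : set (set T) := [set A | exists j B, measurable B /\ A = v j @^-1` B].

Let vgen_measurable : sigma_generated v `<=` (measurable : set (set T)).
Proof.
apply: smallest_sub; first exact: sigma_algebra_measurable.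
move=> _ [j [B [mB ->]]]; rewrite -[X in measurable X]setTI.
exact: (iid_measurable (dw_potential dw)).
Qed.

Let vgenI : setI_closed (sigma_generated v).
Proof.
by move=> A B vA vB; exact: (@measurableI _ (g_sigma_algebraType vgen) A B vA vB).
Qed.

Let vgenT : sigma_generated v setT.
Proof. exact: (@measurableT _ (g_sigma_algebraType vgen)). Qed.

Let wgen : set (set T) :=
  [set A | exists (ij : 'I_N * 'I_N) B, measurable B /\
     A = (fun t => reim (W t ij.1 ij.2)) @^-1` B].

Let cylinders_wgen D : cylinders (@upper_entry _ T R N W) D `<=` <<s wgen >>.
Proof.
move=> _ [B [mB _ ->]].
apply: (@fin_bigcap_measurable _ (g_sigma_algebraType wgen)).
  exact: finite_finset.
by move=> p _; apply: sub_gen_smallest; exists (val p), (B p).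
Qed.

Let restT i : rest_sets i setT.
Proof.
by exists setT, setT; split; [exact: vgenT|exact: cylinders_setT|rewrite setIT].
Qed.

Let restI i : setI_closed (rest_sets i).
Proof.
move=> _ _ [A1 [A2 [vA cA ->]]] [B1 [B2 [vB cB ->]]].
exists (A1 `&` B1), (A2 `&` B2); split; last by rewrite setIACA.
  exact: vgenI.
exact: cylinders_setI.
Qed.

Let rest_measurable i : rest_sets i `<=` measurable.
Proof.
move=> _ [A1 [A2 [vA cA ->]]]; apply: measurableI; first exact: vgen_measurable.
exact: cylinders_measurable cA.
Qed.

Let column_measurable i : column_sets i `<=` measurable.
Proof. exact: cylinders_measurable. Qed.

Let rest_column i A B : rest_sets i A -> column_sets i B ->
  P (A `&` B) = (P A * P B)%E.
Proof.
move=> [A1 [A2 [vA cA ->]]] cB.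
have VW := dw_independent dw.
have cAB : P (A2 `&` B) = (P A2 * P B)%E.
  exact: (cylinders_independent indW (fun p h => h) cA cB).
rewrite -setIA VW //; last first.
  apply: (@measurableI _ (g_sigma_algebraType wgen)).
    exact: cylinders_wgen cA.
  exact: cylinders_wgen cB.
rewrite (VW A1 A2) //; last exact: cylinders_wgen cA.
by rewrite cAB muleA.
Qed.

Let mH i k l : k != i -> l != i ->
  cmeasurable (fun t : g_sigma_algebraType (rest_sets i) => H t k l).
Proof.
move=> ki li.
have mv : measurable_fun setT (v k : g_sigma_algebraType (rest_sets i) -> measurableTypeR R).
  move=> _ B mB; rewrite setTI; apply: sub_gen_smallest.
  exists (v k @^-1` B), setT; split; last by rewrite setIT.
    by apply: sub_gen_smallest; exists k, B.
  exact: cylinders_setT.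
apply: (@eq_cmeasurable _ (g_sigma_algebraType (rest_sets i)) R
    (fun t => (if k == l then (lambda * v k t)%:C else 0) + W t k l)).
  by move=> t; rewrite hamiltonianE.
apply: cmeasurableD.
  case: eqP => _; last exact: cmeasurable_cst.
  by apply: cmeasurable_real; exact: measurable_funM.
apply/cmeasurable_reim => _ B mB; rewrite setTI.
have [C mC CE] := entry_preimage wigW k l mB.
rewrite [X in measurable X](_ : _ = upper_entry W (entry_index k l) @^-1` C) //.
apply: sub_gen_smallest; exists setT, (upper_entry W (entry_index k l) @^-1` C).
split; [exact: vgenT| |by rewrite setTI].
apply: cylinders_preimage => //; rewrite /touches /= /ordered_pair.
by case: ifP => _; rewrite negb_or ki li.
Qed.

Let mcol i k : cmeasurable (fun t : g_sigma_algebraType (column_sets i) => W t k i).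
Proof.
apply/cmeasurable_reim => _ B mB; rewrite setTI.
have [C mC CE] := entry_preimage wigW k i mB.
rewrite [X in measurable X](_ : _ = upper_entry W (entry_index k i) @^-1` C) //.
apply: sub_gen_smallest; apply: cylinders_preimage => //.
by rewrite /touches /= /ordered_pair; case: ifP => _; rewrite /= eqxx ?orbT.
Qed.

Variables (K : R) (b : \bar R) (i : 'I_N) (z : R[i]).
Hypotheses (N_gt0 : (0 < N)%N) (z_gt0 : 0 < Im z) (b_ge0 : (0 <= b)%E).
Let sigma : R := Num.sqrt N%:R^-1.
Let B t := minor_resolvent (H t) i z.

Let sigma2 : sigma ^+ 2 = N%:R^-1.
Proof. by rewrite sqr_sqrtr // invr_ge0 ler0n. Qed.

(** Column [i] of [H] and of [W] differ only at the diagonal entry, which the coefficients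
    annihilate. *)
Let column_off t (M : 'M[R[i]]_N) k l : (k = i -> M k l = 0) -> (l = i -> M k l = 0) ->
  (H t k i)^* * M k l * H t l i = (W t k i)^* * M k l * W t l i.
Proof.
move=> Mk Ml; have [ki|ki] := eqVneq k i; first by rewrite Mk // !mulr0 !mul0r.
have [li|li] := eqVneq l i; first by rewrite Ml // !mulr0 !mul0r.
by rewrite !hamiltonianE (negPf ki) (negPf li) !add0r.
Qed.

Let B_row t k l : k = i -> B t k l = 0.
Proof. by move=> ->; rewrite mxE eqxx. Qed.

Let B_col t k l : l = i -> B t k l = 0.
Proof. by move=> ->; rewrite mxE eqxx orbT. Qed.

Let mB k l : cmeasurable (fun t : g_sigma_algebraType (rest_sets i) => B t k l).
Proof.
apply: cmeasurable_minor_resolvent => //; last by move=> p q; exact: mH.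
exact: hamiltonian_hermitian.
Qed.

Let mB1 k l : cmeasurable (fun p : (g_sigma_algebraType (rest_sets i) *
  g_sigma_algebraType (column_sets i))%type => B p.1 k l).
Proof. exact: (cmeasurable_comp (mB k l) measurable_fst). Qed.

Let mcol2 k : cmeasurable (fun p : (g_sigma_algebraType (rest_sets i) *
  g_sigma_algebraType (column_sets i))%type => W p.2 k i).
Proof. exact: (cmeasurable_comp (mcol i k) measurable_snd). Qed.

Lemma diag_deviation :
  (forall D : 'I_N -> 'I_N -> R[i],
     let S := \sum_k normc (D k k) ^+ 2 in 0 < S ->
     (P [set t | (K * sigma ^+ 2 * Num.sqrt S <=
             normc (\sum_k (W t k i)^* * D k k * W t k i
                      - \sum_k (sigma ^+ 2)%:C * D k k))%R] <= b)%E) ->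
  exists A : set T, [/\ measurable A, (P A <= b)%E & forall t, ~ A t ->
    normc (\sum_k (H t k i)^* * B t k k * H t k i - N%:R^-1%:C * \sum_k B t k k)
      <= K * N%:R^-1 * Num.sqrt (\sum_k normc (B t k k) ^+ 2)].
Proof.
move=> lde.
have mX : cmeasurable (fun p : (g_sigma_algebraType (rest_sets i) *
    g_sigma_algebraType (column_sets i))%type =>
    \sum_k (W p.2 k i)^* * B p.1 k k * W p.2 k i
      - \sum_k (sigma ^+ 2)%:C * B p.1 k k).
  apply: cmeasurableB; last first.
    by apply: cmeasurable_sum => k _; apply: cmeasurableM; [exact: cmeasurable_cst|exact: mB1].
  apply: cmeasurable_sum => k _; apply: cmeasurableM => //.
  by apply: cmeasurableM; [exact: cmeasurable_conj|exact: mB1].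
have [A [mA PA devA]] := @decoupled_deviation _ T R P (rest_sets i) (column_sets i)
  (fun t => \sum_k normc (B t k k) ^+ 2)
  (fun t s => \sum_k (W s k i)^* * B t k k * W s k i
              - \sum_k (sigma ^+ 2)%:C * B t k k) (K * sigma ^+ 2) b
  (@rest_measurable i) (@column_measurable i) (@restI i)
  (@cylinders_setI _ _ _ _ _ _ (touches i))
  (restT i) (@cylinders_setT _ _ _ _ _ _ (touches i)) (@rest_column i)
  (measurable_sum _ (fun k => measurable_normc_sqr (mB k k)))
  (fun t => sumr_ge0 _ (fun k _ => sqr_ge0 _)) mX b_ge0 (fun t => lde (B t)).
exists A; split => // t nA; have := devA t nA.
have -> : \sum_k (H t k i)^* * B t k k * H t k i = \sum_k (W t k i)^* * B t k k * W t k i.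
  by apply: eq_bigr => k _; apply: column_off; [exact: B_row|exact: B_col].
rewrite sigma2 -mulr_sumr.
have : 0 <= \sum_k normc (B t k k) ^+ 2.
  by apply: sumr_ge0 => k _; exact: sqr_ge0.
rewrite le_eqVlt => /orP[/eqP S0 _|S0]; last exact.
rewrite -S0 sqrtr0 mulr0.
have B0 k : B t k k = 0.
  move/esym/eqP: S0; rewrite psumr_eq0 => [|j _]; last exact: sqr_ge0.
  move=> /allP /(_ k); rewrite mem_index_enum => /(_ isT) /=.
  by rewrite sqrf_eq0 => /eqP /Normc.eq0_normc.
rewrite !big1 ?mulr0 ?subr0 ?Normc.normc0 // => k _; rewrite B0 //.
by rewrite mulr0 mul0r.
Qed.

Lemma off_diag_deviation :
  (forall D : 'I_N -> 'I_N -> R[i],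
     let S := \sum_k \sum_(l | k != l) normc (D k l) ^+ 2 in 0 < S ->
     (P [set t | (K * sigma ^+ 2 * Num.sqrt S <=
             normc (\sum_k \sum_(l | k != l) (W t k i)^* * D k l * W t l i))%R] <= b)%E) ->
  exists A : set T, [/\ measurable A, (P A <= b)%E & forall t, ~ A t ->
    normc (\sum_k \sum_(l | k != l) (H t k i)^* * B t k l * H t l i)
      <= K * N%:R^-1 * Num.sqrt (\sum_k \sum_(l | k != l) normc (B t k l) ^+ 2)].
Proof.
move=> lde.
have nn t k : 0 <= \sum_(l | k != l) normc (B t k l) ^+ 2.
  by apply: sumr_ge0 => l _; exact: sqr_ge0.
have mS : measurable_fun setT (fun t : g_sigma_algebraType (rest_sets i) =>
    \sum_k \sum_(l | k != l) normc (B t k l) ^+ 2).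
  rewrite (_ : (fun t => _) = (fun t : g_sigma_algebraType (rest_sets i) =>
      \sum_k \sum_l if k != l then normc (B t k l) ^+ 2 else 0)).
    apply: measurable_sum => k; apply: measurable_sum => l.
    have [kl|kl] := boolP (k != l); last exact: measurable_cst.
    exact: measurable_normc_sqr.
  by apply/funext => t; apply: eq_bigr => k _; rewrite big_mkcond.
have mX : cmeasurable (fun p : (g_sigma_algebraType (rest_sets i) *
    g_sigma_algebraType (column_sets i))%type =>
    \sum_k \sum_(l | k != l) (W p.2 k i)^* * B p.1 k l * W p.2 l i).
  apply: cmeasurable_sum => k _; apply: cmeasurable_sum => l _.
  apply: cmeasurableM => //.
  by apply: cmeasurableM; [exact: cmeasurable_conj|exact: mB1].
have [A [mA PA devA]] := @decoupled_deviation _ T R P (rest_sets i) (column_sets i)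
  (fun t => \sum_k \sum_(l | k != l) normc (B t k l) ^+ 2)
  (fun t s => \sum_k \sum_(l | k != l) (W s k i)^* * B t k l * W s l i)
  (K * sigma ^+ 2) b
  (@rest_measurable i) (@column_measurable i) (@restI i)
  (@cylinders_setI _ _ _ _ _ _ (touches i))
  (restT i) (@cylinders_setT _ _ _ _ _ _ (touches i)) (@rest_column i)
  mS
  (fun t => sumr_ge0 _ (fun k _ => nn t k)) mX b_ge0 (fun t => lde (B t)).
exists A; split => // t nA; have := devA t nA.
have -> : \sum_k \sum_(l | k != l) (H t k i)^* * B t k l * H t l i =
    \sum_k \sum_(l | k != l) (W t k i)^* * B t k l * W t l i.
  apply: eq_bigr => k _; apply: eq_bigr => l _.
  by apply: column_off; [exact: B_row|exact: B_col].
rewrite sigma2.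
have : 0 <= \sum_k \sum_(l | k != l) normc (B t k l) ^+ 2.
  by apply: sumr_ge0 => k _; exact: nn.
rewrite le_eqVlt => /orP[/eqP S0 _|S0]; last exact.
rewrite -S0 sqrtr0 mulr0.
have B0 k l : k != l -> B t k l = 0.
  move=> kl; move/esym/eqP: S0; rewrite psumr_eq0 => [|j _]; last exact: nn.
  move=> /allP /(_ k); rewrite mem_index_enum => /(_ isT) /=.
  rewrite psumr_eq0 => [|j _]; last exact: sqr_ge0.
  move=> /allP /(_ l); rewrite mem_index_enum => /(_ isT) /=.
  by rewrite kl sqrf_eq0 => /eqP /Normc.eq0_normc.
rewrite big1 ?Normc.normc0 // => k _; rewrite big1 // => l kl.
by rewrite B0 // mulr0 mul0r.
Qed.

End QuadraticDeviation.

(** * Delocalization *)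

(** The crude Frobenius bound is enough: any polynomial bound on the spectrum keeps the energy grid
    polynomial. *)
Lemma eigenvalue_bound (R : rcfType) N (H : 'M[R[i]]_N) (e a : R)
    (u : 'cV[R[i]]_N) : 0 <= a -> H *m u = e%:C *: u ->
  \sum_k Normc.normc (u k 0) ^+ 2 = 1 ->
  (forall k l, Normc.normc (H k l) <= a) -> `|e| <= N%:R * a.
Proof.
move=> a0 Hu u1 Ha.
rewrite -(@ler_pXn2r _ 2) ?nnegrE ?mulr_ge0 ?ler0n //.
have -> : `|e| ^+ 2 = \sum_k Normc.normc ((H *m u) k 0) ^+ 2.
  rewrite Hu -[LHS]mulr1 -u1 mulr_sumr; apply: eq_bigr => k _.
  by rewrite mxE Normc.normcM exprMn normc_real.
apply: (@le_trans _ _ (\sum_(k < N) N%:R * a ^+ 2)).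
  apply: ler_sum => k _; rewrite mxE.
  apply: le_trans (cauchy_schwarz_normc (H k) (fun l => u l 0)) _.
  rewrite u1 mulr1; apply: (@le_trans _ _ (\sum_(l < N) a ^+ 2)).
    by apply: ler_sum => l _; rewrite lerXn2r ?nnegrE ?normc_ge0.
  by rewrite sumr_const card_ord mulr_natl.
by rewrite sumr_const card_ord -[leLHS]mulr_natl exprMn mulrA -expr2.
Qed.

Section Sample.
Variables (R : realType) (N : nat) (H : 'M[R[i]]_N) (x : 'I_N -> R) (K eps c a : R).
Local Notation normc := (@Normc.normc R).
Local Notation eta0 := (K ^+ 6 / N%:R).
Local Notation J := (N ^ 3)%N.

(** For [j] up to [2 N^3] these energies have spacing [eta0] and cover [-N^2, N^2], since
    [eta0 >= 1 / N] when [K >= 1]; the spectrum lies there because entries are at most [a <= N]. *)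
Definition grid_energy (j : nat) : R := (j%:R - J%:R) * eta0.

Definition grid_point (j k : nat) : R[i] :=
  grid_energy j +i* (k.+1%:R * eta0).

Hypotheses (N_gt0 : (0 < N)%N) (hH : hermitian H).
Hypotheses (eps01 : 0 < eps <= 1) (c01 : 0 < c <= 1) (K_eps : 40 / eps <= K)
  (K_c : 40 / c <= K) (K_N : K ^+ 4 <= N%:R) (a_N : 0 <= a <= N%:R).
Hypothesis stable : forall w : R[i], 0 < complex.Im w ->
  \sum_i normc ((x i)%:C - w) ^- 2 <= (1 + eps) * N%:R ->
  forall i, c <= normc ((x i)%:C - w).
Hypothesis entries : forall k l, normc (H k l) <= a.
Hypothesis diag_entries : forall i, normc (H i i - (x i)%:C) <= K / Num.sqrt N%:R.
Hypothesis diag_dev : forall (i : 'I_N) (j : 'I_(J.*2.+1)) (k : 'I_N.+1),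
  let B := minor_resolvent H i (grid_point j k) in
  normc (\sum_k (H k i)^* * B k k * H k i - N%:R^-1%:C * \sum_k B k k)
    <= K * N%:R^-1 * Num.sqrt (\sum_k normc (B k k) ^+ 2).
Hypothesis off_diag_dev : forall (i : 'I_N) (j : 'I_(J.*2.+1)) (k : 'I_N.+1),
  let B := minor_resolvent H i (grid_point j k) in
  normc (\sum_k \sum_(l | k != l) (H k i)^* * B k l * H l i)
    <= K * N%:R^-1 * Num.sqrt (\sum_k \sum_(l | k != l) normc (B k l) ^+ 2).

Lemma eigenvector_delocalized (e : R) (u : 'cV[R[i]]_N) i :
  H *m u = e%:C *: u -> \sum_k normc (u k 0) ^+ 2 = 1 ->
  normc (u i 0) <= K ^+ 4 / Num.sqrt N%:R.
Proof.
move=> Hu u1; have [eps0 eps1] := andP eps01; have [c0 c1] := andP c01.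
have [a0 aN] := andP a_N.
have K40 : 40 <= K.
  by apply: le_trans K_c; rewrite ler_pdivlMr // ger_pMr.
have K0 : 0 < K by lra.
have K1 : 1 <= K by lra.
have NR : (0 : R) < N%:R by rewrite ltr0n.
have NR1 : (1 : R) <= N%:R by rewrite ler1n.
have eta_gt0 : 0 < eta0 by rewrite divr_gt0 // exprn_gt0.
have eta_ge : N%:R^-1 <= eta0.
  by rewrite ler_peMl ?invr_ge0 ?(ltW NR) // exprn_ege1.
have eN := eigenvalue_bound a0 Hu u1 entries.
have eJ : `|e| <= J%:R * eta0.
  apply: (@le_trans _ _ (N%:R * N%:R)).
    by apply: le_trans eN _; rewrite ler_wpM2l // ltW.
  apply: (@le_trans _ _ (J%:R * N%:R^-1)); last by rewrite ler_wpM2l.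
  by rewrite natrX exprS expr2 mulrAC -mulrA mulKf ?gt_eqF //.
pose y := e / eta0 + J%:R.
have eE : e = (y - J%:R) * eta0 by rewrite /y addrK divfK // gt_eqF.
have [y0 y2] : 0 <= y /\ y <= (J.*2)%:R.
  move: eJ; rewrite ler_norml => /andP[e1 e2].
  have h1 : - J%:R <= e / eta0 by rewrite ler_pdivlMr // mulNr.
  have h2 : e / eta0 <= J%:R by rewrite ler_pdivrMr.
  by rewrite /y -addnn natrD; split; lra.
(* The grid energy just below [e], within one spacing; the spacing equals the lowest height. *)
pose j := Num.trunc y.
have /andP[jy yj] := truncn_itv y0.
have jJ : (j < J.*2.+1)%N.
  by rewrite ltnS -(ler_nat R); apply: le_trans y2.
have jS : j.+1%:R = j%:R + 1 :> R by rewrite -natr1.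
have close : `|e - complex.Re (grid_point j 0)| <= complex.Im (grid_point j 0).
  rewrite /= /grid_energy mul1r {1}eE -mulrBl normrM (gtr0_norm eta_gt0).
  rewrite ger_pMl // ler_norml.
  by rewrite jS in yj; apply/andP; split; lra.
have z0 (k : 'I_N.+1) : 0 < complex.Im (grid_point j k).
  by rewrite /= mulr_gt0 // ltr0n.
have bound (k : nat) : (k <= N)%N -> schur_bound H x K (grid_point j k).
  move=> kN; have kN' : (k < N.+1)%N by [].
  apply: schur_bound_deviations => //.
  - exact: (z0 (Ordinal kN')).
  - by move=> i'; exact: (diag_dev i' (Ordinal jJ) (Ordinal kN')).
  - by move=> i'; exact: (off_diag_dev i' (Ordinal jJ) (Ordinal kN')).
have top : 1 <= N.+1%:R * eta0.
  apply: (@le_trans _ _ (N%:R * N%:R^-1)); first by rewrite divff // gt_eqF.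
  by apply: ler_pM; rewrite ?invr_ge0 ?ler0n // ler_nat.
have G := @resolvent_diag_bound R N H x K eps c hH eps0 eps1 c0 c1 K_eps K_c K_N
  stable (grid_energy j) eta0 N erefl top bound i.
have z00 : 0 < complex.Im (grid_point j 0) by exact: (z0 ord0).
have uG := @eigenvector_resolvent R N H (grid_point j 0) e u i hH z00 Hu u1 close.
have zE : grid_point j 0 = grid_energy j +i* eta0 by rewrite /grid_point mul1r.
rewrite zE /= in uG.
rewrite -(@ler_pXn2r _ 2) ?nnegrE ?normc_ge0 ?divr_ge0 ?sqrtr_ge0 ?exprn_ge0 ?(ltW K0) //.
apply: le_trans uG _.
apply: (@le_trans _ _ (2 * eta0 * (2 / c))).
  by rewrite ler_wpM2l // mulr_ge0 // ltW.
have -> : (K ^+ 4 / Num.sqrt N%:R) ^+ 2 = K ^+ 8 / N%:R.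
  by rewrite expr_div_n sqr_sqrtr ?ler0n // -exprM.
have -> : 2 * eta0 * (2 / c) = K ^+ 6 * (4 / c) / N%:R by field; rewrite !gt_eqF.
rewrite ler_pM2r ?invr_gt0 // (_ : K ^+ 8 = K ^+ 6 * K ^+ 2); last by rewrite -exprD.
rewrite ler_pM2l ?exprn_gt0 //.
(* The spare factor K ^ 2 absorbs the constant 4 / c. *)
apply: (@le_trans _ _ K); last by rewrite expr2 ler_peMr // ltW.
by apply: le_trans K_c; rewrite ler_pM2r ?invr_gt0 //; lra.
Qed.

End Sample.

Lemma union_bound_cst d (T : measurableType d) (R : realType)
    (P : probability T R) (I : eqType) (s : seq I) (A : I -> set T) (b : R) :
  (forall i, measurable (A i)) -> (forall i, (P (A i) <= b%:E)%E) ->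
  exists U : set T, [/\ measurable U, (P U <= ((size s)%:R * b)%:E)%E &
    forall t, ~ U t -> forall i, i \in s -> ~ A i t].
Proof.
move=> mA PA; exists (\big[setU/set0]_(i <- s) A i); split.
- exact: bigsetU_measurable.
- apply: le_trans (union_bound P s predT mA) _.
  apply: (@le_trans _ _ (\sum_(i <- s) b%:E)%E); first exact: lee_sum.
  by rewrite sumEFin lee_fin big_const_seq count_predT iter_addr addr0 mulr_natl.
- move=> t; elim: s => // i s IH; rewrite big_cons => /not_orP[nA nU] j.
  by rewrite inE => /orP[/eqP ->|] //; exact: IH.
Qed.

(** * The exceptional event and its probability *)

Section DelocalizationEvent.
Context d (T : measurableType d) (R : realType) (P : probability T R).
Variables (theta C0 lambda : R) (mu : probability (measurableTypeR R) R) (N : nat).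
Variables (v : 'I_N -> T -> measurableTypeR R) (W : T -> 'M[R[i]]_N).
Hypothesis dw : deformed_wigner P theta C0 mu v W.
Local Notation normc := (@Normc.normc R).
Local Notation H := (hamiltonian lambda v W).
Local Notation sigma := (Num.sqrt N%:R^-1 : R).
Variables (K eps c delta b : R) (Bs : seq (set R)).
Hypotheses (N_gt0 : (0 < N)%N) (lambda_gt0 : 0 < lambda) (delta_gt0 : 0 < delta)
  (b_ge0 : 0 <= b).
Hypotheses (eps01 : 0 < eps <= 1) (c01 : 0 < c <= 1) (K_eps : 40 / eps <= K)
  (K_c : 40 / c <= K) (K_N : K ^+ 4 <= N%:R) (lambda_N : lambda + 1 <= N%:R).
Hypothesis mBs : forall B, B \in Bs -> measurable (B : set (measurableTypeR R)).
Hypothesis mu_out : mu (~` `[-1, 1]%classic : set (measurableTypeR R)) = 0%E.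
Hypothesis stable : forall x : 'I_N -> R, (forall i, -1 <= x i <= 1) ->
  typical mu Bs delta x -> forall w, 0 < complex.Im w ->
  \sum_i normc ((lambda * x i)%:C - w) ^- 2 <= (1 + eps) * N%:R ->
  forall i, c <= normc ((lambda * x i)%:C - w).
Hypothesis lde_linear : forall i (D : 'I_N -> R[i]),
  let S := \sum_k normc (D k) ^+ 2 in 0 < S ->
  (P [set t | (K * sigma * Num.sqrt S <= normc (\sum_k D k * W t k i))%R] <= b%:E)%E.
Hypothesis lde_diag : forall i (D : 'I_N -> 'I_N -> R[i]),
  let S := \sum_k normc (D k k) ^+ 2 in 0 < S ->
  (P [set t | (K * sigma ^+ 2 * Num.sqrt S <=
     normc (\sum_k (W t k i)^* * D k k * W t k i
            - \sum_k (sigma ^+ 2)%:C * D k k))%R] <= b%:E)%E.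
Hypothesis lde_off_diag : forall i (D : 'I_N -> 'I_N -> R[i]),
  let S := \sum_k \sum_(l | k != l) normc (D k l) ^+ 2 in 0 < S ->
  (P [set t | (K * sigma ^+ 2 * Num.sqrt S <=
     normc (\sum_k \sum_(l | k != l) (W t k i)^* * D k l * W t l i))%R] <= b%:E)%E.
Let wigW := dw_wigner dw.

Let sigmaE : sigma = (Num.sqrt N%:R)^-1.
Proof. by rewrite sqrtrV ?ler0n. Qed.

Let entry_event : exists U : set T, [/\ measurable U,
  (P U <= ((N ^ 2)%:R * b)%:E)%E &
  forall t, ~ U t -> forall k i, normc (W t k i) <= K / Num.sqrt N%:R].
Proof.
pose A (p : 'I_N * 'I_N) : set T :=
  [set t | K / Num.sqrt N%:R <= normc (W t p.1 p.2)].
have mA p : measurable (A p).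
  have -> : A p = setT `&` (fun t => normc (W t p.1 p.2)) @^-1`
      `[K / Num.sqrt N%:R, +oo[%classic.
    by rewrite setTI; apply/seteqP; split=> t; rewrite /A /= in_itv /= andbT.
  have mf := measurable_normc (cmeasurable_entry wigW p.1 p.2).
  by apply: mf => //; exact: measurable_itv.
have PA p : (P (A p) <= b%:E)%E.
  (* A coefficient vector supported at one index turns the linear estimate into a bound on a single
     entry. *)
  pose D (k : 'I_N) : R[i] := if k == p.1 then 1 else 0.
  have DS : \sum_k normc (D k) ^+ 2 = 1.
    rewrite (bigD1 p.1) //= /D eqxx Normc.normc1 expr1n big1 ?addr0 // => k /negPf ->.
    by rewrite Normc.normc0 expr0n.
  have := lde_linear p.2 (D := D); rewrite DS => /(_ ltr01).
  rewrite sqrtr1 mulr1 sigmaE.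
  have E t : \sum_k D k * W t k p.2 = W t p.1 p.2.
    rewrite (bigD1 p.1) //= /D eqxx mul1r big1 ?addr0 // => k /negPf ->.
    by rewrite mul0r.
  by under eq_set do rewrite E.
have [U [mU PU nU]] := @union_bound_cst _ _ _ P _ (enum {: 'I_N * 'I_N}) A b mA PA.
exists U; split => //.
  by move: PU; rewrite -cardE card_prod card_ord -mulnn.
move=> t nUt k i; rewrite leNgt; apply/negP => /ltW h.
by apply: (nU t nUt (k, i)) => //; rewrite mem_enum.
Qed.

Local Notation J := (N ^ 3)%N.
Local Notation site := ('I_N * 'I_(J.*2.+1) * 'I_N.+1)%type.

Let site_point (p : site) : R[i] := grid_point N K p.1.2 p.2.

Let site_gt0 p : 0 < complex.Im (site_point p).
Proof.
have K0 : 0 < K by apply: lt_le_trans K_c; rewrite divr_gt0 //; case/andP: c01.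
by rewrite /= mulr_gt0 ?ltr0n // divr_gt0 ?exprn_gt0 ?ltr0n.
Qed.

Let card_site : size (enum {: site}) = (N * J.*2.+1 * N.+1)%N.
Proof. by rewrite -cardE !card_prod !card_ord. Qed.

Let diag_event : exists U : set T, [/\ measurable U,
  (P U <= ((N * J.*2.+1 * N.+1)%:R * b)%:E)%E &
  forall t, ~ U t -> forall p : site,
    let B := minor_resolvent (H t) p.1.1 (site_point p) in
    normc (\sum_k (H t k p.1.1)^* * B k k * H t k p.1.1
           - N%:R^-1%:C * \sum_k B k k)
      <= K * N%:R^-1 * Num.sqrt (\sum_k normc (B k k) ^+ 2)].
Proof.
have /choice[A AP] := fun p : site => @diag_deviation _ T R P theta C0 lambda mu N
  v W dw K b%:E p.1.1 (site_point p) (site_gt0 p) b_ge0 (lde_diag p.1.1).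
have [U [mU PU nU]] := @union_bound_cst _ _ _ P _ (enum {: site}) A b
  (fun p => let: And3 mA _ _ := AP p in mA) (fun p => let: And3 _ PA _ := AP p in PA).
exists U; split => //; first by rewrite -card_site.
move=> t nUt p; have [_ _] := AP p; apply.
by apply: (nU t nUt); rewrite mem_enum.
Qed.

Let off_diag_event : exists U : set T, [/\ measurable U,
  (P U <= ((N * J.*2.+1 * N.+1)%:R * b)%:E)%E &
  forall t, ~ U t -> forall p : site,
    let B := minor_resolvent (H t) p.1.1 (site_point p) in
    normc (\sum_k \sum_(l | k != l) (H t k p.1.1)^* * B k l * H t l p.1.1)
      <= K * N%:R^-1 * Num.sqrt (\sum_k \sum_(l | k != l) normc (B k l) ^+ 2)].
Proof.
have /choice[A AP] := fun p : site => @off_diag_deviation _ T R P theta C0 lambda mu N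
  v W dw K b%:E p.1.1 (site_point p) (site_gt0 p) b_ge0 (lde_off_diag p.1.1).
have [U [mU PU nU]] := @union_bound_cst _ _ _ P _ (enum {: site}) A b
  (fun p => let: And3 mA _ _ := AP p in mA) (fun p => let: And3 _ PA _ := AP p in PA).
exists U; split => //; first by rewrite -card_site.
move=> t nUt p; have [_ _] := AP p; apply.
by apply: (nU t nUt); rewrite mem_enum.
Qed.

Let support_event : exists U : set T, [/\ measurable U, P U = 0%E &
  forall t, ~ U t -> forall i, -1 <= v i t <= 1].
Proof.
have [mv lawv _] := dw_potential dw.
pose C : set (measurableTypeR R) := ~` `[-1, 1]%classic.
have mC : measurable C by apply: measurableC; exact: measurable_itv.
have mA i : measurable (v i @^-1` C).
  by rewrite -[X in measurable X]setTI; exact: mv.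
have PA i : (P (v i @^-1` C) <= 0%:E)%E by rewrite lawv // mu_out.
have [U [mU PU nU]] := @union_bound_cst _ _ _ P _ (enum 'I_N)
  (fun i => v i @^-1` C) 0 mA PA.
exists U; split => //.
  by apply/eqP; rewrite eq_le measure_ge0 andbT; move: PU; rewrite mulr0.
move=> t nUt i; have := nU t nUt i; rewrite mem_enum => /(_ isT) /contrapT.
by rewrite /= in_itv.
Qed.

Let typical_event : exists U : set T, [/\ measurable U,
  (P U <= ((size Bs)%:R * expR (- (delta ^+ 2 / 4 * N%:R)))%:E)%E &
  forall t, ~ U t -> typical mu Bs delta (fun i => v i t)].
Proof.
have /choice[A AP] : forall B : set R, exists A : set T, [/\ measurable A,
    (P A <= (expR (- (delta ^+ 2 / 4 * N%:R)))%:E)%E & B \in Bs ->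
    forall t, ~ A t -> N%:R * (fine (mu (B : set (measurableTypeR R))) - delta)
      <= \sum_i (\1_B (v i t) : R)].
  move=> B; have [BB|BB] := boolP (B \in Bs).
    have [A [mA nA PA]] := count_lower_tail (dw_potential dw) (mBs BB) delta_gt0.
    by exists A.
  (* [choice] ranges over all sets [B]; those outside [Bs] get the empty event. *)
  by exists set0; split => //; rewrite measure0 lee_fin expR_ge0.
have [U [mU PU nU]] := @union_bound_cst _ _ _ P _ Bs A _
  (fun p => let: And3 mA _ _ := AP p in mA) (fun p => let: And3 _ PA _ := AP p in PA).
exists U; split => // t nUt B BB; have [_ _] := AP B; apply => //.
exact: nU.
Qed.

(** The exceptional set is built before any eigenvector is mentioned, so the bound holds for every
    choice of eigenvectors, without any measurability of that choice. *)
Lemma delocalization_event : exists U : set T, [/\ measurable U,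
  (P U <= ((N ^ 2 + (N * J.*2.+1 * N.+1).*2)%:R * b +
     (size Bs)%:R * expR (- (delta ^+ 2 / 4 * N%:R)))%:E)%E &
  forall t, ~ U t -> forall (e : R) (u : 'cV[R[i]]_N) i,
    H t *m u = e%:C *: u -> \sum_k normc (u k 0) ^+ 2 = 1 ->
    normc (u i 0) <= K ^+ 4 / Num.sqrt N%:R].
Proof.
have [U1 [m1 P1 n1]] := entry_event; have [U2 [m2 P2 n2]] := diag_event.
have [U3 [m3 P3 n3]] := off_diag_event; have [U4 [m4 P4 n4]] := support_event.
have [U5 [m5 P5 n5]] := typical_event.
exists ((((U1 `|` U2) `|` U3) `|` U4) `|` U5).
have m12 := measurableU _ _ m1 m2; have m123 := measurableU _ _ m12 m3.
have m1234 := measurableU _ _ m123 m4.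
split; first exact: measurableU.
  apply: le_trans (measureU2 P m1234 m5) _; rewrite EFinD; apply: leeD => //.
  have P4' : (P U4 <= 0)%E by rewrite P4.
  apply: le_trans (measureU2 P m123 m4) _.
  rewrite -[leRHS]adde0; apply: leeD P4'.
  apply: le_trans (measureU2 P m12 m3) _.
  rewrite -addnn !natrD addrA !mulrDl 2!EFinD; apply: leeD => //.
  by apply: le_trans (measureU2 P m1 m2) _; exact: leeD.
move=> t /not_orP[/not_orP[/not_orP[/not_orP[/n1 h1 /n2 h2] /n3 h3] /n4 h4] /n5 h5].
(* Entries are at most [lambda + 1]: the potential is at most 1 in modulus, and K / sqrt N <= 1
   because K ^ 4 <= N. *)
move=> e u i; apply: (@eigenvector_delocalized R N (H t) (fun i => lambda * v i t)
  K eps c (lambda + 1)) => //.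
- exact: (hamiltonian_hermitian _ dw).
- by rewrite lambda_N andbT; move: lambda_gt0; lra.
- by move=> w w0; exact: stable.
- move=> k l; rewrite hamiltonianE; apply: le_trans (ler_normcD _ _) _.
  apply: lerD; last first.
    apply: le_trans (h1 k l) _; rewrite ler_pdivrMr ?sqrtr_gt0 ?ltr0n // mul1r.
    have K0 : 0 < K by apply: lt_le_trans K_c; rewrite divr_gt0 //; case/andP: c01.
    have K1 : 1 <= K.
      case/andP: c01 => c0 c1; apply: le_trans K_c; rewrite ler_pdivlMr //.
      by rewrite mul1r; lra.
    rewrite -[leLHS](ger0_norm (ltW K0)) -sqrtr_sqr ler_wsqrtr //.
    by apply: le_trans K_N; rewrite ler_weXn2l.
  case: eqP => _; last by rewrite Normc.normc0 ltW.
  rewrite normc_real normrM (gtr0_norm lambda_gt0) ler_piMr ?(ltW lambda_gt0) //.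
  by rewrite ler_norml h4.
- by move=> k; rewrite hamiltonianE eqxx addrAC subrr add0r.
- by move=> i' j k; exact: (h2 (i', j, k)).
- by move=> i' j k; exact: (h3 (i', j, k)).
Qed.

End DelocalizationEvent.

(** * Asymptotics and conclusion *)

Lemma law_outside (R : realType) (mu : probability (measurableTypeR R) R)
    (f : R -> R) : has_density mu f -> (forall v, v \notin `[-1, 1] -> f v = 0) ->
  mu (~` `[-1, 1]%classic : set (measurableTypeR R)) = 0%E.
Proof.
move=> [_ _ muE] f0; rewrite muE; last first.
  by apply: measurableC; exact: measurable_itv.
apply: integral0_eq => v nv; rewrite f0 //; exact/negP.
Qed.

Lemma near_lnln_ge (R : realType) (y : R) : \forall N \near \oo, y <= ln (ln N%:R).
Proof.
near=> N.
have N_ge : expR (expR y) <= N%:R by near: N; exact: nbhs_infty_ger.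
have N0 : (0 : R) < N%:R by apply: lt_le_trans N_ge; exact: expR_gt0.
have lnN : expR y <= ln N%:R.
  by rewrite -[leLHS]expRK ler_ln ?posrE ?expR_gt0.
have l0 : 0 < ln N%:R :> R by apply: lt_le_trans lnN; exact: expR_gt0.
by rewrite -[leLHS]expRK ler_ln ?posrE ?expR_gt0.
Unshelve. all: by end_near.
Qed.

Lemma site_count N : (13 <= N)%N ->
  (N ^ 2 + (N * (N ^ 3).*2.+1 * N.+1).*2 <= N ^ 6)%N.
Proof.
move=> N13; have N1 : (1 <= N)%N by exact: leq_trans N13.
have N3 : (1 <= N ^ 3)%N by rewrite expn_gt0 N1.
have h : ((N * (N ^ 3).*2.+1 * N.+1).*2 <= 12 * N ^ 5)%N.
  apply: (@leq_trans (2 * (N * (3 * N ^ 3) * (2 * N)))); last by rewrite !expnS; lia.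
  rewrite -mul2n leq_mul2l /=; apply: leq_mul; last by lia.
  by rewrite leq_mul2l; apply/orP; right; lia.
have h2 : (N ^ 2 <= N ^ 5)%N by rewrite leq_exp2l //; lia.
apply: (@leq_trans (13 * N ^ 5)); first by lia.
by rewrite [(N ^ 6)%N]expnS leq_mul2r N13 orbT.
Qed.

(* Written in terms of [y = ln (ln N)], so that [ln N = exp y]: [K] is at most
   [exp (Cphi A0 y ^ 2)], which is smaller than any power of [N], while
   [(ln N) ^ xi] lies between [(ln N) ^ 2] and [sqrt N]. *)
Lemma asymptotic_bounds (R : realType) (A0 Cphi kappa g M : R) :
  1 <= A0 -> 1 <= Cphi -> 0 < g -> 0 <= M ->
  exists Y : R, forall (N : nat) (xi : R), Y <= ln (ln N%:R) ->
    2 < xi -> xi <= A0 * ln (ln N%:R) ->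
    [/\ kappa <= varphi Cphi N `^ xi, (varphi Cphi N `^ xi) ^+ 4 <= N%:R &
      (N ^ 2 + (N * (N ^ 3).*2.+1 * N.+1).*2)%:R * expR (- (ln N%:R `^ xi)) +
      M * expR (- (g * N%:R)) <= expR (- (2^-1 * ln N%:R `^ xi))].
Proof.
move=> A01 C1 g0 M0.
(* The number 14 gives L^2 / 2 >= 7 L >= 6 L + 1 for L = ln N, which beats the N ^ 6 of the union
   bound; the term in [kappa] gives the lower bound on K, that in [Cphi * A0] gives K ^ 4 <= N, and
   the last one handles the Chernoff term. *)
exists (14 + `|kappa| + 24 * (Cphi * A0) + 2 * (2 + M) / g).
move=> N xi; set y := ln (ln N%:R) => Yy xi2 xiA.
have q0 : 0 <= 2 * (2 + M) / g by rewrite divr_ge0 ?mulr_ge0 ?(ltW g0) //; lra.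
have CA1 : 1 <= Cphi * A0 by nra.
have k0 := normr_ge0 kappa; have kk := ler_norm kappa.
have y14 : 14 <= y by lra.
have yk : kappa <= y by lra.
have yCA : 24 * (Cphi * A0) <= y by lra.
have yg : 2 * (2 + M) / g <= y by lra.
have L0 : 0 < ln N%:R :> R.
  by rewrite ltNge; apply/negP => /ln0 h; move: y14; rewrite /y h; lra.
have N0 : (0 : R) < N%:R.
  by rewrite ltNge; apply/negP => /ln0 h; move: L0; rewrite h ltxx.
have LE : ln N%:R = expR y :> R by rewrite /y lnK.
have NE : N%:R = expR (ln N%:R) :> R by rewrite lnK.
pose L : R := ln N%:R.
have Ly : 1 + y ^+ 3 / 6 <= L.
  have := @expR_ge1Dxn R y 2; rewrite /L LE; apply; lra.
have y2 : 4 * (Cphi * A0) * y ^+ 2 <= L.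
  have : 24 * (Cphi * A0) * y ^+ 2 <= y ^+ 3 by rewrite exprS ler_wpM2r ?sqr_ge0.
  lra.
have y3 : 14 * y ^+ 2 <= y ^+ 3 by rewrite exprS ler_wpM2r ?sqr_ge0.
have L14 : 14 <= L by nra.
have Ly1 : y <= L by nra.
have KE : varphi Cphi N `^ xi = expR (Cphi * xi * y).
  by rewrite /varphi -powRrM {1}/powR gt_eqF.
have XE : ln N%:R `^ xi = expR (xi * y) by rewrite {1}/powR gt_eqF.
have xy : 2 * y <= xi * y by rewrite ler_wpM2r //; lra.
have xyA : xi * y <= A0 * y ^+ 2 by rewrite expr2 mulrA ler_wpM2r //; lra.
split.
- rewrite KE; apply: le_trans (expR_ge1Dx _).
  have : 1 * (xi * y) <= Cphi * (xi * y) by rewrite ler_wpM2r //; lra.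
  by rewrite mulrA; lra.
- rewrite KE -expRM_natl [leRHS]NE ler_expR -/L; apply: le_trans y2.
  have : Cphi * (xi * y) <= Cphi * (A0 * y ^+ 2) by rewrite ler_wpM2l //; lra.
  by rewrite !mulrA; lra.
rewrite XE; set X := expR (xi * y).
have XL : L ^+ 2 <= X by rewrite /L LE -expRM_natl ler_expR; lra.
pose s := expR (L / 2).
have Xs : X <= s.
  rewrite ler_expR.
  have : 1 * (A0 * y ^+ 2) <= Cphi * (A0 * y ^+ 2).
    by rewrite ler_wpM2r // mulr_ge0 ?sqr_ge0 //; lra.
  rewrite mulrA in y2 *; lra.
have sN : N%:R = s ^+ 2 :> R.
  by rewrite /s -expRM_natl [LHS]NE; congr expR; rewrite -/L; field.
have s1 : 1 + L / 2 <= s by exact: expR_ge1Dx.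
have N13 : (13 <= N)%N.
  have : 1 + L <= N%:R by rewrite [leRHS]NE expR_ge1Dx.
  move=> h; rewrite -(ler_nat R); lra.
(* Each of the two terms will be at most 1 / e times the target. *)
have e2 : 2 * expR (-1) <= 1 :> R.
  have := @expR_ge1Dx R 1; rewrite expRN => h.
  by rewrite ler_pdivrMr ?expR_gt0 //; lra.
have half u : u <= - (2^-1 * X) - 1 -> expR u <= expR (- (2^-1 * X)) * expR (-1).
  by move=> h; rewrite -expRD ler_expR.
have h1 : (N ^ 2 + (N * (N ^ 3).*2.+1 * N.+1).*2)%:R * expR (- X) <=
    expR (- (2^-1 * X)) * expR (-1).
  apply: (@le_trans _ _ (N%:R ^+ 6 * expR (- X))).
    by rewrite ler_wpM2r ?expR_ge0 // -natrX ler_nat site_count.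
  rewrite NE -expRM_natl -expRD; apply: half; rewrite -/L; nra.
have h2 : M * expR (- (g * N%:R)) <= expR (- (2^-1 * X)) * expR (-1).
  apply: (@le_trans _ _ (expR M * expR (- (g * N%:R)))).
    by rewrite ler_wpM2r ?expR_ge0 //; have := expR_ge1Dx M; lra.
  rewrite -expRD; apply: half; rewrite sN.
  have gs : 2 + M <= g * s.
    move: yg; rewrite ler_pdivrMr // => h.
    have : (y / 2) * g <= s * g by rewrite ler_wpM2r ?(ltW g0) //; lra.
    lra.
  have : 1 * (2 + M) <= s * (g * s - 1 / 2 + 1 / 2) by nra.
  nra.
have := expR_ge0 (- (2^-1 * X)); nra.
Qed.

Local Close Scope complex_scope.

Theorem theorem2p15 (R : realType) (theta C0 lambda0 E0 a0 A0 Cphi : R)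
    (mu : probability (measurableTypeR R) R)
    (theta_gt1 : 1 < theta) (C0_gt0 : 0 < C0)
    (lambda0_gt0 : 0 < lambda0) (E0_ge : 3 + lambda0 <= E0)
    (a0_gt2 : 2 < a0) (A0_ge10 : 10 <= A0) (Cphi_ge1 : 1 <= Cphi)
    (lde : large_deviation_estimates theta C0 a0 A0 Cphi)
    (mu_centered : (\int[mu]_v (v : R)%:E = 0)%E)
    (mu_support : msupport mu = `[-1, 1]%classic)
    (mu_admissible : forall lambda, coupling_domain lambda0 lambda ->
       admissible_law lambda mu) :
  exists nu : R, 0 < nu /\
    forall lambda : R, coupling_domain lambda0 lambda ->
    forall (d : nat -> measure_display) (T : forall N, measurableType (d N))
      (P : forall N, probability (T N) R)
      (v : forall N, 'I_N -> T N -> measurableTypeR R)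
      (W : forall N, T N -> 'M[R[i]]_N),
      (forall N, (0 < N)%N -> deformed_wigner (P N) theta C0 mu (v N) (W N)) ->
    forall (e : forall N, T N -> 'I_N -> R)
      (u : forall N, T N -> 'I_N -> 'cV[R[i]]_N),
      (forall N t, (0 < N)%N ->
         eigen_system (hamiltonian lambda (v N) (W N) t) (e N t) (u N t)) ->
    forall xi : nat -> R,
      (\forall N \near \oo, a0 < xi N /\ xi N <= A0 * ln (ln N%:R)) ->
    high_probability xi nu P
      (fun N => [set t |
         \big[Num.max/0]_(al < N) \big[Num.max/0]_(i < N)
             Normc.normc (u N t al i 0)
           <= varphi Cphi N `^ (4 * xi N) / Num.sqrt N%:R]).
Proof.
(* The other half of the exponent pays for the number of events in the union bound. *)
exists 2^-1; split; first by rewrite invr_gt0.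
move=> lambda dom d T P v W dwN e u eig xi xiP.
have [l0 ll0] := dom.
have [c [eps [delta [Bs [c01 eps01 delta0 mBs stable]]]]] :=
  empirical_stability l0 (fun s => law_dispersion mu_admissible mu_centered dom (s := s)).
have [N1 _ ldeN] := lde.
have mu_out : mu (~` `[-1, 1]%classic : set (measurableTypeR R)) = 0%E.
  (* A coupling at most 1, for which admissibility provides a density vanishing off [-1, 1]. *)
  have dom1 : coupling_domain lambda0 (Num.min 1 lambda0).
    by split; [rewrite lt_min ltr01 | rewrite ge_min lexx orbT].
  have [+ _] := mu_admissible _ dom1.
  by rewrite ge_min lexx => /(_ isT)[f [df _ _ f0]]; exact: law_outside df f0.
have A01 : 1 <= A0 by lra.
have g0 : 0 < delta ^+ 2 / 4 by rewrite divr_gt0 // exprn_gt0.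
have [Y YP] := @asymptotic_bounds R A0 Cphi (40 / eps + 40 / c) _ (size Bs)%:R
  A01 Cphi_ge1 g0 (ler0n _ _).
have [eps0 _] := andP eps01; have [c0 _] := andP c01.
near=> N.
have N0 : (0 < N)%N by near: N; exists 1%N.
have lambdaN : lambda + 1 <= N%:R by near: N; exact: nbhs_infty_ger.
have YN : Y <= ln (ln N%:R) by near: N; exact: near_lnln_ge.
have [xi_gt xi_le] : a0 < xi N /\ xi N <= A0 * ln (ln N%:R) by near: N.
have N1N : (N1 <= N)%N by near: N; exists N1.
have [K_ge K_N prob_le] := YP N (xi N) YN (lt_trans a0_gt2 xi_gt) xi_le.
have dwN0 := dwN N N0; have wigN := dw_wigner dwN0.
have sigma0 : 0 < Num.sqrt N%:R^-1 :> R by rewrite sqrtr_gt0 invr_gt0 ltr0n.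
have LD i := ldeN N N1N (xi N) (ltW xi_gt) xi_le (d N) (T N) (P N) _ sigma0
  (fun k t => W N t k i) (fun k => column_subexp wigN k i N0)
  (column_independent wigN i).
have q1 : 0 < 40 / eps by rewrite divr_gt0.
have q2 : 0 < 40 / c by rewrite divr_gt0.
have [U [mU PU nU]] := @delocalization_event _ _ _ (P N) theta C0 lambda mu N (v N)
  (W N) dwN0 (varphi Cphi N `^ xi N) eps c delta (expR (- (ln N%:R `^ xi N))) Bs
  N0 l0 delta0 (expR_ge0 _) eps01 c01 (le_trans (ltW (ltr_pwDr q2 (lexx _))) K_ge)
  (le_trans (ltW (ltr_pwDl q1 (lexx _))) K_ge) K_N lambdaN mBs mu_out (stable N)
  (fun i D => let: And4 h _ _ _ := LD i in h D)
  (fun i D => let: And4 _ h _ _ := LD i in h D)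
  (fun i D => let: And4 _ _ h _ := LD i in h D).
exists U; split => //.
  move=> t; apply: contra_notP => nUt /=.
  have [_ _ eig_vec eig_norm] := eig N t N0.
  have bound al i : Normc.normc (u N t al i 0) <=
      varphi Cphi N `^ (4 * xi N) / Num.sqrt N%:R.
    rewrite [4 * _]mulrC powRrM powR_mulrn ?powR_ge0 //.
    exact: (nU t nUt (e N t al)).
  have rhs0 : 0 <= varphi Cphi N `^ (4 * xi N) / Num.sqrt N%:R.
    by rewrite divr_ge0 ?powR_ge0 ?sqrtr_ge0.
  apply: bigmax_le => // al _; apply: bigmax_le => // i _.
by apply: le_trans PU _; rewrite lee_fin.
Unshelve. all: by end_near.
Qed.
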